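(* Fix $k\ge2$, $c>0$ and $\zeta=\zeta_n\in(0,1]$ with $\limsup_n\zeta_n(k-1)c^{k-1}<e$. Let $G=G_n=(V,E)$ be a sequence of asymptotically tree-like $k$-uniform hypergraphs on $N$ vertices with maximum degree $\Delta$, and let $\lambda\sim c\Delta^{-\frac1{k-1}}$. Let $\mathbf x^\ast$ be the unique fixed point of $F^G_{c,\zeta}$ and, for $t\in(0,c]$, $\mathbf x^\ast(t)$ the unique fixed point of $F^G_{t,\zeta}$. Then: (i) for each $v\in V$, $\mu_{G,\lambda,\zeta}(v\in\mathbf S)\sim x_v^\ast\Delta^{-\frac1{k-1}}$; (ii) for each $e\in E$, $\mu_{G,\lambda,\zeta}(e\subseteq\mathbf S)\sim(1-\zeta)\prod_{v\in e}\left(x_v^\ast\Delta^{-\frac1{k-1}}\right)$; (iii) $\Delta^{\frac1{k-1}}\log Z_G(\lambda,\zeta)\sim\sum_{v\in V}\int_0^c\frac{x_v^\ast(t)}{t}\,dt$; (iv) $\Delta^{\frac1{k-1}}N^{-1}\log Z_G(\lambda,\zeta)=N^{-1}\mathcal B^G_{c,\zeta}(\mathbf x^\ast)+o(1)$; (v) $\mathrm{var}_{G,\lambda,\zeta}(|\mathbf S|)=o(N^2\Delta^{-\frac2{k-1}})$ and $\mathrm{var}_{G,\lambda,\zeta}(|E(\mathbf S)|)=o(N^2\Delta^{-\frac2{k-1}})$.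
   Context: Hypergraphs are simple. For a hypergraph $G$ and $S\subseteq V(G)$, $d_G(S)=|\{e\in E(G):S\subseteq e\}|$, $\Delta_\ell(G)=\max_{|S|=\ell}d_G(S)$, $\Delta(G)=\Delta_1(G)$ the maximum degree, and $\Gamma(G)$ is the maximum over distinct $v,v'$ of the number of $(k-1)$-sets $S$ with $S\cup\{v\},S\cup\{v'\}\in E(G)$. A sequence $(G_n)$ of $k$-uniform hypergraphs is asymptotically tree-like if, with $G=G_n$, $\Delta=\Delta(G)$, as $n\to\infty$: (1) $\Delta\to\infty$; (2) $\Delta_\ell(G)=o(\Delta^{\frac{k-\ell}{k-1}})$ for each $\ell\in\{2,\dots,k-1\}$; (3) $\Gamma(G)=o(\Delta)$; (4) $|E(G)|/|V(G)|=\Omega(\Delta)$. The edge-penalty model $\mu_{G,\lambda,\zeta}(S)=\lambda^{|S|}(1-\zeta)^{|E(S)|}/Z_G(\lambda,\zeta)$ for $S\subseteq V$, $E(S)=\{e\in E:e\subseteq S\}$, $Z_G(\lambda,\zeta)=\sum_{S\subseteq V}\lambda^{|S|}(1-\zeta)^{|E(S)|}$; $\mathbf S$ is a sample. $(F^G_{c,\zeta}(\mathbf x))_v=c\exp\left(-\frac{\zeta}{\Delta}\sum_{e\ni v}\prod_{u\in e\setminus\{v\}}x_u\right)$, and $\mathcal B^G_{c,\zeta}(\mathbf x)=-\frac{\zeta}{\Delta}\sum_{e\in E}\prod_{u\in e}x_u-\sum_{v\in V}x_v\left[\log\frac{x_v}c-1\right]$. *)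

(* Defs.v *)
From HB Require Import structures.
From mathcomp Require Import all_boot all_order all_algebra.
From mathcomp Require Import all_classical all_reals all_analysis.
Set Implicit Arguments. Unset Strict Implicit. Unset Printing Implicit Defensive.
Import Order.TTheory GRing.Theory Num.Theory.
Local Open Scope ring_scope.

Record hgraph := HGraph { hN : nat; hE : {set {set 'I_hN}} }.

Definition uniform (k : nat) (G : hgraph) : Prop :=
  forall e, e \in hE G -> #|e| = k.

Definition degS (G : hgraph) (S : {set 'I_(hN G)}) : nat :=
  #|[set e in hE G | S \subset e]|.

Definition Delta_l (G : hgraph) (l : nat) : nat :=
  \max_(S : {set 'I_(hN G)} | #|S| == l) degS S.

Definition Delta (G : hgraph) : nat := Delta_l G 1.

Definition Gamma (k : nat) (G : hgraph) : nat :=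
  \max_(vv : 'I_(hN G) * 'I_(hN G) | vv.1 != vv.2)
     #|[set S : {set 'I_(hN G)} | [&& #|S| == k.-1,
                                     (vv.1 |: S) \in hE G & (vv.2 |: S) \in hE G]]|.

Section Asymp.
Variable R : realType.

Definition evn (P : nat -> Prop) : Prop := exists n0, forall n, (n0 <= n)%N -> P n.

Definition seq_o (f g : nat -> R) : Prop :=
  forall eps : R, 0 < eps -> evn (fun n => `|f n| <= eps * `|g n|).

Definition seq_asymp (f g : nat -> R) : Prop := seq_o (fun n => f n - g n) g.

End Asymp.

Definition tree_like (R : realType) (k : nat) (G : nat -> hgraph) : Prop :=
  [/\ (forall M : R, evn (fun n => M <= (Delta (G n))%:R)),
      (forall l : nat, (2 <= l <= k.-1)%N ->
         seq_o (fun n => ((Delta_l (G n) l)%:R : R))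
                 (fun n => powR (Delta (G n))%:R ((k - l)%:R / (k.-1)%:R))),
      seq_o (fun n => ((Gamma k (G n))%:R : R)) (fun n => (Delta (G n))%:R)
    & (exists C : R, 0 < C /\
         evn (fun n => C * (Delta (G n))%:R <= (#|hE (G n)|)%:R / (hN (G n))%:R))].

Definition Dpow (R : realType) (k : nat) (G : hgraph) : R :=
  powR (Delta G)%:R (- ((k.-1)%:R)^-1).

Definition Fmap (R : realType) (G : hgraph) (c zeta : R) (x : 'I_(hN G) -> R)
  (v : 'I_(hN G)) : R :=
  c * expR (- (zeta / (Delta G)%:R) *
            \sum_(e in hE G | v \in e) \prod_(u in e :\ v) x u).

Definition is_fixed (R : realType) (G : hgraph) (c zeta : R) (x : 'I_(hN G) -> R) : Prop :=
  forall v, Fmap c zeta x v = x v.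

Definition Bfun (R : realType) (G : hgraph) (c zeta : R) (x : 'I_(hN G) -> R) : R :=
  - (zeta / (Delta G)%:R) * (\sum_(e in hE G) \prod_(u in e) x u)
  - \sum_(v : 'I_(hN G)) x v * (ln (x v / c) - 1).

Definition Eof (G : hgraph) (S : {set 'I_(hN G)}) : {set {set 'I_(hN G)}} :=
  [set e in hE G | e \subset S].

Definition weight (R : realType) (G : hgraph) (lam zeta : R) (S : {set 'I_(hN G)}) : R :=
  lam ^+ #|S| * (1 - zeta) ^+ #|Eof S|.

Definition Zpart (R : realType) (G : hgraph) (lam zeta : R) : R :=
  \sum_(S : {set 'I_(hN G)}) weight lam zeta S.

Definition muP (R : realType) (G : hgraph) (lam zeta : R) (P : pred {set 'I_(hN G)}) : R :=
  (\sum_(S : {set 'I_(hN G)} | P S) weight lam zeta S) / Zpart G lam zeta.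

Definition mexp (R : realType) (G : hgraph) (lam zeta : R) (f : {set 'I_(hN G)} -> R) : R :=
  (\sum_(S : {set 'I_(hN G)}) f S * weight lam zeta S) / Zpart G lam zeta.

Definition mvar (R : realType) (G : hgraph) (lam zeta : R) (f : {set 'I_(hN G)} -> R) : R :=
  mexp lam zeta (fun S => f S ^+ 2) - (mexp lam zeta f) ^+ 2.

(* Main.v *)
Require Import Defs.
From HB Require Import structures.
From mathcomp Require Import all_boot all_order all_algebra.
From mathcomp Require Import all_classical all_reals all_analysis.
From mathcomp Require Import ring lra zify.
Import Order.TTheory GRing.Theory Num.Theory.
Local Open Scope ring_scope.

(* Write [beta = lam / c ~ Delta^(-1/(k-1))].  Pinning the vertices of [A] and
   penalising only the edges of [F] gives partition functions with
     Z(A, F + e) = Z(A, F) - zeta Z(A + e, F),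
   so the odds of a vertex [v], divided by [lam], are a product over the edges at
   [v] of factors [1 - zeta Q_e], where [Q_e] is close to [lam^(k-1)] times the
   product of the odds ratios of the other vertices of [e]: tree-likeness makes
   the exceptional edges at [v] number only [o(Delta)].  In terms of
   [T_v = -(k-1) ln(odds ratio)] the recursion reads
     T_v = (C / Delta) sum_(e at v) exp (- average of T over e \ v) + o(1),
   with [C = zeta (k-1) t^(k-1) < e], and its exact solution is given by the
   fixed point.  For [a = 2 - ln C > 1] the map contracts the distance
   [max |ln (a + T) - ln (a + T')|] by the factor [(1 + C) / (a + C)], so finitely
   many levels suffice, and
     P(W in S) ~ (1 - zeta)^(number of edges in W) prod_(w in W) (x_w beta)
   whenever [#|W| <= 2k], uniformly in [t <= c] at activity [t beta].  This yields
   (i) and (ii), and (v) by summing covariances.  For (iii) and (iv),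
   [t |-> ln Z(t beta) / beta] has derivative [E|S| / (t beta)], close to
   [sum_v x_v(t) / t]; the Bethe functional at [x(t)] has exactly this
   derivative, because [x(t)] is a stationary point of it and is Lipschitz in [t]. *)

(** * Pinned partition functions *)

(** The map [T |-> C * expR (- T)] has slope [- C] at [T = 0], so for [1 < C < e] it is no
    contraction in the ordinary distance, although its fixed point is attracting; this is why
    distances are measured through [ln (a + T)]. Closeness in this metric means
    [a + T <= expR M * (a + T')], a linear condition that averaging over [e :\ v] preserves, so a
    one-variable inequality serves for every [k]. The other obstacle is that each level of the
    recursion pins further vertices and switches off further edges. A state therefore records only
    how many vertices are pinned and how many edges avoiding them are missing. The edges removed on
    the way down contain a newly pinned vertex, so the second number never grows, and the first
    grows by at most [k] per level. As the number of levels depends only on [k], [a] and the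
    required precision, the error allowed per step can be fixed after it. *)

Section PinnedPartition.
Import mathcomp.boot.fintype mathcomp.boot.finset.
Variables (R : realType) (V : finType) (lam zeta : R).
Implicit Types (A S W e : {set V}) (F : {set {set V}}).

Definition inner F S : {set {set V}} := [set e in F | e \subset S].
Definition off F v : {set {set V}} := [set e in F | v \notin e].
Definition wt F S : R := lam ^+ #|S| * (1 - zeta) ^+ #|inner F S|.
Definition Zin A F : R := \sum_(S : {set V} | A \subset S) wt F S.

Lemma wt_setU1 F e S : e \notin F ->
  wt (e |: F) S = wt F S - zeta * (if e \subset S then wt F S else 0).
Proof.
move=> eF; rewrite /wt.
have -> : inner (e |: F) S = if e \subset S then e |: inner F S else inner F S.
  apply/setP => f; case: ifP => eS; rewrite !inE; case: eqVneq => //= ->.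
    by rewrite eS.
  by rewrite eS (negbTE eF).
case: ifP => eS; last by rewrite mulr0 subr0.
rewrite cardsU1 !inE (negbTE eF) /= add1n exprS.
by move: (lam ^+ #|S|) ((1 - zeta) ^+ #|inner F S|) => x y; ring.
Qed.

Lemma Zin_setU1 A F e : e \notin F ->
  Zin A (e |: F) = Zin A F - zeta * Zin (e :|: A) F.
Proof.
move=> eF; rewrite /Zin (eq_bigr _ (fun S _ => wt_setU1 F e S eF)).
rewrite big_split /= sumrN -mulr_sumr; congr (_ - zeta * _).
rewrite -big_mkcondr; apply: eq_bigl => S.
by rewrite subUset andbC.
Qed.

(** Adding [v] is a bijection from the sets avoiding [v] to those containing it. It costs one factor
    [lam], and the edges inside [S :\ v] are those of [off F v] inside [S]. *)
Lemma Zin_split A F v : v \notin A ->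
  lam * Zin A F = lam * Zin (v |: A) F + Zin (v |: A) (off F v).
Proof.
move=> vA; rewrite {1}/Zin (bigID (fun S : {set V} => v \in S)) /= mulrDr.
congr (_ + _).
  by congr (_ * _); apply: eq_bigl => S; rewrite subUset sub1set andbC.
rewrite mulr_sumr /Zin.
rewrite (reindex_onto (fun S => S :\ v) (fun S => v |: S)) /=; last first.
  by move=> S /andP[_ vS]; rewrite setU1K.
apply: eq_big => S.
  rewrite !inE eqxx andbT subUset sub1set.
  case vS: (v \in S).
    by rewrite setD1K // eqxx andbT subsetD1 vA andbT.
  case: eqP => [E|]; last by rewrite andbF.
  by move: vS; rewrite -E !inE eqxx.
rewrite !inE eqxx andbT => /andP[_ /eqP SE].
have vS : v \in S by rewrite -SE !inE eqxx.
rewrite /wt (cardsD1 v S) vS /= add1n exprS mulrA; congr (_ * _ ^+ _).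
apply: eq_card => e; rewrite !inE subsetD1.
by case: (e \in F); case: (v \in e); rewrite /= ?andbF ?andbT.
Qed.

Hypotheses (lam_gt0 : 0 < lam) (zeta_ge0 : 0 <= zeta) (zeta_le1 : zeta <= 1).

Let lam_ge0 : 0 <= lam := ltW lam_gt0.

Lemma wt_ge0 F S : 0 <= wt F S.
Proof. by rewrite /wt mulr_ge0 ?exprn_ge0 ?subr_ge0. Qed.

Lemma Zin_ge0 A F : 0 <= Zin A F.
Proof. by apply: sumr_ge0 => S _; apply: wt_ge0. Qed.

(** For [zeta = 1] every set containing an edge of [F] has weight [0]. When [A] contains none, the
    term [S = A] equals [lam ^+ #|A|]. *)
Lemma Zin_gt0 A F : (forall f, f \in F -> ~~ (f \subset A)) -> 0 < Zin A F.
Proof.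
move=> FA; rewrite /Zin (bigD1 A) //=; apply: ltr_pwDl; last first.
  by apply: sumr_ge0 => S _; apply: wt_ge0.
rewrite /wt (_ : inner F A = set0) ?cards0 ?expr0 ?mulr1 ?exprn_gt0 //.
apply/setP => f; rewrite !inE; apply/negP => /andP[/FA]; exact/negP.
Qed.

Lemma Zin_mono A F F' : F \subset F' -> Zin A F' <= Zin A F.
Proof.
move=> FF'; apply: ler_sum => S _; rewrite /wt ler_wpM2l ?exprn_ge0 //.
rewrite ler_wiXn2l ?subr_ge0 // ?gerBl //.
apply/subset_leq_card/subsetP => e; rewrite !inE => /andP[eF ->].
by rewrite (subsetP FF').
Qed.

Lemma off_sub F v : off F v \subset F.
Proof. by apply/subsetP => e; rewrite inE => /andP[]. Qed.

Lemma Zin_pin_le A F v : v \notin A -> Zin (v |: A) F <= lam * Zin A F.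
Proof.
move=> vA; rewrite (Zin_split _ F v vA).
apply: (le_trans (Zin_mono (v |: A) (off F v) F (off_sub F v))).
by rewrite lerDr mulr_ge0 // Zin_ge0.
Qed.

(** Each newly pinned vertex costs at most a factor [lam], whatever the edges are. This crude bound
    is what exceptional edges and exceptional pairs receive. *)
Lemma Zin_pins_le A F W : Zin (W :|: A) F <= lam ^+ #|W :\: A| * Zin A F.
Proof.
move: {2}#|W :\: A| (erefl #|W :\: A|) => n; elim: n W A => [|n IH] W A.
  move=> /[dup] E /cards0_eq/eqP; rewrite setD_eq0 => /setUidPr ->.
  by rewrite E expr0 mul1r.
move=> E; have /card_gt0P[v] : (0 < #|W :\: A|)%N by rewrite E.
rewrite !inE => /andP[vA vW].
have E2 : #|W :\: (v |: A)| = n.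
  have -> : W :\: (v |: A) = (W :\: A) :\ v.
    by apply/setP => x; rewrite !inE negb_or andbA.
  by move: E; rewrite (cardsD1 v (W :\: A)) !inE vA vW => -[].
have -> : W :|: A = W :|: (v |: A).
  apply/setP => x; rewrite !inE; case: eqVneq => [->|//].
  by rewrite vW.
apply: le_trans (IH _ _ E2) _.
rewrite E E2 exprSr -mulrA ler_wpM2l ?exprn_ge0 //.
exact: Zin_pin_le.
Qed.

(* Odds of [v] divided by [lam], given that all of [A] is occupied: forbidding [v] amounts to pinning it and switching off its edges. *)
Definition rat A F v : R := Zin (v |: A) F / Zin (v |: A) (off F v).

Lemma rat_le1 A F v : rat A F v <= 1.
Proof.
rewrite /rat; have := Zin_ge0 (v |: A) (off F v).
(* A vanishing denominator makes the quotient [0], by the convention for [0^-1]. *)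
rewrite le_eqVlt => /orP[/eqP <-|h]; first by rewrite invr0 mulr0.
by rewrite ler_pdivrMr // mul1r Zin_mono // off_sub.
Qed.

Lemma rat_ge0 A F v : 0 <= rat A F v.
Proof. by rewrite /rat divr_ge0 // Zin_ge0. Qed.

Lemma rat_gt0 A F v : (forall f, f \in F -> ~~ (f \subset v |: A)) ->
  0 < rat A F v.
Proof.
move=> FA; rewrite /rat divr_gt0 // Zin_gt0 // => f /(subsetP (off_sub F v)).
exact: FA.
Qed.

Lemma Zin_pin_rat A F v : v \notin A ->
  (forall f, f \in F -> ~~ (f \subset v |: A)) ->
  (1 + lam * rat A F v) * Zin (v |: A) F = lam * rat A F v * Zin A F.
Proof.
move=> vA FA.
have q0 : Zin (v |: A) (off F v) != 0.
  rewrite gt_eqF // Zin_gt0 // => f /(subsetP (off_sub F v)); exact: FA.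
have := Zin_split A F v vA; rewrite /rat.
set p := Zin (v |: A) F; set q := Zin (v |: A) (off F v) in q0 *.
move=> E; rewrite [lam * (p / q)]mulrC -[RHS]mulrA E.
by field.
Qed.

(** The conditional probability of [v] is [lam * r / (1 + lam * r)] with [r = rat A F v] in
    [[0, 1]]. Replacing the denominator by [1 + lam] below and by [1] above makes both bounds linear
    in [r], so that they multiply along a chain of vertices. *)
Lemma Zin_pin_bounds A F v lo hi : v \notin A ->
  (forall f, f \in F -> ~~ (f \subset v |: A)) ->
  0 <= lo <= rat A F v -> rat A F v <= hi ->
  lam / (1 + lam) * lo * Zin A F <= Zin (v |: A) F <= lam * hi * Zin A F.
Proof.
move=> vA FA /andP[lo0 Hlo] Hhi.
have E := Zin_pin_rat _ _ _ vA FA.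
have r0 := rat_ge0 A F v; have r1 := rat_le1 A F v.
have z0 := Zin_ge0 A F; have p0 := Zin_ge0 (v |: A) F.
set r := rat A F v in E Hlo Hhi r0 r1 *.
set z := Zin A F in E z0 *; set p := Zin (v |: A) F in E p0 *.
apply/andP; split.
  have l1 : 0 < 1 + lam by rewrite addr_gt0.
  rewrite -!mulrA mulrCA ler_pdivrMl //.
  apply: (@le_trans _ _ (lam * r * z)).
    by rewrite -mulrA ler_wpM2l // ler_wpM2r.
  rewrite -E ler_wpM2r // lerD2l -[leRHS]mulr1 ler_wpM2l //.
apply: (@le_trans _ _ (lam * r * z)).
  rewrite -E mulrDl mul1r lerDl mulr_ge0 // mulr_ge0 //.
rewrite ler_wpM2r // ler_wpM2l //.
Qed.

End PinnedPartition.

(** * The contraction *)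

Section Contraction.
Import numFieldNormedType.Exports.
Local Open Scope classical_set_scope.
Local Open Scope ring_scope.
Variable R : realType.

Lemma is_derive1_expR_comp (f : R -> R) (x df : R) : is_derive x 1 f df ->
  is_derive x 1 (fun y => expR (f y)) (df * expR (f x)).
Proof.
move=> Hf; have H := is_derive1_comp (is_derive_expR (f x)) Hf.
by apply: (is_derive_eq H); rewrite mulrC.
Qed.

Definition rate (a : R) : R := (1 + expR (2 - a)) / (a + expR (2 - a)).

Lemma rate_gt0 a : 1 < a -> 0 < rate a.
Proof.
move=> a1; have := expR_gt0 (2 - a) => e0.
by rewrite /rate divr_gt0 // addr_gt0 // (lt_trans ltr01).
Qed.

Lemma rate_lt1 a : 1 < a -> rate a < 1.
Proof.
move=> a1; have := expR_gt0 (2 - a) => e0.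
rewrite /rate ltr_pdivrMr; first by rewrite mul1r ltrD2r.
by rewrite addr_gt0 // (lt_trans ltr01).
Qed.

(* The potential is [ln (a - ln y)]; it is tangent to the critical profile at [y = 1], where [1 + x <= expR x] is an equality. *)
Lemma rate_pointwise (a C y : R) : 1 < a -> 0 <= C <= expR (2 - a) -> a <= y ->
  C * expR (a - y) * y <= rate a * (a + C * expR (a - y)).
Proof.
move=> a1 /andP[C0 C1] ay.
have a0 : 0 < a by lra.
have E0 := expR_gt0 (2 - a); have Ey := expR_gt0 (a - y).
have r0 := rate_gt0 _ a1; have r1 := rate_lt1 _ a1.
apply: (@le_trans _ _ (rate a * a + C * expR (a - y) * rate a)); last first.
  by rewrite mulrDr; lra.
rewrite -lerBlDr -mulrBr.
have yr : 0 <= y - rate a by lra.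
apply: (@le_trans _ _ (expR (2 - a) * expR (a - y) * (y - rate a))).
  by rewrite ler_wpM2r // ler_wpM2r // ltW.
have -> : expR (2 - a) * expR (a - y) = expR (2 - y).
  by rewrite -expRD; congr expR; lra.
have Hz : expR (2 - y) <= expR (2 - a) by rewrite ler_expR; lra.
have H1 : expR (2 - y) * (y - 1) <= 1.
  rewrite -[leRHS](expRxMexpNx_1 (2 - y)) ler_wpM2l ?expR_ge0 //.
  by have := expR_ge1Dx (- (2 - y)); lra.
(* Because [a > 1], the function [z |-> (1 + z) / (a + z)] increases; [rate a] is its value at
   [z = expR (2 - a)], the largest one for [y >= a]. *)
have H2 : 1 + expR (2 - y) <= rate a * (a + expR (2 - y)).
  rewrite /rate mulrAC ler_pdivlMr; last by rewrite addr_gt0.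
  have : (a - 1) * expR (2 - y) <= (a - 1) * expR (2 - a).
    by rewrite ler_wpM2l // subr_ge0 ltW.
  by move: (expR (2 - y)) (expR (2 - a)) => z c; lra.
by move: H1 H2; move: (expR (2 - y)) (rate a) => z r; lra.
Qed.

(** Here [s] stands for [a + T]. The function [psi] runs from the left side at [0] to the right side
    at [M], and [rate_pointwise] at [y = expR m * s] says exactly that its derivative is
    nonnegative. *)
Lemma contraction_scalar (a C s M : R) : 1 < a -> 0 <= C <= expR (2 - a) -> a <= s ->
  0 <= M ->
  a + C * expR (a - s) <=
  expR (rate a * M) * (a + C * expR (a - expR M * s)).
Proof.
move=> a1 C01 as_ M0.
pose psi m := expR (rate a * m) * (a + C * expR (a - expR m * s)).
pose dpsi m := expR (rate a * m) * (rate a * (a + C * expR (a - expR m * s))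
   - C * expR (a - expR m * s) * (expR m * s)).
have dpsiP (m : R) : is_derive m 1 psi (dpsi m).
  have d1 : is_derive m 1 (fun m => expR (rate a * m)) (rate a * expR (rate a * m)).
    apply: is_derive1_expR_comp.
    by apply: (@is_derive_eq _ _ _ (rate a \*: id)); rewrite /= [_ *: _]mulr1.
  have d2 : is_derive m 1 (fun m => expR (a - expR m * s))
     ((- (expR m * s)) * expR (a - expR m * s)).
    apply: is_derive1_expR_comp.
    have := is_deriveB (is_derive_cst a m 1) (is_deriveM (is_derive_expR m) (is_derive_cst s m 1)).
    by move=> H; apply: (is_derive_eq H); rewrite /GRing.scale /= /cst mulr0 !add0r mulrC.
  have := is_deriveM d1 (is_deriveD (is_derive_cst a m 1) (is_deriveM (is_derive_cst C m 1) d2)).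
  move=> H; apply: (is_derive_eq H); rewrite /GRing.scale /= /dpsi !mulr0.
  rewrite -[X in _ + X * _]/(a + C * expR (a - expR m * s)) /cst /=; ring.
have psi0 : psi 0 = a + C * expR (a - s).
  by rewrite /psi mulr0 expR0 !mul1r.
have cpsi : {within `[0, M], continuous psi}.
  apply: continuous_subspaceT => x; apply: differentiable_continuous.
  by apply/derivable1_diffP; case: (dpsiP x).
have [m mM E] := MVT_segment M0 (fun x _ => dpsiP x) cpsi.
rewrite -psi0 -[leRHS]/(psi M) -subr_ge0 E subr0 mulr_ge0 //.
rewrite /dpsi mulr_ge0 ?expR_ge0 // subr_ge0 rate_pointwise //.
have m0 : 0 <= m by move: mM; rewrite in_itv /= => /andP[].
apply: (le_trans as_); rewrite ler_peMl //.
  exact: le_trans (ltW (lt_trans ltr01 a1)) as_.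
by rewrite -expR0 ler_expR.
Qed.

End Contraction.

(** * The recursion for the odds ratios *)

Section Recursion.
Import mathcomp.boot.fintype mathcomp.boot.finset.
Variables (R : realType) (V : finType) (lam zeta : R).
Implicit Types (A B S W X Y e f : {set V}) (F E : {set {set V}}) (u v : V).
Hypotheses (lam_gt0 : 0 < lam) (lam_le : lam <= 2^-1).
Hypotheses (zeta_ge0 : 0 <= zeta) (zeta_le1 : zeta <= 1).
Let lam_ge0 : 0 <= lam := ltW lam_gt0.

Local Notation Zin := (@Zin R V lam zeta).
Local Notation rat := (@rat R V lam zeta).
Local Notation off := (@off V).

(** Chain rule: the vertices of [W] are pinned one at a time on top of [B]. The odds of the next
    vertex must be controlled whatever part [Y] of [W] is already pinned. *)
Lemma Zin_chain B F W (lo hi : V -> R) : [disjoint W & B] ->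
  (forall u, 0 <= lo u) -> (forall u, 0 <= hi u) ->
  (forall Y u, Y \subset W -> u \in W -> u \notin Y ->
     (forall f, f \in F -> ~~ (f \subset u |: (Y :|: B))) /\
     lo u <= rat (Y :|: B) F u <= hi u) ->
  (lam / (1 + lam)) ^+ #|W| * \prod_(u in W) lo u * Zin B F
    <= Zin (W :|: B) F
    <= lam ^+ #|W| * \prod_(u in W) hi u * Zin B F.
Proof.
move=> dWB lo0 hi0 H.
have [n nE] := ubnP #|W|; elim: n => // n IH in W dWB H nE *.
case: (set_0Vmem W) => [->|[w wW]].
  by rewrite cards0 !expr0 !big_set0 !mul1r set0U lexx.
have dW : [disjoint W :\ w & B].
  by apply: disjointWl dWB; rewrite subD1set.
have cW : #|W| = #|W :\ w|.+1 by rewrite (cardsD1 w) wW.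
have /andP[IHlo IHhi] : (lam / (1 + lam)) ^+ #|W :\ w| * \prod_(u in W :\ w) lo u * Zin B F
    <= Zin ((W :\ w) :|: B) F
    <= lam ^+ #|W :\ w| * \prod_(u in W :\ w) hi u * Zin B F.
  apply: IH => //; last by rewrite -ltnS -cW.
  move=> Y u YW; rewrite !inE => /andP[_ uW] uY; apply: H => //.
  by apply: (subset_trans YW); rewrite subD1set.
have [HF /andP[Hlo Hhi]] := H (W :\ w) w (subD1set _ _) wW (negbT (setD11 _ _)).
have wN : w \notin W :\ w :|: B.
  rewrite !inE eqxx /=; apply/negP => wB.
  by move/pred0P: dWB => /(_ w); rewrite /= wW wB.
have /andP[L U] : lam / (1 + lam) * lo w * Zin ((W :\ w) :|: B) F
   <= Zin (w |: ((W :\ w) :|: B)) F <= lam * hi w * Zin ((W :\ w) :|: B) F.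
  by apply: Zin_pin_bounds => //; rewrite lo0.
have -> : W :|: B = w |: ((W :\ w) :|: B) by rewrite setUA setD1K.
have l1 : 0 < 1 + lam by rewrite addr_gt0.
rewrite cW !exprS !(big_setD1 w wW) /=; apply/andP; split.
  apply: le_trans L; rewrite -[leLHS]mulrA.
  have -> : lam / (1 + lam) * (lam / (1 + lam)) ^+ #|W :\ w| *
      (lo w * \prod_(i in W :\ w) lo i * Zin B F) =
     lam / (1 + lam) * lo w * ((lam / (1 + lam)) ^+ #|W :\ w| *
        \prod_(i in W :\ w) lo i * Zin B F).
    by rewrite -!mulrA; congr (_ * (_ * _)); rewrite mulrCA.
  by rewrite ler_wpM2l // mulr_ge0 // divr_ge0 // ltW.
apply: (le_trans U).
have -> : lam * lam ^+ #|W :\ w| * (hi w * \prod_(i in W :\ w) hi i) * Zin B F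
  = lam * hi w * (lam ^+ #|W :\ w| * \prod_(i in W :\ w) hi i * Zin B F).
  by rewrite -!mulrA; congr (_ * _); rewrite mulrCA.
by rewrite ler_wpM2l // mulr_ge0.
Qed.

(** Turns the product of the factors [1 - zeta * Q] over edges into a sum; the upper bound is
    [- ln (1 - q) <= q / (1 - q)]. *)
Lemma ln_oneB_bounds (q l : R) : 0 <= q <= l -> l <= 2^-1 ->
  q <= - ln (1 - q) <= (1 + 2 * l) * q.
Proof.
move=> /andP[q0 ql] l2.
have q1 : 0 < 1 - q by lra.
apply/andP; split.
  by have := @le_ln1Dx R (- q); rewrite ltrN2 => /(_ ltac:(lra)); lra.
rewrite -lnV ?posrE //.
have -> : (1 - q)^-1 = 1 + q / (1 - q) by field; rewrite gt_eqF.
have h : 0 <= q / (1 - q) by rewrite divr_ge0 // ltW.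
apply: (le_trans (le_ln1Dx _)); first by lra.
rewrite ler_pdivrMr // -mulrA mulrCA ler_peMr //.
have : 0 <= l * (1 - 2 * q) by rewrite mulr_ge0; lra.
by lra.
Qed.

Variable E : {set {set V}}.

(* A state of the recursion: [A] is pinned and only the edges of [F] are penalised; at most [m] edges of [E] avoiding [A] have been switched off. *)
Definition valid K m A F v := [/\ v \notin A, F \subset E, (#|A| <= K)%N,
  (forall f, f \in F -> ~~ (f \subset v |: A)) &
  (#|[set f in E :\: F | [disjoint f & A]]| <= m)%N].

(* Conditioning on such an edge never completes another edge of the state. *)
Definition nice A F v e :=
  [&& e \in F, v \in e, [disjoint e & A] &
    [forall f in E, (f != e) ==> (f \subset e :|: A) ==> (f \subset v |: A)]].

Variables (k : nat) (k_gt0 : (0 < k)%N).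
Hypothesis unifE : forall e, e \in E -> #|e| = k.

Lemma card_link e v : e \in E -> v \in e -> #|e :\ v| = k.-1.
Proof. by move=> eE ve; rewrite -(unifE _ eE) (cardsD1 v e) ve. Qed.

Lemma inner_lt_card W : (#|W| < k)%N -> inner V E W = set0.
Proof.
move=> Wk; apply/setP => e; rewrite !inE; apply/negP => /andP[eE eW].
by have := subset_leq_card eW; rewrite unifE // leqNgt Wk.
Qed.

Lemma inner_edge e : e \in E -> inner V E e = [set e].
Proof.
move=> eE; apply/setP => f; rewrite !inE; apply/andP/eqP => [[fE fe]|->].
  by apply/eqP; rewrite eqEcard fe !unifE /=.
by rewrite eE subxx.
Qed.

(** Descent from [v] to another vertex [u] of a nice edge [e]. The edges lost between [F] and [F']
    all contain [v], which is now pinned, so [m] need not grow: this is why [valid] counts only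
    missing edges that avoid the pinned set. An edge of [F'] completed at [u] would lie in
    [e :|: A], hence in [v |: A] by niceness, against validity at [v]. *)
Lemma valid_child K m A F F' v e Y u : valid K m A F v -> nice A F v e ->
  off F v \subset F' -> F' \subset F -> e \notin F' ->
  Y \subset e :\ v -> u \in e :\ v -> u \notin Y ->
  valid (K + k) m (Y :|: (v |: A)) F' u.
Proof.
move=> [vA FE AK FA Fm] /and4P[eF ve deA /forall_inP He] offF' F'F eF' Ye ue uY.
have eE := subsetP FE _ eF.
have ueN : u \notin A.
  move: ue; rewrite !inE => /andP[_ ue].
  by apply/negP => uA; move/pred0P: deA => /(_ u); rewrite /= ue uA.
split.
- move: ue; rewrite !inE => /andP[uv ue].
  by rewrite !negb_or uY uv.
- exact: subset_trans F'F FE.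
- have : (#|Y| <= k.-1)%N by rewrite -(card_link _ _ eE ve) subset_leq_card.
  have : (#|Y :|: (v |: A)| <= #|Y| + #|v |: A|)%N by case: (leq_card_setU Y (v |: A)).
  have : (#|v |: A| <= K.+1)%N by rewrite cardsU1 vA.
  rewrite -[in (K + k)%N](prednK k_gt0).
  move: #|_ :|: _| #|v |: A| #|Y| k.-1 => a b c d; clear; lia.
- move=> f fF'; apply/negP => fsub.
  have fF := subsetP F'F _ fF'.
  have fe : f != e by apply: (contraNneq _ eF') => <-.
  have fE := subsetP FE _ fF.
  have : f \subset e :|: A.
    apply: (subset_trans fsub); rewrite subUset sub1set; apply/andP; split.
      by move: ue; rewrite !inE => /andP[_ ->].
    rewrite subUset (subset_trans Ye) ?(subset_trans (subD1set _ _)) ?subsetUl //=.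
    by rewrite setUSS // sub1set.
  by move=> fs; have := He _ fE; rewrite fe fs /= => /(negP (FA _ fF)).
- apply: leq_trans Fm; apply/subset_leq_card/subsetP => f.
  rewrite !inE => /andP[/andP[fF' fE] dis].
  rewrite fE andbT; apply/andP; split; last first.
    by apply: disjointWr dis; rewrite setUA subsetUr.
  apply: contra fF' => fF; apply: (subsetP offF'); rewrite inE fF /=.
  apply/negP => vf; move/pred0P: dis => /(_ v).
  by rewrite /= vf !inE eqxx orbT.
Qed.

Section Bounds.
Variables (K m : nat) (lo hi : V -> R).
Hypotheses (lo_ge0 : forall u, 0 <= lo u) (hi_ge0 : forall u, 0 <= hi u).
Hypothesis rat_child : forall A F u, valid (K + k) m A F u -> lo u <= rat A F u <= hi u.
Variables (A : {set V}) (F : {set {set V}}) (v : V).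
Hypothesis vAF : valid K m A F v.

(** Bounds on the conditional probability that [e] becomes fully occupied. An edge that is not nice
    gets the trivial lower bound [0] and the crude upper bound of [Zin_pins_le]. *)
Definition elo e : R := if nice A F v e then
  (lam / (1 + lam)) ^+ k.-1 * \prod_(u in e :\ v) lo u else 0.
Definition ehi e : R := if nice A F v e then
  lam ^+ k.-1 * \prod_(u in e :\ v) hi u else lam ^+ #|e :\: (v |: A)|.

(** For a nice edge this is [Zin_chain] applied to [e :\ v]. At least one vertex of [e] is outside
    [v |: A], hence [Q <= lam], which keeps [1 - zeta * Q] away from [0] even for [zeta = 1]. *)
Lemma edge_step F' e : e \in F -> v \in e -> off F v \subset F' ->
  F' \subset F -> e \notin F' ->
  let Q := Zin (e :|: (v |: A)) F' / Zin (v |: A) F' in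
  [/\ 0 < Zin (v |: A) F', elo e <= Q, Q <= ehi e, 0 <= Q & Q <= lam].
Proof.
move=> eF ve offF' F'F eF' Q.
have [vA FE AK FA Fm] := vAF.
have Z0 : 0 < Zin (v |: A) F'.
  by apply: Zin_gt0 => // f /(subsetP F'F); apply: FA.
have Q0 : 0 <= Q by rewrite divr_ge0 // ?Zin_ge0 // ltW.
have Qp : Q <= lam ^+ #|e :\: (v |: A)|.
  by rewrite ler_pdivrMr // Zin_pins_le.
have Ql : Q <= lam.
  apply: (le_trans Qp); rewrite -[leRHS]expr1 ler_wiXn2l //.
    by apply: (le_trans lam_le); rewrite invf_le1 // ler1n.
  rewrite card_gt0 setD_eq0; exact: FA.
suff /andP[] : elo e <= Q <= ehi e by split.
rewrite /elo /ehi; case: ifP => ne; last by rewrite Q0 Qp.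
have eE := subsetP FE _ eF.
rewrite /Q; have -> : e :|: (v |: A) = e :\ v :|: (v |: A).
  by apply/setP => x; rewrite !inE; case: (x == v); rewrite ?orbT //= ?andbT ?orbF.
have := @Zin_chain (v |: A) F' (e :\ v) lo hi; rewrite (card_link _ _ eE ve).
rewrite ler_pdivrMr // ler_pdivlMr //; apply=> //.
  rewrite disjoint_sym disjoints_subset; apply/subsetP => x; rewrite !inE negb_and negbK.
  case: eqVneq => //= _ xA; case/and4P: ne => _ _ /pred0P/(_ x) /=.
  by rewrite xA andbT => ->.
move=> Y u Ye ue uY.
have vc := valid_child _ _ _ _ _ _ _ _ _ vAF ne offF' F'F eF' Ye ue uY.
split; last exact: rat_child.
by case: vc.
Qed.

(** The edges at [v] are switched on one by one, starting from [off F v]; each multiplies the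
    partition function by [1 - zeta * Q], with [Q] taken in the intermediate system. The child
    bounds hold in all these systems, so the order is immaterial. *)
Lemma rat_edge_bounds :
  zeta * \sum_(e in F | v \in e) elo e <= - ln (rat A F v)
    <= (1 + 2 * lam) * zeta * \sum_(e in F | v \in e) ehi e.
Proof.
have [vA FE AK FA Fm] := vAF.
suff H (X : {set {set V}}) : X \subset [set e in F | v \in e] ->
  zeta * \sum_(e in X) elo e
    <= - ln (Zin (v |: A) (X :|: off F v) / Zin (v |: A) (off F v))
    <= (1 + 2 * lam) * zeta * \sum_(e in X) ehi e.
  have := H _ (subxx _).
  have -> : [set e in F | v \in e] :|: off F v = F.
    by apply/setP => e; rewrite !inE; case: (e \in F) => //=; case: (v \in e).
  rewrite (eq_bigl (fun e => (e \in F) && (v \in e))); last by move=> e; rewrite inE.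
  rewrite [X in _ <= _ <= _ * X](eq_bigl (fun e => (e \in F) && (v \in e))) //.
  by move=> e; rewrite inE.
have Zpos F' : F' \subset F -> 0 < Zin (v |: A) F'.
  by move=> F'F; apply: Zin_gt0 => // f /(subsetP F'F); apply: FA.
have [n nX] := ubnP #|X|; elim: n => // n IH in X nX *.
case: (set_0Vmem X) => [->|[e eX]] XF.
  rewrite !big_set0 !mulr0 set0U divff ?ln1 ?oppr0 ?lexx //.
  by rewrite gt_eqF // Zpos // off_sub.
have cX : #|X| = #|X :\ e|.+1 by rewrite (cardsD1 e) eX.
have XF' : X :\ e \subset [set e in F | v \in e].
  exact: subset_trans (subD1set _ _) XF.
have /andP[IHlo IHhi] : zeta * \sum_(f in X :\ e) elo f
    <= - ln (Zin (v |: A) (X :\ e :|: off F v) / Zin (v |: A) (off F v))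
    <= (1 + 2 * lam) * zeta * \sum_(f in X :\ e) ehi f.
  by apply: IH => //; rewrite -ltnS -cX.
have /andP[eF ve] : (e \in F) && (v \in e) by move: (subsetP XF _ eX); rewrite inE.
set F' := X :\ e :|: off F v in IHlo IHhi *.
have F'F : F' \subset F.
  rewrite subUset off_sub andbT; apply: (subset_trans XF').
  by apply/subsetP => x; rewrite inE => /andP[].
have eF' : e \notin F' by rewrite !inE eqxx ve andbF.
have [Z0 Qlo Qhi Q0 Ql] := edge_step F' e eF ve (subsetUr _ _) F'F eF'.
set Q := _ / _ in Qlo Qhi Q0 Ql.
have -> : X :|: off F v = e |: F' by rewrite /F' setUA setD1K.
have zQ0 : 0 <= zeta * Q by rewrite mulr_ge0.
have zQl : zeta * Q <= lam by apply: le_trans Ql; rewrite ler_piMl.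
have lq1 : 0 < 1 - zeta * Q by move: lam_le zQl; lra.
have offF : off F v \subset F by rewrite off_sub.
have -> : Zin (v |: A) (e |: F') / Zin (v |: A) (off F v) =
  (1 - zeta * Q) * (Zin (v |: A) F' / Zin (v |: A) (off F v)).
  rewrite Zin_setU1 // /Q; field.
  by rewrite !gt_eqF //; apply: Zpos.
rewrite lnM ?posrE ?divr_gt0 //; last exact: Zpos.
rewrite !(big_setD1 e eX) /= !mulrDr.
have /andP[B1 B2] : zeta * Q <= - ln (1 - zeta * Q) <= (1 + 2 * lam) * (zeta * Q).
  by apply: ln_oneB_bounds => //; rewrite zQ0.
have B3 : zeta * elo e <= zeta * Q by rewrite ler_wpM2l.
have B4 : (1 + 2 * lam) * (zeta * Q) <= (1 + 2 * lam) * zeta * ehi e.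
  rewrite -mulrA ler_wpM2l ?ler_wpM2l //.
  by rewrite addr_ge0 // mulr_ge0.
rewrite opprD; apply/andP; split; apply: lerD => //.
  exact: le_trans B3 B1.
exact: le_trans B2 B4.
Qed.

End Bounds.
End Recursion.

(** * Tree-like degree conditions *)

Section Degrees.
Import mathcomp.boot.fintype mathcomp.boot.finset.
Variables (R : realType) (V : finType).
Implicit Types (A B S W X Y T e f g : {set V}) (F E : {set {set V}}) (u v w : V).

Definition deg E B : nat := #|[set e in E | B \subset e]|.

Definition common_links k E v w : {set {set V}} :=
  [set S : {set V} | [&& #|S| == k.-1, (v |: S) \in E & (w |: S) \in E]].

(* [beta] stands for [lambda / c], which is asymptotic to [D ^ (- 1 / (k - 1))]. *)
Record near_tree (k : nat) E (D beta eta : R) : Prop := NearTree {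
  nt_k : (2 <= k)%N;
  nt_unif : forall e, e \in E -> #|e| = k;
  nt_beta : 0 < beta;
  nt_beta_eta : beta <= eta;
  nt_eta : eta <= 1;
  nt_deg1 : forall v, (deg E [set v])%:R <= D;
  nt_D : `|D * beta ^+ k.-1 - 1| <= eta;
  nt_deg : forall B, (2 <= #|B| < k)%N ->
    (deg E B)%:R * beta ^+ (k - #|B|) <= eta;
  nt_Gamma : forall v w, v != w ->
    #|common_links k E v w|%:R * beta ^+ k.-1 <= eta }.

(** Edges are grouped by their trace [B] on [T]: there are at most [2 ^ #|T|] traces, and at most
    [deg E B] edges share the trace [B]. *)
Lemma deg_group E T (P : pred {set V}) (h : nat -> R) (c : R) : 0 <= c ->
  (forall j, 0 <= h j) ->
  (forall e, e \in E -> P e -> (deg E (e :&: T))%:R * h #|e :&: T| <= c) ->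
  \sum_(e in E | P e) h #|e :&: T| <= (2 ^ #|T|)%:R * c.
Proof.
move=> c0 h0 H.
rewrite (partition_big (fun e => e :&: T) (fun B => B \in powerset T)) /=; last first.
  by move=> e _; rewrite powersetE subsetIr.
have -> : (2 ^ #|T|)%:R * c = \sum_(B in powerset T) c.
  by rewrite sumr_const card_powerset mulr_natl.
apply: ler_sum => B _.
case: (pickP (fun e => [&& e \in E, P e & e :&: T == B])) => [e /and3P[eE Pe /eqP eB]|none].
  apply: le_trans (H e eE Pe); rewrite eB.
  rewrite (eq_bigr (fun=> h #|B|)); last by move=> f /andP[_ /eqP ->].
  rewrite sumr_const -[h _ *+ _]mulr_natl ler_wpM2r // ler_nat subset_leq_card //.
  apply/subsetP => f; rewrite inE => /andP[/andP[fE _] /eqP <-].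
  by rewrite fE subsetIl.
by rewrite big_pred0 // => e; have := none e; rewrite andbA.
Qed.

Lemma card_bigcup_le (I : finType) (P : pred I) (X : I -> {set {set V}}) :
  (#|\bigcup_(i | P i) X i| <= \sum_(i | P i) #|X i|)%N.
Proof.
elim/big_rec2: _ => [|i n S _ IH]; first by rewrite cards0.
apply: (@leq_trans (#|X i| + #|S|)%N); first by case: (leq_card_setU (X i) S).
by rewrite leq_add2l.
Qed.

Variables (k : nat) (E : {set {set V}}) (D beta eta : R).
Hypothesis NT : near_tree k E D beta eta.

Let k2 := nt_k _ _ _ _ _ NT.
Let unifE := nt_unif _ _ _ _ _ NT.
Let beta_gt0 := nt_beta _ _ _ _ _ NT.
Let beta_eta := nt_beta_eta _ _ _ _ _ NT.
Let eta1 := nt_eta _ _ _ _ _ NT.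

Let beta_ge0 : 0 <= beta. Proof. exact: ltW. Qed.
Let eta_ge0 : 0 <= eta. Proof. exact: le_trans beta_eta. Qed.
Let beta_le1 : beta <= 1. Proof. exact: le_trans beta_eta eta1. Qed.

Lemma D_beta_le : D * beta ^+ k.-1 <= 2.
Proof. by have := nt_D _ _ _ _ _ NT; rewrite ler_norml => /andP[_]; move: eta1; lra. Qed.

Lemma deg_full B : #|B| = k -> (deg E B <= 1)%N.
Proof.
move=> Bk; rewrite /deg -(cards1 B); apply/subset_leq_card/subsetP => e.
rewrite !inE => /andP[eE Be]; rewrite eq_sym eqEcard Be.
by rewrite (unifE _ eE) Bk /=.
Qed.

Lemma deg_beta_le2 B : (1 <= #|B| <= k)%N ->
  (deg E B)%:R * beta ^+ (k - #|B|) <= 2.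
Proof.
move=> /andP[]; rewrite leq_eqVlt => /orP[/eqP /esym B1|B2].
  have /cards1P[v ->] : #|B| == 1%N by rewrite B1.
  rewrite cards1 subn1 => _; apply: le_trans D_beta_le.
  by rewrite ler_wpM2r ?exprn_ge0 // (nt_deg1 _ _ _ _ _ NT).
rewrite leq_eqVlt => /orP[/eqP Bk|Bk].
  rewrite Bk subnn expr0 mulr1; apply: (@le_trans _ _ 1%:R); last by rewrite ler_nat.
  by rewrite ler_nat deg_full.
apply: (@le_trans _ _ 1); last by rewrite ler1n.
by apply: le_trans eta1; apply: (nt_deg _ _ _ _ _ NT); rewrite B2.
Qed.

Section AtVertex.
Variables (K m : nat) (A : {set V}) (F : {set {set V}}) (v : V).
Hypothesis vAF : valid V E K m A F v.

(** The edges at [v] avoiding [A] that violate the last clause of [nice]. *)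
Definition entangled : {set {set V}} :=
  [set e in E | [&& v \in e, [disjoint e & A] & [exists f in E,
    [&& f != e, f \subset e :|: A & ~~ (f \subset v |: A)]]]].

Let vA : v \notin A. Proof. by case: vAF. Qed.
Let FE : F \subset E. Proof. by case: vAF. Qed.
Let cardvA : (#|v |: A| <= K.+1)%N.
Proof. by rewrite cardsU1 vA; case: vAF. Qed.

(** Let [f] be the edge completed by [e]. If [f] meets [v |: A] in a single vertex [a], its other
    [k.-1] vertices fill [e :\ v], which is then a common link of [v] and [a]. If it meets it in
    [j >= 2] vertices, then [e] contains the [k - j + 1] vertices of [v |: (f :\: (v |: A))], a
    codegree condition. An empty intersection is impossible, since [e :\ v] has only [k.-1]
    vertices. *)
Lemma entangled_sub : entangled \subset
  (\bigcup_(a in A) [set v |: S | S in common_links k E v a]) :|: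
  (\bigcup_(f in E | (2 <= #|f :&: (v |: A)| < k)%N)
      [set e in E | v |: (f :\: (v |: A)) \subset e]).
Proof.
apply/subsetP => e; rewrite inE => /andP[eE /and3P[ve deA]].
move=> /exists_inP[f fE /and3P[fe feA fvA]].
have eA x : x \in e -> x \in A = false.
  by move=> xe; apply/negP => xA; move/pred0P: deA => /(_ x); rewrite /= xe xA.
have subfe : f :\: (v |: A) \subset e :\ v.
  apply/subsetP => x; rewrite !inE negb_or => /andP[/andP[xv xA] xf].
  by rewrite xv; move: (subsetP feA _ xf); rewrite inE (negbTE xA) orbF.
have cf : #|f :\: (v |: A)| = (k - #|f :&: (v |: A)|)%N.
  by rewrite -(unifE _ fE) -(cardsID (v |: A) f) addKn.
have f0 : (0 < #|f :\: (v |: A)|)%N by rewrite card_gt0 setD_eq0.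
have ce : #|e :\ v| = k.-1 by rewrite (card_link _ _ _ unifE).
have le1 : (#|f :\: (v |: A)| <= k.-1)%N by rewrite -ce subset_leq_card.
have ltB : (#|f :&: (v |: A)| < k)%N by rewrite -subn_gt0 -cf.
have [le2|lt2] := leqP 2 #|f :&: (v |: A)|.
  apply/setUP; right; apply/bigcupP; exists f; first by rewrite fE le2.
  rewrite inE eE subUset sub1set ve (subset_trans subfe) //.
  exact: subD1set.
apply/setUP; left.
have B1 : #|f :&: (v |: A)| == 1%N.
  rewrite eqn_leq -ltnS lt2 /= lt0n; apply: contraTneq le1 => B0.
  by rewrite cf B0 subn0 -ltnNge ltn_predL (leq_trans _ k2).
have feq : f :\: (v |: A) = e :\ v.
  apply/eqP; rewrite eqEcard subfe ce cf (eqP B1).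
  by rewrite subn1 /=.
have /cards1P[a fa] := B1.
have af : a \in f :&: (v |: A) by rewrite fa inE.
have av : a != v.
  apply: contraNneq fe => av.
  rewrite eqEsubset; apply/andP; split.
    apply/subsetP => x xf; move: (subsetP feA _ xf); rewrite inE => /orP[//|xA].
    have : x \in f :&: (v |: A) by rewrite !inE xf xA orbT.
    by rewrite fa inE av => /eqP ->.
  apply/subsetP => x xe; case: (eqVneq x v) => [->|xv].
    by move: af; rewrite inE av => /andP[].
  have : x \in e :\ v by rewrite !inE xv.
  by rewrite -feq inE => /andP[].
have aA : a \in A by move: af; rewrite !inE (negbTE av) => /andP[].
apply/bigcupP; exists a => //; apply/imsetP; exists (e :\ v); last by rewrite setD1K.
rewrite inE ce eqxx setD1K // eE /=.
have -> // : a |: e :\ v = f.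
rewrite -feq -fa; apply/setP => x; rewrite !inE.
by case: (x \in f) => //=; case: (x == v); case: (x \in A).
Qed.

Lemma entangled_le :
  #|entangled|%:R * beta ^+ k.-1 <= (K + 2 ^ K.+1)%:R * eta.
Proof.
have k0 : (0 < k)%N by rewrite (leq_trans _ k2).
apply: (@le_trans _ _ ((\sum_(a in A) #|common_links k E v a| +
   \sum_(f in E | (2 <= #|f :&: (v |: A)| < k)%N) deg E (v |: (f :\: (v |: A))))%:R * beta ^+ k.-1)).
  rewrite ler_wpM2r ?exprn_ge0 // ler_nat.
  apply: (leq_trans (subset_leq_card entangled_sub)).
  set X := \bigcup_(a in A) _; set Y := \bigcup_(f in E | _) _.
  apply: (@leq_trans (#|X| + #|Y|)%N); first by case: (leq_card_setU X Y).
  apply: leq_add; last exact: card_bigcup_le.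
  apply: (leq_trans (card_bigcup_le _ _ _)); apply: leq_sum => a _.
  exact: leq_imset_card.
rewrite natrD mulrDl natrD mulrDl; apply: lerD.
  rewrite natr_sum mulr_suml.
  apply: (@le_trans _ _ (\sum_(a in A) eta)).
    apply: ler_sum => a aA; apply: (nt_Gamma _ _ _ _ _ NT).
    by apply: contraNneq vA => ->.
  rewrite sumr_const -[eta *+ _]mulr_natl ler_wpM2r // ler_nat.
  by case: vAF.
rewrite natr_sum mulr_suml.
(* For an edge [f] with trace of size [j], the codegree of a set of [k - j + 1] vertices absorbs
   [beta ^+ j.-1] and yields [eta]. The remaining [beta ^+ (k - j)] pays for the number of edges [f]
   with that trace. *)
pose h j := eta * beta ^+ (k - j).
apply: (@le_trans _ _ (\sum_(f in E | (2 <= #|f :&: (v |: A)| < k)%N) h #|f :&: (v |: A)|)).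
  apply: ler_sum => f /andP[fE /andP[B2 Bk]].
  have cg : #|v |: (f :\: (v |: A))| = (k - #|f :&: (v |: A)|).+1.
    rewrite cardsU1 !inE eqxx /= add1n; congr _.+1.
    by rewrite -(unifE _ fE) -(cardsID (v |: A) f) addKn.
  have := nt_deg _ _ _ _ _ NT (v |: (f :\: (v |: A))); rewrite cg.
  set j := #|f :&: _| in B2 Bk *.
  have -> : (k.-1 = (k - (k - j).+1) + (k - j))%N by move: k j k2 B2 Bk; clear; lia.
  rewrite exprD mulrA => Hd; rewrite /h ler_wpM2r ?exprn_ge0 //; apply: Hd.
  by move: k j k2 B2 Bk; clear; lia.
apply: (@le_trans _ _ ((2 ^ #|v |: A|)%:R * eta)); last first.
  by rewrite ler_wpM2r // ler_nat leq_exp2l.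
apply: deg_group => // [j|f fE /andP[B2 Bk]]; first by rewrite mulr_ge0 ?exprn_ge0.
rewrite /h mulrCA ler_piMr //.
by apply: le_trans eta1; apply: (nt_deg _ _ _ _ _ NT); rewrite B2.
Qed.

Lemma not_nice_cases e : e \in E -> v \in e -> ~~ nice V E A F v e ->
  [|| (e \in [set f in E :\: F | [disjoint f & A]]), ~~ [disjoint e & A]
    | e \in entangled].
Proof.
move=> eE ve; rewrite /nice !inE ve eE /=.
case eF: (e \in F) => /=; case dis: [disjoint e & A] => //=.
rewrite negb_forall_in => /exists_inP[f fE]; rewrite !negb_imply => /and3P[fe fs fv].
by apply/exists_inP; exists f => //; rewrite fe fs fv.
Qed.

Lemma meets_pinned e : v \in e -> ~~ [disjoint e & A] -> (2 <= #|e :&: (v |: A)|)%N.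
Proof.
move=> ve /pred0Pn[x /=/andP[xe xA]].
have xv : x != v by apply: contraNneq vA => <-.
have <- : #|[set v; x]| = 2%N by rewrite cards2 eq_sym xv.
apply: subset_leq_card; apply/subsetP => y; rewrite !inE => /orP[]/eqP ->.
  by rewrite ve eqxx.
by rewrite xe xA orbT.
Qed.

(** For the lower bound of the recursion, where an edge that is not nice merely loses its main term,
    of order [beta ^+ k.-1]. *)
Lemma not_nice_count :
  #|[set e in E | (v \in e) && ~~ nice V E A F v e]|%:R * beta ^+ k.-1
    <= (m + K + 3 * 2 ^ K.+1)%:R * eta.
Proof.
have k0 : (0 < k)%N by rewrite (leq_trans _ k2).
have b1 : beta ^+ k.-1 <= eta.
  apply: le_trans beta_eta; rewrite -[leRHS]expr1 ler_wiXn2l //.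
  by rewrite -ltnS prednK.
set X1 := [set f in E :\: F | [disjoint f & A]].
set X2 := [set e in E | (v \in e) && ~~ [disjoint e & A]].
apply: (@le_trans _ _ ((#|X1| + #|X2| + #|entangled|)%:R * beta ^+ k.-1)).
  rewrite ler_wpM2r ?exprn_ge0 // ler_nat.
  apply: (@leq_trans #|X1 :|: X2 :|: entangled|).
    apply/subset_leq_card/subsetP => e; rewrite inE => /andP[eE /andP[ve ne]].
    have := not_nice_cases e eE ve ne.
    by rewrite !in_setU [e \in X2]inE eE ve orbA.
  apply: (@leq_trans (#|X1 :|: X2| + #|entangled|)%N).
    by case: (leq_card_setU (X1 :|: X2) entangled).
  by rewrite leq_add2r; case: (leq_card_setU X1 X2).
rewrite !natrD !mulrDl.
have H1 : #|X1|%:R * beta ^+ k.-1 <= m%:R * eta.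
  by rewrite ler_pM ?ler_nat ?exprn_ge0 //; case: vAF.
have H3 := entangled_le; rewrite natrD mulrDl in H3.
have H2 : #|X2|%:R * beta ^+ k.-1 <= (2 ^ K.+1)%:R * (2 * eta).
  apply: (@le_trans _ _ ((2 ^ #|v |: A|)%:R * (2 * eta))); last first.
    by rewrite ler_wpM2r ?mulr_ge0 // ler_nat leq_exp2l.
  have -> : #|X2|%:R * beta ^+ k.-1 =
     \sum_(e in E | (v \in e) && ~~ [disjoint e & A]) (fun=> beta ^+ k.-1) #|e :&: (v |: A)|.
    rewrite sumr_const mulr_natl; congr (_ *+ _).
    by apply: eq_card => e; rewrite inE.
  apply: (@deg_group E (v |: A) (fun e => (v \in e) && ~~ [disjoint e & A]) (fun=> beta ^+ k.-1)) => [|_|e eE /andP[ve ndis]]; rewrite ?mulr_ge0 ?exprn_ge0 //.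
  have B2 := meets_pinned e ve ndis.
  have Bk : (#|e :&: (v |: A)| <= k)%N by rewrite -(unifE _ eE) subset_leq_card // subsetIl.
  have := deg_beta_le2 (e :&: (v |: A)).
  set j := #|_ :&: _| in B2 Bk *.
  (* The degree bound uses [beta ^+ (k - j)]; since [j >= 2], a factor [beta ^+ j.-1 <= eta] is left
     over. The case [j = k] can occur, because [e] need not belong to [F]. *)
  have -> : (k.-1 = (k - j) + j.-1)%N by move: k j k2 B2 Bk; clear; lia.
  rewrite exprD mulrA => Hd; apply: ler_pM; rewrite ?mulr_ge0 ?exprn_ge0 //.
    by apply: Hd; rewrite Bk (leq_trans _ B2).
  apply: le_trans beta_eta; rewrite -[leRHS]expr1 ler_wiXn2l //.
  by rewrite -subn1 subn_gt0.
move: H1 H2 H3; lra.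
Qed.

(** For the upper bound of the recursion, where an edge with few unpinned vertices may weigh far
    more than [beta ^+ k.-1]. With a trace of size [j] on the pinned set the weight is
    [lam ^+ (k - j)], exactly what the codegree condition compensates; [j < k] because edges of [F]
    are not contained in [v |: A]. *)
Lemma not_nice_weight (lam c1 : R) : 1 <= c1 -> 0 < lam -> lam <= c1 * beta ->
  \sum_(e in F | (v \in e) && ~~ nice V E A F v e) lam ^+ #|e :\: (v |: A)|
    <= c1 ^+ k * ((m + K + 3 * 2 ^ K.+1)%:R * eta).
Proof.
move=> c1_ge1 lam_gt0 lamc.
have k0 : (0 < k)%N by rewrite (leq_trans _ k2).
have c0 : 0 <= c1 by rewrite (le_trans ler01).
have lamj j : (j <= k)%N -> lam ^+ j <= c1 ^+ k * beta ^+ j.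
  move=> jk; apply: (@le_trans _ _ ((c1 * beta) ^+ j)).
    by rewrite lerXn2r ?nnegrE ?mulr_ge0 // ltW.
  by rewrite exprMn ler_wpM2r ?exprn_ge0 // ler_weXn2l.
rewrite (bigID (fun e => [disjoint e & A])) /=.
have H1 : \sum_(e | [&& e \in F, v \in e & ~~ nice V E A F v e] && [disjoint e & A])
    lam ^+ #|e :\: (v |: A)| <= c1 ^+ k * ((K + 2 ^ K.+1)%:R * eta).
  apply: le_trans (_ : _ <= c1 ^+ k * (#|entangled|%:R * beta ^+ k.-1)) _; last first.
    by rewrite ler_wpM2l ?exprn_ge0 // entangled_le.
  rewrite mulrCA.
  have -> : #|entangled|%:R * (c1 ^+ k * beta ^+ k.-1) = \sum_(e in entangled) (c1 ^+ k * beta ^+ k.-1).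
    by rewrite sumr_const mulr_natl.
  rewrite big_mkcond [leRHS]big_mkcond; apply: ler_sum => e _.
  case: ifP => [/andP[/and3P[eF ve ne] dis]|_]; last first.
    by case: ifP => // _; rewrite mulr_ge0 ?exprn_ge0.
  have eE := subsetP FE _ eF.
  have := not_nice_cases e eE ve ne; rewrite inE inE eF dis /= => ->.
  have -> : #|e :\: (v |: A)| = k.-1.
    rewrite -(card_link _ _ _ unifE e v eE ve); apply: eq_card => x; rewrite !inE negb_or -andbA.
    case: (x == v) => //=; case xe: (x \in e); rewrite ?andbF ?andbT //=.
    by apply/negP => xA; move/pred0P: dis => /(_ x); rewrite /= xe xA.
  by apply: lamj; rewrite leq_pred.
have H2 : \sum_(e | [&& e \in F, v \in e & ~~ nice V E A F v e] && ~~ [disjoint e & A])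
    lam ^+ #|e :\: (v |: A)| <= (2 ^ K.+1)%:R * (c1 ^+ k * eta).
  apply: (@le_trans _ _ ((2 ^ #|v |: A|)%:R * (c1 ^+ k * eta))); last first.
    by rewrite ler_wpM2r ?mulr_ge0 ?exprn_ge0 // ler_nat leq_exp2l.
  pose P e := [&& e \in F, v \in e & ~~ [disjoint e & A]].
  apply: (@le_trans _ _ (\sum_(e in E | P e) (fun j => c1 ^+ k * beta ^+ (k - j)) #|e :&: (v |: A)|)).
    rewrite big_mkcond [leRHS]big_mkcond; apply: ler_sum => e _.
    case: ifP => [/andP[/and3P[eF ve ne] dis]|_]; last first.
      by case: ifP => // _; rewrite mulr_ge0 ?exprn_ge0.
    have eE := subsetP FE _ eF.
    rewrite eE /P eF ve dis /=.
    have -> : #|e :\: (v |: A)| = (k - #|e :&: (v |: A)|)%N.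
      by rewrite -(unifE _ eE) -(cardsID (v |: A) e) addKn.
    by apply: lamj; rewrite leq_subr.
  apply: (@deg_group E (v |: A) P (fun j => c1 ^+ k * beta ^+ (k - j))) => [|j|e eE /and3P[eF ve ndis]]; rewrite ?mulr_ge0 ?exprn_ge0 //.
  rewrite mulrCA ler_wpM2l ?exprn_ge0 //.
  apply: (nt_deg _ _ _ _ _ NT); rewrite (meets_pinned e ve ndis) /=.
  rewrite -subn_gt0 -(unifE _ eE) -(cardsID (v |: A) e) addKn card_gt0 setD_eq0.
  by case: vAF => _ _ _ + _; apply.
have E1 : (m + K + 3 * 2 ^ K.+1)%:R = (K + 2 ^ K.+1)%:R + 2 * (2 ^ K.+1)%:R + m%:R :> R.
  by rewrite !natrD; lra.
rewrite E1; have : 0 <= c1 ^+ k * (m%:R * eta) by rewrite !mulr_ge0 ?exprn_ge0.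
have : 0 <= (2 ^ K.+1)%:R * (c1 ^+ k * eta) by rewrite !mulr_ge0 ?exprn_ge0.
move=> h1 h2; apply: (le_trans (lerD H1 H2)).
move: h1 h2; move: (c1 ^+ k) (K + _)%:R (2 ^ K.+1)%:R => x y z; lra.
Qed.

End AtVertex.
End Degrees.

(** * Mean-field approximation of the marginals *)

Section MeanField.
Import mathcomp.boot.fintype mathcomp.boot.finset.
Variables (R : realType) (V : finType) (k : nat) (E : {set {set V}}).
Variables (D beta eta : R).
Hypothesis NT : near_tree R V k E D beta eta.
Variables (a c1 zeta t : R).
Hypotheses (a_gt1 : 1 < a) (c1_ge1 : 1 <= c1) (c1_eta : c1 * eta <= 2^-1).
Hypotheses (zeta_ge0 : 0 <= zeta) (zeta_le1 : zeta <= 1).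
Hypotheses (t_gt0 : 0 < t) (t_le : t <= c1).

Let k2 : (2 <= k)%N. Proof. by case: NT. Qed.
Let unifE e : e \in E -> #|e| = k. Proof. by case: NT => _ + *; apply. Qed.
Let beta_gt0 : 0 < beta. Proof. by case: NT. Qed.
Let beta_eta : beta <= eta. Proof. by case: NT. Qed.
Let k_gt0 : (0 < k)%N. Proof. exact: leq_trans k2. Qed.
Let eta_gt0 : 0 < eta. Proof. exact: lt_le_trans beta_eta. Qed.
Let eta_half : eta <= 2^-1.
Proof. by apply: le_trans c1_eta; rewrite ler_peMl // ltW. Qed.

Definition kap : R := (k.-1)%:R.
Definition temper : R := zeta * kap * t ^+ k.-1.
Hypothesis temper_le : temper <= expR (2 - a).

Lemma kap_ge1 : 1 <= kap.
Proof. by rewrite /kap ler1n -ltnS prednK. Qed.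

Let kap_gt0 : 0 < kap. Proof. exact: lt_le_trans ltr01 kap_ge1. Qed.

Lemma temper_ge0 : 0 <= temper.
Proof. by rewrite /temper !mulr_ge0 ?exprn_ge0 // ltW. Qed.

Lemma D_gt0 : 0 < D.
Proof.
have := nt_D _ _ _ _ _ _ _ NT; rewrite ler_norml => /andP[H _].
have h : 0 < D * beta ^+ k.-1 by move: H eta_half; lra.
by move: h; rewrite pmulr_lgt0 // exprn_gt0.
Qed.

Definition fsum (v : V) (f : {set V} -> R) : R :=
  temper / D * \sum_(e in E | v \in e) f e.

Lemma sum_edges_const v (h : R) : 0 <= h -> \sum_(e in E | v \in e) h <= D * h.
Proof.
move=> h0.
have -> : \sum_(e in E | v \in e) h = (deg V E [set v])%:R * h.
  rewrite mulr_natl -sumr_const; apply: eq_bigl => e; rewrite inE.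
  by rewrite sub1set.
by rewrite ler_wpM2r // (nt_deg1 _ _ _ _ _ _ _ NT).
Qed.

Lemma fsum_le v f g : (forall e, e \in E -> v \in e -> f e <= g e) ->
  fsum v f <= fsum v g.
Proof.
move=> fg; rewrite /fsum ler_wpM2l ?divr_ge0 ?temper_ge0 ?(ltW D_gt0) //.
by apply: ler_sum => e /andP[eE ve]; apply: fg.
Qed.

Lemma fsum_le_temper v f : (forall e, e \in E -> v \in e -> f e <= 1) ->
  fsum v f <= temper.
Proof.
move=> f1; apply: (le_trans (fsum_le v f (fun=> 1) f1)).
rewrite /fsum mulrAC ler_pdivrMr ?D_gt0 // ler_wpM2l ?temper_ge0 //.
by have := sum_edges_const v 1 ler01; rewrite mulr1.
Qed.

Lemma fsum_ge0 v f : (forall e, e \in E -> v \in e -> 0 <= f e) -> 0 <= fsum v f.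
Proof.
move=> f0; rewrite /fsum mulr_ge0 ?divr_ge0 ?temper_ge0 ?(ltW D_gt0) //.
by apply: sumr_ge0 => e /andP[eE ve]; apply: f0.
Qed.

(** [contraction_scalar] is summed over the edges at [v]. Having fewer than [D] edges does no harm,
    because the constant term [a] enters with the nonnegative coefficient
    [expR (rate a * M) - 1]. *)
Lemma fsum_contraction v (s : {set V} -> R) M : 0 <= M ->
  (forall e, e \in E -> v \in e -> a <= s e) ->
  a + fsum v (fun e => expR (a - s e)) <=
  expR (rate R a * M) * (a + fsum v (fun e => expR (a - expR M * s e))).
Proof.
move=> M0 as_; set G := expR (rate R a * M).
have G1 : 0 <= G - 1.
  by rewrite subr_ge0 -expR0 ler_expR mulr_ge0 // ltW // rate_gt0.
suff H : fsum v (fun e => expR (a - s e)) - G * fsum v (fun e => expR (a - expR M * s e))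
   <= (G - 1) * a by move: H; rewrite mulrDr; lra.
rewrite /fsum mulrCA -mulrBr mulrAC ler_pdivrMr ?D_gt0 // mulr_sumr -sumrB mulr_sumr.
rewrite [leRHS]mulrC; apply: le_trans (sum_edges_const v _ _); last first.
  by rewrite mulr_ge0 // (le_trans ler01) // ltW.
apply: ler_sum => e /andP[eE ve].
have C01 : 0 <= temper <= expR (2 - a) by rewrite temper_ge0 temper_le.
have := @contraction_scalar R a temper (s e) M a_gt1 C01 (as_ e eE ve) M0.
rewrite -/G mulrDr; lra.
Qed.

Definition lam : R := t * beta.

Lemma lam_gt0 : 0 < lam. Proof. by rewrite mulr_gt0. Qed.
Lemma lam_le_beta : lam <= c1 * beta. Proof. by rewrite ler_wpM2r // ltW. Qed.
Lemma lam_le_eta : lam <= c1 * eta.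
Proof.
apply: (le_trans lam_le_beta); rewrite ler_wpM2l //.
exact: le_trans ler01 _.
Qed.
Lemma lam_half : lam <= 2^-1. Proof. exact: le_trans lam_le_eta c1_eta. Qed.

Variable m : nat.
(* Additive error of one step of the recursion: the first term is the gap between [lam / (1 + lam)] and [lam], the second the weight of the edges that are not nice. *)
Definition slack (K : nat) : R :=
  (6 * kap * c1 * expR (2 - a) + 2 * kap * c1 ^+ k * (m + K + 3 * 2 ^ K.+1)%:R) * eta.

Lemma slack_ge0 K : 0 <= slack K.
Proof.
have c0 : 0 <= c1 by exact: le_trans ler01 _.
rewrite /slack mulr_ge0 ?addr_ge0 ?mulr_ge0 ?exprn_ge0 ?expR_ge0 ?(ltW kap_gt0) //; exact: ltW.
Qed.

Local Notation rat := (@rat R V lam zeta).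

(** The coefficient [kap * zeta * lam ^+ k.-1] of the edge sums is [temper / D] times
    [D * beta ^+ k.-1], which is within [eta] of [1]. The other errors come from the logarithm, from
    the factors [(1 + lam)^-1] of the chain rule and from the edges that are not nice. *)
Lemma rat_log_bounds K (lo hi : V -> R) A F v :
  (forall u, 0 <= lo u <= 1) -> (forall u, 0 <= hi u <= 1) ->
  (forall A F u, valid V E (K + k) m A F u -> lo u <= rat A F u <= hi u) ->
  valid V E K m A F v ->
  fsum v (fun e => \prod_(u in e :\ v) lo u) - slack K
    <= - (kap * ln (rat A F v))
    <= fsum v (fun e => \prod_(u in e :\ v) hi u) + slack K.
Proof.
move=> lo01 hi01 child val.
have lo0 u : 0 <= lo u by case/andP: (lo01 u).
have hi0 u : 0 <= hi u by case/andP: (hi01 u).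
have Plo0 e : 0 <= \prod_(u in e :\ v) lo u by apply: prodr_ge0 => u _.
have Phi0 e : 0 <= \prod_(u in e :\ v) hi u by apply: prodr_ge0 => u _.
have Plo1 e : \prod_(u in e :\ v) lo u <= 1.
  by apply: prodr_ile1.
have Phi1 e : \prod_(u in e :\ v) hi u <= 1.
  by apply: prodr_ile1.
have /andP[L U] := rat_edge_bounds R V lam zeta lam_gt0 lam_half zeta_ge0 zeta_le1 E k k_gt0 unifE
  K m lo hi lo0 hi0 child A F v val.
have l0 := lam_gt0; have lh := lam_half.
have [vA FE AK FA Fm] := val.
set N : R := (m + K + 3 * 2 ^ K.+1)%:R in L U *.
have N0 : 0 <= N by rewrite ler0n.
have c0 : 0 <= c1 by exact: le_trans ler01 _.
have c1k : 0 <= c1 ^+ k by rewrite exprn_ge0.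
have bk0 : 0 <= beta ^+ k.-1 by rewrite exprn_ge0 // ltW.
have dD := nt_D _ _ _ _ _ _ _ NT; rewrite ler_norml in dD.
have EC : kap * zeta * lam ^+ k.-1 = D * beta ^+ k.-1 * (temper / D).
  rewrite /lam exprMn /temper; field.
  by rewrite gt_eqF // D_gt0.
apply/andP; split; last first.
- set S1 := fsum v _.
  have S10 : 0 <= S1 by apply: fsum_ge0.
  have S1C : S1 <= expR (2 - a) by apply: le_trans temper_le; apply: fsum_le_temper.
  have H1 : \sum_(e in F | v \in e) ehi R V lam E k hi A F v e <=
     lam ^+ k.-1 * (\sum_(e in E | v \in e) \prod_(u in e :\ v) hi u) + c1 ^+ k * (N * eta).
    apply: le_trans (_ : \sum_(e in F | v \in e) (lam ^+ k.-1 * \prod_(u in e :\ v) hi u) +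
       \sum_(e in F | (v \in e) && ~~ nice V E A F v e) lam ^+ #|e :\: (v |: A)| <= _).
      rewrite [X in _ <= _ + X]big_mkcond /= [X in _ <= X + _]big_mkcond /= -big_split /=.
      rewrite big_mkcond /=; apply: ler_sum => e _; rewrite /ehi.
      case: (e \in F) => /=; last by rewrite addr0.
      case: (v \in e) => /=; last by rewrite addr0.
      case: ifP => _ /=; first by rewrite addr0.
      by rewrite lerDr mulr_ge0 // exprn_ge0 // ltW.
    apply: lerD; last first.
      exact: (not_nice_weight R V k E D beta eta NT K m A F v val lam c1 c1_ge1 lam_gt0 lam_le_beta).
    rewrite -mulr_sumr ler_wpM2l ?exprn_ge0 ?(ltW l0) //.
    rewrite big_mkcond [leRHS]big_mkcond; apply: ler_sum => e _.
    case: ifP => [/andP[eF ve]|_]; first by rewrite (subsetP FE _ eF) ve.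
    by case: ifP.
  have H2 : kap * (- ln (rat A F v)) <= (1 + 2 * lam) * (D * beta ^+ k.-1 * S1)
       + 2 * kap * (c1 ^+ k * (N * eta)).
    have h1 : kap * (- ln (rat A F v)) <= kap * ((1 + 2 * lam) * zeta *
       (lam ^+ k.-1 * (\sum_(e in E | v \in e) \prod_(u in e :\ v) hi u) + c1 ^+ k * (N * eta))).
      rewrite ler_wpM2l ?(ltW kap_gt0) //; apply: (le_trans U).
      by rewrite ler_wpM2l // mulr_ge0 // addr_ge0 // mulr_ge0 // ltW.
    apply: (le_trans h1).
    have -> : D * beta ^+ k.-1 * S1 = kap * zeta * lam ^+ k.-1 *
       (\sum_(e in E | v \in e) \prod_(u in e :\ v) hi u).
      by rewrite EC /S1 /fsum !mulrA.
    set S := \sum_(e in E | _) _; set Y := c1 ^+ k * (N * eta).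
    have Y0 : 0 <= Y by rewrite /Y !mulr_ge0 // ltW.
    have -> : kap * ((1 + 2 * lam) * zeta * (lam ^+ k.-1 * S + Y)) =
       (1 + 2 * lam) * (kap * zeta * lam ^+ k.-1 * S) + ((1 + 2 * lam) * zeta) * (kap * Y).
      by move: (lam ^+ k.-1) => q; ring.
    rewrite lerD2l -[2 * kap * Y]mulrA ler_wpM2r ?mulr_ge0 ?(ltW kap_gt0) ?(ltW eta_gt0) //.
    apply: (@le_trans _ _ ((1 + 2 * lam) * 1)); last by move: lh; lra.
    by rewrite ler_wpM2l // addr_ge0 // mulr_ge0 // ltW.
  rewrite -mulrN; apply: (le_trans H2).
  (* The relative errors [1 + 2 * c1 * eta] and [1 + eta] multiply to at most
     [1 + 6 * kap * c1 * eta], and [S1 <= expR (2 - a)]. *)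
  have H3 : (1 + 2 * lam) * (D * beta ^+ k.-1 * S1) <= S1 + 6 * kap * c1 * expR (2 - a) * eta.
    case/andP: dD => _ dD.
    apply: (@le_trans _ _ ((1 + 2 * (c1 * eta)) * ((1 + eta) * S1))).
      apply: ler_pM.
      - by rewrite addr_ge0 // mulr_ge0 // ltW.
      - by apply: mulr_ge0 => //; apply: mulr_ge0 => //; exact: ltW D_gt0.
      - by have := lam_le_eta; lra.
      by rewrite ler_wpM2r //; move: dD; lra.
    have -> : (1 + 2 * (c1 * eta)) * ((1 + eta) * S1) =
       S1 + (eta + 2 * c1 * eta + 2 * c1 * eta * eta) * S1 by ring.
    rewrite lerD2l.
    have -> : 6 * kap * c1 * expR (2 - a) * eta = (6 * kap * c1 * eta) * expR (2 - a) by ring.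
    have e0 := ltW eta_gt0.
    apply: ler_pM => //; first by rewrite !addr_ge0 ?mulr_ge0.
    have h1 : c1 * eta * eta <= c1 * eta by rewrite ler_piMr ?mulr_ge0 //; move: eta_half; lra.
    have h2 : eta <= c1 * eta by rewrite ler_peMl.
    have h3 : c1 * eta <= kap * (c1 * eta) by rewrite ler_peMl ?mulr_ge0 ?kap_ge1.
    by move: h1 h2 h3; lra.
  apply: (le_trans (lerD H3 (lexx _))); rewrite /slack -/N.
  by move: (c1 ^+ k) (expR (2 - a)) => x y; lra.
set S2 := fsum v _.
have S20 : 0 <= S2 by apply: fsum_ge0.
have S2C : S2 <= expR (2 - a) by apply: le_trans temper_le; apply: fsum_le_temper.
set q := (1 + lam)^-1.
have q0 : 0 < q by rewrite invr_gt0 addr_gt0.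
have q1 : q <= 1 by rewrite invf_le1 ?addr_gt0 // lerDl ltW.
set S := \sum_(e in E | v \in e) \prod_(u in e :\ v) lo u.
have H1 : (lam * q) ^+ k.-1 * S - c1 ^+ k * (N * eta) <=
    \sum_(e in F | v \in e) elo R V lam E k lo A F v e.
  have h1 : (lam * q) ^+ k.-1 * S <= \sum_(e in F | v \in e) elo R V lam E k lo A F v e
     + \sum_(e in [set e in E | (v \in e) && ~~ nice V E A F v e]) (c1 ^+ k * beta ^+ k.-1).
    rewrite /S mulr_sumr [X in _ <= X + _]big_mkcond /= [X in _ <= _ + X]big_mkcond /= -big_split /=.
    rewrite big_mkcond /=; apply: ler_sum => e _; rewrite inE /elo.
    case: ifP => [/andP[eE ve]|nE]; last first.
      rewrite addr_ge0 //; last by case: ifP => // _; rewrite mulr_ge0.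
      case: ifP => // _; case: ifP => // _; rewrite mulr_ge0 //.
      by rewrite exprn_ge0 // divr_ge0 ?addr_ge0 ?(ltW l0).
    rewrite eE ve /=; case ne: (nice V E A F v e) => /=.
      by have /and4P[-> _ _ _] := ne; rewrite addr0.
    have -> : (if (e \in F) && true then 0 else 0) = 0 :> R by case: ifP.
    rewrite add0r; apply: (@le_trans _ _ ((lam * q) ^+ k.-1 * 1)).
      by rewrite ler_wpM2l // exprn_ge0 // mulr_ge0 // ltW.
    rewrite mulr1; apply: (@le_trans _ _ (lam ^+ k.-1)).
      apply: lerXn2r; rewrite ?nnegrE; [exact: mulr_ge0 (ltW l0) (ltW q0)|exact: ltW|].
      by rewrite ler_piMr // ltW.
    apply: (@le_trans _ _ ((c1 * beta) ^+ k.-1)).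
      apply: lerXn2r; rewrite ?nnegrE; [exact: ltW|exact: mulr_ge0 c0 (ltW beta_gt0)|].
      exact: lam_le_beta.
    by rewrite exprMn ler_wpM2r // ler_weXn2l // leq_pred.
  rewrite lerBlDr; apply: (le_trans h1); rewrite lerD2l sumr_const -[leLHS]mulr_natl mulrCA.
  rewrite ler_wpM2l //.
  exact: (not_nice_count R V k E D beta eta NT K m A F v val).
have H2 : q ^+ k.-1 * (D * beta ^+ k.-1 * S2) - kap * (c1 ^+ k * (N * eta))
     <= kap * (- ln (rat A F v)).
  have h1 : kap * (zeta * ((lam * q) ^+ k.-1 * S - c1 ^+ k * (N * eta))) <= kap * (- ln (rat A F v)).
    by rewrite ler_wpM2l ?(ltW kap_gt0) //; apply: le_trans L; rewrite ler_wpM2l.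
  apply: le_trans h1.
  have -> : D * beta ^+ k.-1 * S2 = kap * zeta * lam ^+ k.-1 * S.
    by rewrite EC /S2 /fsum !mulrA.
  rewrite [(lam * q) ^+ _]exprMn; set Y := c1 ^+ k * (N * eta).
  have Y0 : 0 <= Y by rewrite /Y !mulr_ge0 // ltW.
  have : kap * (zeta * Y) <= kap * Y by rewrite ler_wpM2l ?(ltW kap_gt0) // ler_piMl.
  by move: (lam ^+ k.-1) (q ^+ k.-1) => x y; lra.
rewrite -[leRHS]mulrN; apply: le_trans H2.
have qk : 1 - kap * lam <= q ^+ k.-1.
  apply: (@le_trans _ _ ((1 - lam) ^+ k.-1)).
    rewrite /kap; elim: k.-1 => [|n IH]; first by rewrite mul0r subr0 expr0.
    rewrite exprS; apply: (@le_trans _ _ ((1 - lam) * (1 - n%:R * lam))).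
      rewrite -natr1; have : 0 <= n%:R * lam * lam by rewrite !mulr_ge0 // ltW.
      by lra.
    by rewrite ler_wpM2l // subr_ge0; move: lh; lra.
  rewrite lerXn2r ?nnegrE ?(ltW q0) //; first by move: lh; lra.
  rewrite /q -[leRHS]div1r ler_pdivlMr ?addr_gt0 //.
  by have := mulr_ge0 (ltW l0) (ltW l0); lra.
have H3 : S2 - 2 * kap * c1 * eta * expR (2 - a) <= q ^+ k.-1 * (D * beta ^+ k.-1 * S2).
  case/andP: dD => dD _.
  have e0 := ltW eta_gt0.
  have h1 : (1 - eta) * S2 <= D * beta ^+ k.-1 * S2 by rewrite ler_wpM2r //; move: dD; lra.
  have h2 : (1 - kap * lam) * ((1 - eta) * S2) <= q ^+ k.-1 * (D * beta ^+ k.-1 * S2).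
    apply: (@le_trans _ _ (q ^+ k.-1 * ((1 - eta) * S2))).
      by rewrite ler_wpM2r // mulr_ge0 //; move: eta_half; lra.
    by rewrite ler_wpM2l // exprn_ge0 // ltW.
  apply: le_trans h2.
  have kl : kap * lam <= kap * (c1 * eta) by rewrite ler_wpM2l ?(ltW kap_gt0) // lam_le_eta.
  have h4 : eta <= kap * (c1 * eta).
    apply: (@le_trans _ _ (c1 * eta)); first by rewrite ler_peMl.
    by rewrite ler_peMl ?mulr_ge0 ?kap_ge1.
  have h5 : (2 * (kap * (c1 * eta))) * S2 <= (2 * (kap * (c1 * eta))) * expR (2 - a).
    by rewrite ler_wpM2l // !mulr_ge0 // ltW.
  have h6 : (kap * lam + eta) * S2 <= (2 * (kap * (c1 * eta))) * S2.
    by rewrite ler_wpM2r //; move: kl h4; lra.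
  have h7 : 0 <= kap * lam * eta * S2.
    exact: mulr_ge0 (mulr_ge0 (mulr_ge0 (ltW kap_gt0) (ltW l0)) e0) S20.
  by move: h5 h6 h7; lra.
have HH : 2 * kap * c1 * eta * expR (2 - a) + kap * (c1 ^+ k * (N * eta)) <= slack K.
  rewrite /slack -/N.
  have h1 : 0 <= kap * c1 * eta * expR (2 - a).
    by rewrite !mulr_ge0 ?expR_ge0 // ltW.
  have h2 : 0 <= kap * (c1 ^+ k * (N * eta)) by rewrite !mulr_ge0 // ltW.
  by move: h1 h2; move: (c1 ^+ k) (expR _) => x y; lra.
by move: H3 HH; lra.
Qed.

Variable tau : V -> R.
Hypothesis tauE : forall v,
  tau v = fsum v (fun e => expR (- (\sum_(u in e :\ v) tau u) / kap)).

Lemma tau_ge0 v : 0 <= tau v.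
Proof. by rewrite tauE; apply: fsum_ge0 => e _ _; apply: expR_ge0. Qed.

Lemma tau_le v : tau v <= expR (2 - a).
Proof.
apply: le_trans temper_le; rewrite tauE; apply: fsum_le_temper => e _ _.
by rewrite expR_le1 mulNr oppr_le0 divr_ge0 ?(ltW kap_gt0) ?sumr_ge0 // => u _; apply: tau_ge0.
Qed.

(** Endpoints of the ball of radius [M] about [tau v]. The lower one is clipped at [0], as
    [rat <= 1] allows, so that the child bounds stay at most [1] and [a] plus an edge average stays
    at least [a], where the contraction holds. *)
Definition tlo M v : R := Num.max 0 (expR (- M) * (a + tau v) - a).
Definition thi M v : R := expR M * (a + tau v) - a.
(* [-(k-1) ln (rat A F v)] is within distance [M] of [tau v] in the metric [|ln (a + T) - ln (a + T')|]. *)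
Definition claim K M : Prop := forall A F v, valid V E K m A F v ->
  expR (- thi M v / kap) <= rat A F v <= expR (- tlo M v / kap).

Lemma prod_expR_link (f : V -> R) (e : {set V}) v :
  \prod_(u in e :\ v) expR (- f u / kap) = expR (- (\sum_(u in e :\ v) f u) / kap).
Proof.
rewrite -expR_sum; congr expR.
by rewrite -mulr_suml sumrN.
Qed.

Lemma sum_link_shift (f : V -> R) e v : e \in E -> v \in e ->
  (\sum_(u in e :\ v) (a + f u)) / kap = a + (\sum_(u in e :\ v) f u) / kap.
Proof.
move=> eE ve; rewrite big_split /= sumr_const (card_link _ _ _ unifE) //.
rewrite mulrDl; congr (_ + _).
by rewrite -mulr_natr mulfK // gt_eqF.
Qed.

Lemma rat_expR K M A F v : valid V E K m A F v ->
  tlo M v <= - (kap * ln (rat A F v)) <= thi M v ->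
  expR (- thi M v / kap) <= rat A F v <= expR (- tlo M v / kap).
Proof.
move=> val /andP[H1 H2].
have r0 : 0 < rat A F v.
  by apply: rat_gt0 => //; [exact: lam_gt0 | case: val].
have -> : rat A F v = expR (- (- (kap * ln (rat A F v))) / kap).
  rewrite opprK mulrAC mulfV ?gt_eqF // mul1r.
  by rewrite lnK.
by rewrite !ler_expR !ler_pM2r ?invr_gt0 // !lerN2 H1 H2.
Qed.

Lemma tlo_ge0 M v : 0 <= tlo M v.
Proof. by rewrite /tlo le_max lexx. Qed.

Lemma atau_ge1 v : 1 <= a + tau v.
Proof. by have := tau_ge0 v; move: a_gt1; lra. Qed.

Lemma thi_ge0 M v : 0 <= M -> 0 <= thi M v.
Proof.
move=> M0; rewrite /thi subr_ge0; apply: (@le_trans _ _ (a + tau v)).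
  by rewrite lerDl tau_ge0.
rewrite ler_peMl //; first by apply: le_trans (atau_ge1 v).
by rewrite -expR0 ler_expR.
Qed.

(** The trivial bounds [0] and [1] at the children already put [-(k-1) ln rat] in
    [[0, expR (2 - a) + slack K]]. Since [a + T >= 1], the logarithmic distance is at most the
    ordinary one. *)
Lemma claim_base K : claim K (expR (2 - a) + slack K).
Proof.
move=> A F v val.
have /andP[_ U] : fsum v (fun e => \prod_(u in e :\ v) 0) - slack K
    <= - (kap * ln (rat A F v))
    <= fsum v (fun e => \prod_(u in e :\ v) 1) + slack K.
  apply: (rat_log_bounds K (fun=> 0) (fun=> 1) A F v) => [u|u|A' F' u _|//].
  - by rewrite lexx ler01.
  - by rewrite ler01 lexx.
  - by rewrite rat_ge0 ?rat_le1 //; apply: lam_gt0.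
apply: (rat_expR K) => //.
set T := - (kap * _) in U *.
have T0 : 0 <= T.
  rewrite /T oppr_ge0 mulr_ge0_le0 ?(ltW kap_gt0) // ln_le0 // rat_le1 //.
  exact: lam_gt0.
have U' : T <= expR (2 - a) + slack K.
  apply: (le_trans U); rewrite lerD2r; apply: le_trans temper_le.
  by apply: fsum_le_temper => e _ _; rewrite big1.
set M := _ + slack K in U' *.
have M0 : 0 <= M by exact: le_trans U'.
have s0 := slack_ge0 K.
have eM := expR_ge1Dx M.
have t0 := tau_ge0 v; have t1 := tau_le v.
rewrite /tlo /thi ge_max T0 /=; apply/andP; split.
  have : a + tau v <= expR M * (a + T).
    apply: (@le_trans _ _ ((1 + M) * (a + T))); last first.
      by rewrite ler_wpM2r //; move: a_gt1; lra.
    have : 0 <= M * (a + T - 1) by rewrite mulr_ge0 //; move: a_gt1; lra.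
    by rewrite /M; move: s0 t1; lra.
  rewrite expRN -ler_pdivrMl ?expR_gt0 // => h.
  by rewrite lerBlDr [T + a]addrC.
have : (1 + M) * (a + tau v) <= expR M * (a + tau v).
  by rewrite ler_wpM2r //; apply: le_trans (atau_ge1 v).
have : 0 <= M * (a + tau v - 1) by rewrite mulr_ge0 // subr_ge0 atau_ge1.
by move: U' t0; lra.
Qed.

(** Converts the additive [slack] into an increase of the radius: on a quantity that is at least
    [1], adding [s] costs at most the factor [1 + s <= expR s]. *)
Lemma expR_absorb (y s X Y : R) : 0 <= s -> 1 <= Y -> X <= expR y * Y + s ->
  0 <= y -> X <= expR (y + s) * Y.
Proof.
move=> s0 Y1 XY y0; apply: (le_trans XY); rewrite expRD.
have e1 : 1 <= expR y by rewrite -expR0 ler_expR.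
have H : 1 <= expR y * Y by rewrite -[leLHS]mulr1 ler_pM.
apply: (@le_trans _ _ ((1 + s) * (expR y * Y))).
  have : 0 <= s * (expR y * Y - 1) by rewrite mulr_ge0 // subr_ge0.
  by move: (expR y * Y) => z; lra.
rewrite [expR y * expR s]mulrC -mulrA ler_wpM2r //.
  exact: le_trans ler01 H.
exact: expR_ge1Dx.
Qed.

(** The recursion reverses order: lower endpoints at the children bound [-(k-1) ln rat] at [v] from
    above, and conversely. [H1] contracts the pair [tlo], [tau], and [H2] the pair [tau], [thi]. *)
Lemma claim_step K M : 0 <= M -> claim (K + k) M -> claim K (rate R a * M + slack K).
Proof.
move=> M0 child A F v val.
pose lo u := expR (- thi M u / kap); pose hi u := expR (- tlo M u / kap).
have lo01 u : 0 <= lo u <= 1.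
  by rewrite expR_ge0 expR_le1 mulNr oppr_le0 divr_ge0 ?thi_ge0 ?(ltW kap_gt0).
have hi01 u : 0 <= hi u <= 1.
  by rewrite expR_ge0 expR_le1 mulNr oppr_le0 divr_ge0 ?tlo_ge0 ?(ltW kap_gt0).
have /andP[L U] := rat_log_bounds K lo hi A F v lo01 hi01 child val.
apply: (rat_expR K) => //.
set T := - (kap * _) in L U *.
set S2 := fsum _ _ in L; set S1 := fsum _ _ in U.
have T0 : 0 <= T.
  rewrite /T oppr_ge0 mulr_ge0_le0 ?(ltW kap_gt0) // ln_le0 // rat_le1 //.
  exact: lam_gt0.
have r0 := rate_gt0 R a a_gt1.
have rM0 : 0 <= rate R a * M by rewrite mulr_ge0 // ltW.
have s0 := slack_ge0 K.
have t0 := tau_ge0 v.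
have H1 : a + S1 <= expR (rate R a * M) * (a + tau v).
  have -> : S1 = fsum v (fun e => expR (a - (a + (\sum_(u in e :\ v) tlo M u) / kap))).
    rewrite /S1 /fsum; congr (_ * _); apply: eq_bigr => e _.
    by rewrite /hi prod_expR_link; congr expR; rewrite mulNr; lra.
  apply: (le_trans (fsum_contraction v _ M M0 _)).
    move=> e _ _; rewrite lerDl divr_ge0 ?(ltW kap_gt0) // sumr_ge0 // => u _.
    exact: tlo_ge0.
  rewrite ler_wpM2l ?expR_ge0 // lerD2l [leRHS]tauE; apply: fsum_le => e eE ve.
  rewrite ler_expR -(sum_link_shift _ e v eE ve) mulrA mulr_sumr lerBlDr mulNr.
  rewrite -lerBlDl opprK -(sum_link_shift _ e v eE ve).
  rewrite ler_pM2r ?invr_gt0 //; apply: ler_sum => u _.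
  rewrite -ler_pdivrMl ?expR_gt0 // -expRN -lerBlDl /tlo le_max.
  by apply/orP; right; lra.
have H2 : a + tau v <= expR (rate R a * M) * (a + S2).
  have -> : tau v = fsum v (fun e => expR (a - (a + (\sum_(u in e :\ v) tau u) / kap))).
    rewrite {1}tauE /fsum; congr (_ * _); apply: eq_bigr => e _.
    by congr expR; rewrite mulNr; lra.
  apply: (le_trans (fsum_contraction v _ M M0 _)).
    move=> e _ _; rewrite lerDl divr_ge0 ?(ltW kap_gt0) // sumr_ge0 // => u _.
    exact: tau_ge0.
  rewrite ler_wpM2l ?expR_ge0 // lerD2l; apply: fsum_le => e eE ve.
  rewrite /lo prod_expR_link ler_expR -(sum_link_shift _ e v eE ve) mulrA mulr_sumr.
  rewrite lerBlDr mulNr -lerBlDl opprK -(sum_link_shift _ e v eE ve).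
  rewrite ler_pM2r ?invr_gt0 //; apply: ler_sum => u _.
  by rewrite /thi; lra.
rewrite /tlo /thi ge_max T0 /=; apply/andP; split.
  have : a + tau v <= expR (rate R a * M + slack K) * (a + T).
    have aT : 1 <= a + T by move: a_gt1; lra.
    rewrite expRD -mulrA; apply: (le_trans H2).
    rewrite ler_wpM2l ?expR_ge0 //.
    apply: (@le_trans _ _ ((1 + slack K) * (a + T))); last first.
      by rewrite ler_wpM2r ?expR_ge1Dx //; apply: le_trans aT.
    have : 0 <= slack K * (a + T - 1) by rewrite mulr_ge0 // subr_ge0.
    by move: L; lra.
  rewrite -ler_pdivrMl ?expR_gt0 // -expRN => h.
  by rewrite lerBlDr [T + a]addrC.
rewrite lerBrDl; apply: expR_absorb => //; first exact: atau_ge1.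
by move: U H1; lra.
Qed.

Lemma claim_mono K M M' : M <= M' -> claim K M -> claim K M'.
Proof.
move=> MM cl A F v val; have /andP[L U] := cl A F v val.
have at0 : 0 <= a + tau v by exact: le_trans (atau_ge1 v).
apply/andP; split.
  apply: le_trans L; rewrite ler_expR ler_pM2r ?invr_gt0 // lerN2 /thi lerD2r.
  by rewrite ler_wpM2r // ler_expR.
apply: (le_trans U); rewrite ler_expR ler_pM2r ?invr_gt0 // lerN2 /tlo.
rewrite ge_max le_max lexx /= le_max lerD2r; apply/orP; right.
by rewrite ler_wpM2r // ler_expR lerN2.
Qed.

Lemma slack_mono K K' : (K <= K')%N -> slack K <= slack K'.
Proof.
move=> KK; rewrite /slack ler_wpM2r ?(ltW eta_gt0) // lerD2l.
rewrite ler_wpM2l ?mulr_ge0 ?exprn_ge0 ?(ltW kap_gt0) //; first exact: le_trans ler01 _.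
by rewrite ler_nat leq_add ?leq_add2l // leq_mul2l leq_exp2l.
Qed.

(** Each level may pin [k] more vertices, so [Kmax] bounds the pinned sets of all [L] levels and
    [slack Kmax] their errors. The second summand is the fixed point of
    [M |-> rate a * M + slack Kmax]. *)
Lemma claim_iter Kmax L K : (K + L * k <= Kmax)%N ->
  claim K (rate R a ^+ L * (expR (2 - a) + slack Kmax) + slack Kmax / (1 - rate R a)).
Proof.
have r1 := rate_lt1 R a a_gt1; have r0 := rate_gt0 R a a_gt1.
have s0 := slack_ge0 Kmax; have e0 := expR_gt0 (2 - a).
have q0 : 0 < 1 - rate R a by rewrite subr_gt0.
have sq0 : 0 <= slack Kmax / (1 - rate R a) by rewrite divr_ge0 // ltW.
elim: L K => [|L IH] K KL.
  rewrite expr0 mul1r; apply: claim_mono (claim_base K).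
  have : slack K <= slack Kmax by apply: slack_mono; rewrite addn0 in KL.
  by move: sq0; lra.
have KL' : (K + k + L * k <= Kmax)%N by rewrite -addnA -mulSn.
have M0 : 0 <= rate R a ^+ L * (expR (2 - a) + slack Kmax) + slack Kmax / (1 - rate R a).
  by rewrite addr_ge0 // mulr_ge0 ?exprn_ge0 ?addr_ge0 // ltW.
apply: claim_mono (claim_step K _ M0 (IH _ KL')).
have h1 : slack K <= slack Kmax.
  by apply: slack_mono; apply: leq_trans KL; rewrite leq_addr.
have h2 : slack Kmax / (1 - rate R a) = rate R a * (slack Kmax / (1 - rate R a)) + slack Kmax.
  by field; rewrite gt_eqF.
move: h1 h2; rewrite exprS; move: (_ / (1 - rate R a)) (rate R a ^+ L) => x y; lra.
Qed.

Let E_ne e : e \in E -> (0 < #|e|)%N. Proof. by move=> /unifE ->. Qed.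

Local Notation Zin := (@Zin R V lam zeta).

Definition pi (W : {set V}) : R := \prod_(w in W) (lam * expR (- tau w / kap)).

Lemma pi_gt0 W : 0 < pi W.
Proof. by apply: prodr_gt0 => w _; rewrite mulr_gt0 ?expR_gt0 ?lam_gt0. Qed.

(** The edges inside [W] are contained in every [S] of the sum, so their penalties factor out. What
    remains has no edge inside [W], as [valid] requires. *)
Lemma Zin_inner W :
  Zin W E = (1 - zeta) ^+ #|inner V E W| * Zin W (E :\: inner V E W).
Proof.
rewrite /Zin mulr_sumr; apply: eq_bigr => S WS; rewrite /wt mulrCA; congr (_ * _).
rewrite -exprD; congr (_ ^+ _).
rewrite -(cardsID (inner V E W) (inner V E S)); congr (_ + _)%N; apply: eq_card => e; rewrite !inE.
  case: (e \in E) => //=; apply/andP/idP => [[]//|eW]; split=> //.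
  exact: subset_trans WS.
by rewrite andbA.
Qed.

Lemma oneB_expn_ge (x : R) n : 0 <= x <= 1 -> 1 - n%:R * x <= (1 - x) ^+ n.
Proof.
move=> /andP[x0 x1]; elim: n => [|n IH]; first by rewrite mul0r subr0 expr0.
rewrite exprS; apply: (@le_trans _ _ ((1 - x) * (1 - n%:R * x))).
  rewrite -natr1; have : 0 <= n%:R * x * x by rewrite !mulr_ge0.
  by lra.
by rewrite ler_wpM2l // subr_ge0.
Qed.

Let lam_ge0 : 0 <= lam. Proof. by apply: ltW; apply: lam_gt0. Qed.
Let lam_le1 : lam <= 1. Proof. by have := lam_half; lra. Qed.

(** An edge is nonempty, so the sets containing it carry at most a share [lam] of the partition
    function; penalising it removes no more than that. *)
Lemma Zin_drop_edges (X F : {set {set V}}) : X \subset E ->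
  (1 - lam) ^+ #|X| * Zin set0 F <= Zin set0 (X :|: F).
Proof.
have Z0 := Zin_ge0 R V lam zeta lam_gt0 zeta_le1.
have [n nX] := ubnP #|X|; elim: n => // n IH in X nX *.
case: (set_0Vmem X) => [->|[e eX]] XE; first by rewrite cards0 expr0 mul1r set0U.
have cX : #|X| = #|X :\ e|.+1 by rewrite (cardsD1 e) eX.
have {}IH : (1 - lam) ^+ #|X :\ e| * Zin set0 F <= Zin set0 (X :\ e :|: F).
  apply: IH; first by rewrite -ltnS -cX.
  exact: subset_trans (subD1set _ _) XE.
have -> : X :|: F = e |: (X :\ e :|: F) by rewrite setUA setD1K.
set F' := X :\ e :|: F in IH *.
have h : (1 - lam) * Zin set0 F' <= Zin set0 (e |: F').
  case: (boolP (e \in F')) => eF'.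
    have -> : e |: F' = F' by apply/setUidPr; rewrite sub1set.
    by rewrite ler_piMl // gerBl.
  rewrite Zin_setU1 // mulrBl mul1r lerD2l lerN2.
  apply: (@le_trans _ _ (1 * Zin (e :|: set0) F')); first by rewrite ler_wpM2r.
  rewrite mul1r; apply: (le_trans (Zin_pins_le R V lam zeta lam_gt0 zeta_ge0 zeta_le1 _ _ _)).
  rewrite ler_wpM2r // setD0 -[leRHS]expr1 ler_wiXn2l //.
  by rewrite E_ne // (subsetP XE).
by apply: le_trans h; rewrite cX exprS -mulrA ler_wpM2l // subr_ge0.
Qed.

(** Converts the radius into a relative error: [expR M - 1 <= 2 * M] for [M <= 1/2], and
    [a + tau v <= a + expR (2 - a)]. *)
Lemma claim_ratio K (M : R) A F v : 0 <= M <= 2^-1 -> claim K M -> valid V E K m A F v ->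
  expR (- (2 * M * (a + expR (2 - a)))) * expR (- tau v / kap) <= rat A F v
  <= expR (2 * M * (a + expR (2 - a))) * expR (- tau v / kap).
Proof.
move=> /andP[M0 M1] cl val; have /andP[L U] := cl A F v val.
have t0 := tau_ge0 v; have t1 := tau_le v; set H := a + expR (2 - a).
have aH : a + tau v <= H by rewrite lerD2l.
have a1 := atau_ge1 v.
have MH : 0 <= 2 * M * H.
  by rewrite mulr_ge0 ?mulr_ge0 //; move: aH a1; lra.
have eM : expR M <= 1 + 2 * M.
  have h : 0 < 1 - M by lra.
  rewrite -[M]opprK expRN opprK; apply: (@le_trans _ _ (1 - M)^-1).
    by rewrite lef_pV2 ?posrE ?expR_gt0 // expR_ge1Dx.
  rewrite -div1r ler_pdivrMr //.
  have : 0 <= M * (1 - 2 * M) by rewrite mulr_ge0; lra.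
  by lra.
have eM' := expR_ge1Dx (- M).
have kk : 2 * M * H / kap <= 2 * M * H by rewrite ler_pdivrMr // ler_peMr // kap_ge1.
rewrite -!expRD; apply/andP; split.
  apply: le_trans L; rewrite ler_expR !mulNr.
  have : thi M v / kap <= (tau v + 2 * M * H) / kap.
    rewrite ler_pM2r ?invr_gt0 // /thi.
    have h : (expR M - 1) * (a + tau v) <= 2 * M * H.
      apply: ler_pM => //; first by rewrite subr_ge0 -expR0 ler_expR.
        exact: le_trans a1.
      by move: eM; lra.
    by move: h; lra.
  by rewrite mulrDl; move: kk; lra.
apply: (le_trans U); rewrite ler_expR !mulNr.
have : (tau v - 2 * M * H) / kap <= tlo M v / kap.
  rewrite ler_pM2r ?invr_gt0 // /tlo le_max; apply/orP; right.
  have h : (1 - expR (- M)) * (a + tau v) <= 2 * M * H.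
    apply: ler_pM => //; first by rewrite subr_ge0 expR_le1 oppr_le0.
      exact: le_trans a1.
    by move: eM'; lra.
  by move: h; lra.
by rewrite mulrBl; move: kk; lra.
Qed.

(** Once the edges inside [W] are factored out, they are the at most [m] missing edges that [valid]
    tolerates, and the chain rule applies to [W]. [Zin_drop_edges] then restores them in the
    normalisation. *)
Lemma pins_bounds K (M eps : R) (W : {set V}) : 0 <= M <= 2^-1 -> claim K M -> (#|W| <= K)%N ->
  (#|inner V E W| <= m)%N ->
  2 * (K%:R * (2 * M * (a + expR (2 - a))) + (K + m)%:R * lam) <= eps -> eps <= 1 ->
  `|Zin W E / Zin set0 E - (1 - zeta) ^+ #|inner V E W| * pi W|
     <= eps * ((1 - zeta) ^+ #|inner V E W| * pi W).
Proof.
move=> M01 cl WK Wm He e1.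
set rho := 2 * M * (a + expR (2 - a)) in He *.
set F := E :\: inner V E W.
have FE : F \subset E by apply: subsetDl.
have FW f : f \in F -> ~~ (f \subset W).
  by rewrite !inE negb_and => /andP[/orP[/negP fE fEE|//]].
have rho0 : 0 <= rho.
  rewrite /rho; case/andP: M01 => M0 _; rewrite mulr_ge0 ?mulr_ge0 //.
  by have := expR_gt0 (2 - a); move: a_gt1; lra.
have Z0 := Zin_ge0 R V lam zeta lam_gt0 zeta_le1.
have E0 f : f \in E -> ~~ (f \subset set0).
  by move=> fE; rewrite subset0 -card_gt0 E_ne.
have ZE : 0 < Zin set0 E by apply: (Zin_gt0 R V lam zeta lam_gt0 zeta_le1).
have ZF : 0 < Zin set0 F.
  by apply: (Zin_gt0 R V lam zeta lam_gt0 zeta_le1) => f /(subsetP FE); apply: E0.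
have ch : (lam / (1 + lam)) ^+ #|W| * \prod_(u in W) (expR (- rho) * expR (- tau u / kap)) * Zin set0 F
    <= Zin (W :|: set0) F
    <= lam ^+ #|W| * \prod_(u in W) (expR rho * expR (- tau u / kap)) * Zin set0 F.
  apply: (Zin_chain R V lam zeta lam_gt0 zeta_ge0 zeta_le1 set0 F W) => [|u|u|Y u YW uW uY].
  - by rewrite disjoints_subset setC0 subsetT.
  - by rewrite mulr_ge0 ?expR_ge0.
  - by rewrite mulr_ge0 ?expR_ge0.
  have fN f : f \in F -> ~~ (f \subset u |: (Y :|: set0)).
    move=> /FW; apply: contra => fs; apply: (subset_trans fs).
    by rewrite setU0 subUset sub1set uW YW.
  split=> //; apply: (claim_ratio K) => //; split=> //.
  - by rewrite setU0.
  - by rewrite setU0; apply: leq_trans WK; apply: subset_leq_card.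
  - apply: leq_trans Wm; apply/subset_leq_card/subsetP => f.
    by rewrite !inE negb_and negbK => /andP[/andP[/orP[//|/negbTE ->]]].
have cpi c : \prod_(u in W) (c * expR (- tau u / kap)) = c ^+ #|W| * \prod_(u in W) expR (- tau u / kap).
  by rewrite big_split /= prodr_const.
have EP : pi W = lam ^+ #|W| * \prod_(u in W) expR (- tau u / kap) by rewrite /pi cpi.
rewrite !cpi setU0 in ch.
have P0 := pi_gt0 W.
set z := (1 - zeta) ^+ _; have z0 : 0 <= z by rewrite exprn_ge0 // subr_ge0.
set p := \prod_(u in W) _ in ch EP.
have p0 : 0 <= p by apply: prodr_ge0 => u _; apply: expR_ge0.
have -> : Zin W E / Zin set0 E = z * (Zin W F / Zin set0 E).
  by rewrite Zin_inner mulrA.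
rewrite -mulrBr normrM ger0_norm // mulrCA ler_wpM2l //.
have K0 : 0 <= K%:R * rho by rewrite mulr_ge0.
have Km0 : 0 <= K%:R * lam by rewrite mulr_ge0.
have m0 : 0 <= m%:R * lam by rewrite mulr_ge0.
have {}He : 2 * (K%:R * rho) + 2 * (K%:R * lam) + 2 * (m%:R * lam) <= eps.
  by move: He; rewrite natrD; lra.
have Wr : #|W|%:R * rho <= K%:R * rho by rewrite ler_wpM2r // ler_nat.
have Wl : #|W|%:R * lam <= K%:R * lam by rewrite ler_wpM2r // ler_nat.
have zEF : Zin set0 E <= Zin set0 F by apply: (Zin_mono R V lam zeta lam_gt0 zeta_ge0 zeta_le1).
have zFE : (1 - m%:R * lam) * Zin set0 F <= Zin set0 E.
  have h := Zin_drop_edges (inner V E W) F.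
  have HU : inner V E W :|: F = E.
    by apply/setP => f; rewrite !inE; case: (f \in E) => //=; case: (f \subset W).
  rewrite HU in h; apply: le_trans (h _); last first.
    by apply/subsetP => f; rewrite inE => /andP[].
  rewrite ler_wpM2r //; apply: (@le_trans _ _ (1 - #|inner V E W|%:R * lam)).
    by rewrite lerD2l lerN2 ler_wpM2r // ler_nat.
  by apply: oneB_expn_ge; rewrite lam_ge0.
have eW : expR (- rho) ^+ #|W| = expR (- (#|W|%:R * rho)).
  by rewrite -expRM_natl mulrN.
have eW' : expR rho ^+ #|W| = expR (#|W|%:R * rho) by rewrite -expRM_natl.
rewrite ler_distl; case/andP: ch => chL chU; apply/andP; split.
  rewrite -[X in X - _]mul1r -mulrBl ler_pdivlMr //.
  apply: (@le_trans _ _ ((1 - eps) * pi W * Zin set0 F)).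
    rewrite ler_wpM2l // mulr_ge0 ?(ltW P0) // subr_ge0 //.
  apply: le_trans chL; rewrite ler_wpM2r // expr_div_n EP eW.
  have q1 : 1 - K%:R * lam <= ((1 + lam) ^+ #|W|)^-1.
    apply: (@le_trans _ _ ((1 - lam) ^+ #|W|)).
      apply: (@le_trans _ _ (1 - #|W|%:R * lam)); first by rewrite lerD2l lerN2.
      by apply: oneB_expn_ge; rewrite lam_ge0.
    rewrite -exprVn lerXn2r ?nnegrE ?invr_ge0 ?subr_ge0 ?addr_ge0 //.
    rewrite -[leRHS]div1r ler_pdivlMr ?ltr_pwDl //.
    by have := mulr_ge0 lam_ge0 lam_ge0; lra.
  have q2 : 1 - K%:R * rho <= expR (- (#|W|%:R * rho)).
    by apply: le_trans (expR_ge1Dx _); rewrite lerD2l lerN2.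
  have q3 : 1 - eps <= ((1 + lam) ^+ #|W|)^-1 * expR (- (#|W|%:R * rho)).
    apply: (@le_trans _ _ ((1 - K%:R * lam) * (1 - K%:R * rho))).
      by have := mulr_ge0 Km0 K0; move: He m0 Km0 K0; lra.
    by apply: ler_pM => //; move: He m0 Km0 K0 e1; lra.
  have -> : lam ^+ #|W| / (1 + lam) ^+ #|W| * (expR (- (#|W|%:R * rho)) * p) =
     ((1 + lam) ^+ #|W|)^-1 * expR (- (#|W|%:R * rho)) * (lam ^+ #|W| * p).
    by move: (lam ^+ _) (_^-1) (expR _) => x y u; ring.
  by rewrite ler_wpM2r // mulr_ge0 // exprn_ge0.
rewrite -[X in X + _]mul1r -mulrDl ler_pdivrMr //.
apply: (le_trans chU).
apply: (@le_trans _ _ ((1 + eps) * pi W * ((1 - m%:R * lam) * Zin set0 F))); last first.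
  rewrite ler_wpM2l // mulr_ge0 ?(ltW P0) //; move: He m0 Km0 K0; lra.
rewrite [leRHS]mulrA ler_wpM2r // EP eW'.
have q4 : expR (#|W|%:R * rho) <= (1 + eps) * (1 - m%:R * lam).
  apply: (@le_trans _ _ (1 - K%:R * rho)^-1).
    rewrite -[X in expR X]opprK expRN lef_pV2 ?posrE ?expR_gt0 //.
      by apply: le_trans (expR_ge1Dx _); rewrite lerD2l lerN2.
    by move: He m0 Km0 K0 e1; lra.
  have h1 : 0 < 1 - K%:R * rho by move: He m0 Km0 K0 e1; lra.
  rewrite -[leLHS]div1r ler_pdivrMr //.
  move: He m0 Km0 K0 e1; move: (K%:R * rho) (m%:R * lam) (K%:R * lam) => x y u He y0 u0 x0 e1.
  have y2 : y <= eps / 2 - x by lra.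
  have xy : 0 <= x * y by rewrite mulr_ge0.
  have h3 : (1 - eps / 2) <= (1 - y) * (1 - x) by lra.
  have h4 : 0 <= eps * (1 - eps) by rewrite mulr_ge0; lra.
  have h5 : (1 + eps) * (1 - eps / 2) <= (1 + eps) * ((1 - y) * (1 - x)).
    by rewrite ler_wpM2l //; lra.
  by move: h4 h5; lra.
have -> : lam ^+ #|W| * (expR (#|W|%:R * rho) * p) = expR (#|W|%:R * rho) * (lam ^+ #|W| * p).
  by rewrite mulrCA.
have -> : (1 + eps) * (lam ^+ #|W| * p) * (1 - m%:R * lam) =
  (1 + eps) * (1 - m%:R * lam) * (lam ^+ #|W| * p).
  by rewrite mulrAC.
by rewrite ler_wpM2r // mulr_ge0 // exprn_ge0.
Qed.

End MeanField.

(** * Uniform asymptotics for the occupation of small sets *)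

Section Marginals.
Import mathcomp.boot.fintype mathcomp.boot.finset.
Import numFieldNormedType.Exports.
Variable R : realType.

Lemma pow_small (r e : R) : 0 < r -> r < 1 -> 0 < e -> exists L, r ^+ L <= e.
Proof.
move=> r0 r1 e0.
have h : `|r| < 1 by rewrite gtr0_norm.
have := cvg_expr h => /cvgrPdist_le /(_ e e0) [L _ HL].
exists L; have := HL L (leqnn L).
by rewrite /= sub0r normrN ger0_norm // exprn_ge0 // ltW.
Qed.

Definition pinned_prob (V : finType) (lam zeta : R) (E : {set {set V}}) (W : {set V}) : R :=
  Zin R V lam zeta W E / Zin R V lam zeta set0 E.

(* [tau] is [-(k-1) ln (x / t)] for the mean-field solution [x]. *)
Definition mean_field (V : finType) (k : nat) (E : {set {set V}}) (D zeta t : R)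
    (tau : V -> R) : Prop :=
  forall v, tau v = fsum R V k E D zeta t v
     (fun e => expR (- (\sum_(u in e :\ v) tau u) / kap R k)).

(** [eta] precedes the hypergraph, [t] and [W], which makes the estimate uniform in all of them. The
    size [2 * k] is that of a union of two edges, needed for covariances. *)
Lemma pinned_prob_asymp (k : nat) (a c1 eps : R) : (2 <= k)%N -> 1 < a -> 1 <= c1 -> 0 < eps ->
  exists eta : R, [/\ 0 < eta, c1 * eta <= 2^-1 &
   forall (V : finType) (E : {set {set V}}) (D beta zeta t : R) (tau : V -> R),
   near_tree R V k E D beta eta -> 0 <= zeta -> zeta <= 1 -> 0 < t -> t <= c1 ->
   temper R k zeta t <= expR (2 - a) -> mean_field V k E D zeta t tau ->
   forall W : {set V}, (#|W| <= 2 * k)%N ->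
   `|pinned_prob V (t * beta) zeta E W
      - (1 - zeta) ^+ #|inner V E W| * \prod_(w in W) (t * beta * expR (- tau w / kap R k))|
   <= eps * ((1 - zeta) ^+ #|inner V E W| * \prod_(w in W) (t * beta * expR (- tau w / kap R k)))].
Proof.
move=> k2 a1 c11 eps0.
pose eps' := Num.min eps 1; pose K := (2 * k)%N; pose m := (2 ^ K)%N.
have e'0 : 0 < eps' by rewrite lt_min eps0 ltr01.
have c10 : 0 < c1 by exact: lt_le_trans ltr01 c11.
pose H := a + expR (2 - a).
have H0 : 0 < H by rewrite addr_gt0 ?expR_gt0 // (lt_trans ltr01).
pose mu := Num.min 2^-1 (eps' / (8 * (K%:R + 1) * H)).
have K0 : 0 <= K%:R :> R by [].
have den0 : 0 < 8 * (K%:R + 1) * H by rewrite !mulr_gt0 // addr_ge0.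
have mu0 : 0 < mu by rewrite lt_min invr_gt0 ltr0n /= divr_gt0.
have r0 := rate_gt0 R a a1; have r1 := rate_lt1 R a a1.
have ex0 := expR_gt0 (2 - a).
have ex1 : 0 < expR (2 - a) + 1 by rewrite addr_gt0.
(* Half of the target radius [mu] is for the contracted initial radius, half for the accumulated
   slack. The depth is fixed here, before [eta], because [Kmax] and the constant in the slack grow
   with it. *)
have [L HL] : exists L, rate R a ^+ L <= mu / 2 / (expR (2 - a) + 1).
  by apply: pow_small => //; rewrite !divr_gt0.
pose Kmax := (K + L * k)%N.
pose cst := 6 * kap R k * c1 * expR (2 - a) + 2 * kap R k * c1 ^+ k * (m + Kmax + 3 * 2 ^ Kmax.+1)%:R.
have kap0 : 0 <= kap R k by rewrite /kap.
have cst0 : 0 <= cst.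
  by rewrite /cst addr_ge0 // !mulr_ge0 ?exprn_ge0 // ltW.
pose b1 := Num.min 1 ((1 - rate R a) * (mu / 2)).
have b10 : 0 < b1 by rewrite lt_min ltr01 mulr_gt0 ?subr_gt0 ?divr_gt0.
(* The three terms ensure [lam <= 1/2], a slack of at most [b1], and a small total of the errors of
   order [lam] in [pins_bounds]. *)
pose eta := Num.min (2^-1 / c1) (Num.min (b1 / (cst + 1)) (eps' / (4 * ((K + m)%:R + 1) * c1))).
have cst1 : 0 < cst + 1 by rewrite ltr_wpDl.
have d4 : 0 < 4 * ((K + m)%:R + 1) * c1 :> R by rewrite !mulr_gt0 // ltr_wpDl.
have eta0 : 0 < eta.
  by rewrite !lt_min !divr_gt0 ?invr_gt0 ?ltr0n.
have eta1 : eta <= 2^-1 / c1 by rewrite ge_min lexx.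
have eta2 : eta <= b1 / (cst + 1) by rewrite !ge_min lexx ?orbT.
have eta3 : eta <= eps' / (4 * ((K + m)%:R + 1) * c1) by rewrite !ge_min lexx ?orbT.
have ceta : c1 * eta <= 2^-1 by rewrite -ler_pdivlMl // mulrC.
exists eta; split=> // V E D beta zeta t tau NT z0 z1 t0 tc temp mf W WK.
have slackE : slack R k eta a c1 m Kmax = cst * eta by [].
have sl : slack R k eta a c1 m Kmax <= b1.
  rewrite slackE; apply: (@le_trans _ _ ((cst + 1) * eta)).
    by rewrite ler_wpM2r ?(ltW eta0) // lerDl.
  by rewrite -ler_pdivlMl // mulrC.
have sl1 : slack R k eta a c1 m Kmax <= 1 by apply: (le_trans sl); rewrite ge_min lexx.
have sl2 : slack R k eta a c1 m Kmax / (1 - rate R a) <= mu / 2.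
  rewrite ler_pdivrMr ?subr_gt0 // mulrC; apply: (le_trans sl).
  by rewrite ge_min lexx orbT.
have cl := claim_iter R V k E D beta eta NT a c1 zeta t a1 c11 ceta z0 z1 t0 tc temp m tau mf
   Kmax L K (leqnn _).
have {}cl : claim R V k E beta a zeta t m tau K mu.
  apply: (claim_mono R V k E D beta eta NT a c1 zeta t a1 c11 ceta z0 t0 m tau mf _ _ _ _ cl).
  have h : rate R a ^+ L * (expR (2 - a) + slack R k eta a c1 m Kmax) <= mu / 2.
    apply: (@le_trans _ _ (rate R a ^+ L * (expR (2 - a) + 1))).
      by rewrite ler_wpM2l ?exprn_ge0 ?(ltW r0) // lerD2l.
    by rewrite -ler_pdivlMr.
  by have := lerD h sl2; rewrite -splitr.
have Wm : (#|inner V E W| <= m)%N.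
  apply: (@leq_trans #|powerset W|).
    by apply/subset_leq_card/subsetP => e; rewrite powersetE inE => /andP[].
  by rewrite card_powerset leq_exp2l.
have lc : lam R beta t <= c1 * eta.
  by apply: (lam_le_eta R V k E D beta eta NT c1 t c11 tc).
have le' : eps' <= eps by rewrite ge_min lexx.
have mu01 : 0 <= mu <= 2^-1 by rewrite (ltW mu0) ge_min lexx.
have He : 2 * (K%:R * (2 * mu * (a + expR (2 - a))) + (K + m)%:R * lam R beta t) <= eps'.
  have h1 : 8 * (K%:R + 1) * H * mu <= eps'.
    rewrite -ler_pdivlMl // mulrC ge_min; apply/orP; right.
    by rewrite lexx.
  have h2 : 4 * ((K + m)%:R + 1) * c1 * eta <= eps' by rewrite -ler_pdivlMl // mulrC.
  have h3 : (K + m)%:R * lam R beta t <= (K + m)%:R * (c1 * eta) by rewrite ler_wpM2l.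
  have h4 : 0 <= c1 * eta by rewrite mulr_ge0 // ltW.
  have h5 : 0 <= H * mu by rewrite mulr_ge0 // ltW.
  rewrite -/H; move: h1 h2 h3 h4 h5; move: K%:R (K + m)%:R => x y; lra.
have e'1 : eps' <= 1 by rewrite ge_min lexx orbT.
have := pins_bounds R V k E D beta eta NT a c1 zeta t a1 c11 ceta z0 z1 t0 tc temp m tau mf
  K mu eps' W mu01 cl WK Wm He e'1.
move=> h; apply: (le_trans h); rewrite ler_wpM2r // mulr_ge0 ?exprn_ge0 ?subr_ge0 //.
by apply: prodr_ge0 => w _; rewrite mulr_ge0 ?expR_ge0 // mulr_ge0 // ltW //; case: NT.
Qed.

End Marginals.

(** * Variances *)

Section Variance.
Import mathcomp.boot.fintype mathcomp.boot.finset.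
Variables (R : realType) (V : finType) (k : nat) (E : {set {set V}}).
Implicit Types (A B S W e f g : {set V}).
Variables (D beta eta : R).
Hypothesis NT : near_tree R V k E D beta eta.
Variables (zeta lam c1 eps : R) (y : V -> R).
Hypotheses (zeta_ge0 : 0 <= zeta) (zeta_le1 : zeta <= 1).
Hypotheses (lam_gt0 : 0 < lam) (lam_le1 : lam <= 1).
Hypotheses (c1_ge1 : 1 <= c1) (lam_le : lam <= c1 * beta).
Hypotheses (eps_ge0 : 0 <= eps) (eps_le1 : eps <= 1).
Hypothesis y01 : forall v, 0 <= y v <= lam.

Local Notation P := (pinned_prob R V lam zeta E).
Definition approx_prob W : R :=
  (1 - zeta) ^+ #|inner V E W| * \prod_(w in W) y w.
Hypothesis HP : forall W : {set V}, (#|W| <= 2 * k)%N ->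
  `|P W - approx_prob W| <= eps * approx_prob W.

Let k2 : (2 <= k)%N. Proof. by case: NT. Qed.
Let unifE e : e \in E -> #|e| = k. Proof. by case: NT => _ + *; apply. Qed.
Let beta_gt0 : 0 < beta. Proof. by case: NT. Qed.
Let beta_ge0 : 0 <= beta. Proof. exact: ltW. Qed.
Let k_gt0 : (0 < k)%N. Proof. exact: leq_trans k2. Qed.
Let c1_ge0 : 0 <= c1. Proof. exact: le_trans ler01 _. Qed.
Let lam_ge0 : 0 <= lam. Proof. exact: ltW. Qed.

Definition mean (f : {set V} -> R) : R :=
  (\sum_(S : {set V}) f S * wt R V lam zeta E S) / Zin R V lam zeta set0 E.

Lemma mean_sum (I : finType) (Q : pred I) (W : I -> {set V}) :
  mean (fun S => \sum_(i | Q i) (W i \subset S)%:R) = \sum_(i | Q i) P (W i).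
Proof.
rewrite /mean /pinned_prob -mulr_suml; congr (_ / _).
rewrite (eq_bigr (fun S : {set V} => \sum_(i | Q i) (W i \subset S)%:R * wt R V lam zeta E S)); last first.
  by move=> S _; rewrite mulr_suml.
rewrite exchange_big /=; apply: eq_bigr => i _; rewrite /Zin [RHS]big_mkcond /=.
by apply: eq_bigr => S _; case: ifP => _; rewrite ?mul1r ?mul0r.
Qed.

Lemma variance_sum (I : finType) (Q : pred I) (W : I -> {set V}) :
  mean (fun S => (\sum_(i | Q i) (W i \subset S)%:R) ^+ 2) -
    mean (fun S => \sum_(i | Q i) (W i \subset S)%:R) ^+ 2 =
  \sum_(i | Q i) \sum_(j | Q j) (P (W i :|: W j) - P (W i) * P (W j)).
Proof.
rewrite mean_sum expr2 mulr_suml.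
under [in RHS]eq_bigr => i _ do rewrite sumrB -mulr_sumr.
rewrite sumrB; congr (_ - _).
rewrite pair_big_dep /= -(mean_sum _ (fun p : I * I => Q p.1 && Q p.2) (fun p => W p.1 :|: W p.2)).
rewrite /mean; congr (_ / _); apply: eq_bigr => S _; congr (_ * _).
rewrite expr2 mulr_suml.
transitivity (\sum_(i | Q i) \sum_(j | Q j) ((W i \subset S)%:R * (W j \subset S)%:R : R)).
  by apply: eq_bigr => i _; rewrite mulr_sumr.
rewrite pair_big_dep /=; apply: eq_bigr => -[i j] _ /=.
by rewrite subUset; case: (W i \subset S); case: (W j \subset S); rewrite ?mulr1 ?mulr0 ?mul0r.
Qed.

Lemma pinned_prob_ge0 W : 0 <= P W.
Proof. by rewrite /pinned_prob divr_ge0 // Zin_ge0. Qed.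

Let ZE : 0 < Zin R V lam zeta set0 E.
Proof.
apply: Zin_gt0 => // f fE; rewrite subset0 -card_gt0.
by rewrite unifE.
Qed.

Lemma pinned_prob_le W : P W <= lam ^+ #|W|.
Proof.
rewrite /pinned_prob ler_pdivrMr //.
by have := Zin_pins_le R V lam zeta lam_gt0 zeta_ge0 zeta_le1 set0 E W; rewrite setU0 setD0.
Qed.

Lemma lam_pow_le j : (j <= 2 * k)%N -> lam ^+ j <= c1 ^+ (2 * k) * beta ^+ j.
Proof.
move=> jk; apply: (@le_trans _ _ ((c1 * beta) ^+ j)).
  by rewrite lerXn2r ?nnegrE ?mulr_ge0.
by rewrite exprMn ler_wpM2r ?exprn_ge0 // ler_weXn2l.
Qed.

Lemma approx_prob_ge0 W : 0 <= approx_prob W.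
Proof.
rewrite mulr_ge0 ?exprn_ge0 ?subr_ge0 //; apply: prodr_ge0 => w _.
by case/andP: (y01 w).
Qed.

Lemma approx_prob_le W : approx_prob W <= lam ^+ #|W|.
Proof.
rewrite -[leRHS]mul1r; apply: ler_pM.
- by rewrite exprn_ge0 // subr_ge0.
- by apply: prodr_ge0 => w _; case/andP: (y01 w).
- by apply: exprn_ile1; rewrite ?subr_ge0 // gerBl.
- by rewrite -prodr_const; apply: ler_prod.
Qed.

Lemma cov_any A B : `|P (A :|: B) - P A * P B| <= lam ^+ #|A :|: B|.
Proof.
have h1 := pinned_prob_le (A :|: B); have h0 := pinned_prob_ge0 (A :|: B).
have h2 : P A * P B <= lam ^+ #|A :|: B|.
  apply: (@le_trans _ _ (lam ^+ #|A| * lam ^+ #|B|)).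
    by apply: ler_pM; rewrite ?pinned_prob_ge0 ?pinned_prob_le.
  rewrite -exprD ler_wiXn2l //.
  by case: (leq_card_setU A B).
have h3 : 0 <= P A * P B by rewrite mulr_ge0 ?pinned_prob_ge0.
by rewrite ler_norml; lra.
Qed.

(** Multiplicativity cancels the main terms; the relative errors of the three probabilities leave at
    most [3 * eps + eps ^+ 2 <= 4 * eps]. *)
Lemma cov_good A B : (#|A| <= k)%N -> (#|B| <= k)%N ->
  approx_prob (A :|: B) = approx_prob A * approx_prob B ->
  `|P (A :|: B) - P A * P B| <= 4 * eps * lam ^+ (#|A| + #|B|).
Proof.
move=> Ak Bk EAB.
have cAB : (#|A :|: B| <= 2 * k)%N.
  apply: (@leq_trans (#|A| + #|B|)%N); first by case: (leq_card_setU A B).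
  by rewrite mul2n -addnn leq_add.
have := HP _ cAB; rewrite EAB.
have HA := HP A (leq_trans Ak (leq_pmull _ (isT : 0 < 2)%N)).
have HB := HP B (leq_trans Bk (leq_pmull _ (isT : 0 < 2)%N)).
have qA := approx_prob_ge0 A; have qB := approx_prob_ge0 B.
have pA := pinned_prob_ge0 A; have pB := pinned_prob_ge0 B.
have qAB : approx_prob A * approx_prob B <= lam ^+ (#|A| + #|B|).
  by rewrite exprD; apply: ler_pM; rewrite ?approx_prob_le.
move: HA HB; set a := approx_prob A in qA qAB *; set b := approx_prob B in qB qAB *.
rewrite !ler_distl => /andP[A1 A2] /andP[B1 B2] /andP[C1 C2].
have ab0 : 0 <= a * b by rewrite mulr_ge0.
have e0 : 0 <= eps * (a * b) by rewrite mulr_ge0.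
have u1 : P A * P B <= ((1 + eps) * a) * ((1 + eps) * b).
  by apply: ler_pM => //; lra.
have l1 : ((1 - eps) * a) * ((1 - eps) * b) <= P A * P B.
  have la : (1 - eps) * a <= P A by move: A1; lra.
  have lb : (1 - eps) * b <= P B by move: B1; lra.
  by apply: ler_pM => //; rewrite mulr_ge0 // subr_ge0.
have e1 : eps * (eps * (a * b)) <= eps * (a * b) by rewrite ler_piMl.
have e2 : 0 <= eps * (eps * (a * b)) by rewrite mulr_ge0.
have X : 4 * eps * (a * b) <= 4 * eps * lam ^+ (#|A| + #|B|).
  by rewrite ler_wpM2l // mulr_ge0.
move: X u1 l1 C1 C2 e1 e2 e0.
by move: (P (A :|: B)) (P A * P B) (4 * eps * lam ^+ _) => p q w *; apply/andP; split; lra.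
Qed.

Let N : R := #|V|%:R.

Lemma card_edges_le : #|E|%:R <= N * D.
Proof.
have h : (#|E|%:R : R) <= \sum_(v : V) (deg V E [set v])%:R.
  have -> : \sum_(v : V) (deg V E [set v])%:R = \sum_(e in E) #|e|%:R :> R.
    rewrite (eq_bigr (fun v => \sum_(e in E | v \in e) 1)); last first.
      by move=> v _; rewrite sumr_const; congr (_%:R); apply: eq_card => e; rewrite inE sub1set.
    rewrite (exchange_big_dep (fun e => e \in E)) /=; last by move=> v e _ /andP[].
    apply: eq_bigr => e eE; rewrite sumr_const; congr (_%:R).
    by apply: eq_card => v; rewrite unfold_in /= eE.
  rewrite -sumr_const; apply: ler_sum => e eE.
  by rewrite ler1n unifE.
apply: (le_trans h); rewrite /N mulr_natl -sumr_const.
by apply: ler_sum => v _; apply: (nt_deg1 _ _ _ _ _ _ _ NT).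
Qed.

Lemma edges_beta_le : #|E|%:R * beta ^+ k <= 2 * (N * beta).
Proof.
apply: (@le_trans _ _ (N * D * beta ^+ k)).
  by rewrite ler_wpM2r ?exprn_ge0 ?card_edges_le.
rewrite -{1}(prednK k_gt0) exprSr.
have -> : N * D * (beta ^+ k.-1 * beta) = (D * beta ^+ k.-1) * (N * beta) by ring.
rewrite ler_wpM2r ?mulr_ge0 ?ler0n //.
exact: (D_beta_le R V k E D beta eta NT).
Qed.

(** Covariances are small except on the diagonal and, when [k = 2], for adjacent vertices, whose
    joint probability carries an extra [1 - zeta]. These exceptional pairs contribute only a
    multiple of [N * beta]. *)
Lemma variance_size_le :
  `|mean (fun S => #|S|%:R ^+ 2) - mean (fun S => #|S|%:R) ^+ 2|
    <= 4 * eps * c1 ^+ (2 * k) * (N * beta) ^+ 2 + 3 * c1 ^+ (2 * k) * (N * beta).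
Proof.
have sE S : #|S|%:R = \sum_(v : V) ([set v] \subset S)%:R :> R.
  rewrite -sum1_card natr_sum big_mkcond; apply: eq_bigr => v _.
  by rewrite sub1set; case: (v \in S).
have -> : mean (fun S => #|S|%:R ^+ 2) = mean (fun S => (\sum_(v : V) ([set v] \subset S)%:R) ^+ 2).
  by rewrite /mean; congr (_ / _); apply: eq_bigr => S _; rewrite sE.
have -> : mean (fun S => #|S|%:R) = mean (fun S => \sum_(v : V) ([set v] \subset S)%:R).
  by rewrite /mean; congr (_ / _); apply: eq_bigr => S _; rewrite sE.
rewrite (variance_sum _ xpredT (fun v => [set v])).
apply: (le_trans (ler_norm_sum _ _ _)).
have C0 : 0 <= c1 ^+ (2 * k) by rewrite exprn_ge0.
suff row u : `|\sum_(v : V) (P ([set u] :|: [set v]) - P [set u] * P [set v])|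
   <= 4 * eps * c1 ^+ (2 * k) * (N * beta ^+ 2) + 3 * c1 ^+ (2 * k) * beta.
  apply: (le_trans (ler_sum _ (fun u _ => row u))).
  rewrite sumr_const -[leLHS]mulr_natl -/N.
  by move: (c1 ^+ _) => x; rewrite expr2; lra.
apply: (le_trans (ler_norm_sum _ _ _)).
have h v : `|P ([set u] :|: [set v]) - P [set u] * P [set v]| <=
   4 * eps * lam ^+ 2 + (if v == u then lam else 0) +
   (if (v != u) && ([set u; v] \in E) then lam ^+ k else 0).
  have l2 : 0 <= 4 * eps * lam ^+ 2 by rewrite !mulr_ge0 ?exprn_ge0.
  have lk : 0 <= lam ^+ k by rewrite exprn_ge0.
  case: (eqVneq v u) => [->|vu] /=.
    apply: (le_trans (cov_any _ _)); rewrite setUid cards1 expr1.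
    by rewrite addr0 lerDr.
  rewrite addr0; case: ifP => uvE.
    apply: (le_trans (cov_any _ _)); rewrite unifE //.
    by rewrite lerDr.
  rewrite addr0; have := cov_good [set u] [set v]; rewrite !cards1; apply=> //.
  have i1 w : inner V E [set w] = set0 by apply: (inner_lt_card V E k unifE); rewrite cards1.
  have i2 : inner V E ([set u] :|: [set v]) = set0.
    apply/setP => e; rewrite !inE; apply/negP => /andP[eE es].
    have e2 : (#|e| <= 2)%N.
      by apply: (leq_trans (subset_leq_card es)); rewrite cards2; case: (_ != _).
    have ek := unifE _ eE.
    have : e == [set u; v].
      by rewrite eqEcard es ek cards2 eq_sym vu.
    by move=> /eqP e_eq; rewrite -e_eq eE in uvE.
  rewrite /approx_prob i2 !i1 cards0 !mul1r !big_set1 big_setU1 ?big_set1 //.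
  by rewrite inE eq_sym.
apply: (le_trans (ler_sum _ (fun v _ => h v))).
rewrite !big_split /= -big_mkcond big_pred1_eq -big_mkcond /= sumr_const -[_ *+ #|_|]mulr_natl -/N.
have l1 : lam <= c1 ^+ (2 * k) * beta.
  by have := lam_pow_le 1; rewrite !expr1; apply; rewrite muln_gt0.
have l2 : lam ^+ 2 <= c1 ^+ (2 * k) * beta ^+ 2 by apply: lam_pow_le; rewrite leq_pmulr.
have lk : lam ^+ k <= c1 ^+ (2 * k) * beta ^+ k by apply: lam_pow_le; rewrite leq_pmull.
have h3 : \sum_(i | (i != u) && ([set u; i] \in E)) lam ^+ k <= 2 * (c1 ^+ (2 * k) * beta).
  apply: (@le_trans _ _ (D * lam ^+ k)).
    have -> : \sum_(i | (i != u) && ([set u; i] \in E)) lam ^+ k =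
       #|[set v | (v != u) && ([set u; v] \in E)]|%:R * lam ^+ k.
      by rewrite mulr_natl -sumr_const; apply: eq_bigl => v; rewrite inE.
    rewrite ler_wpM2r ?exprn_ge0 //; apply: le_trans (nt_deg1 _ _ _ _ _ _ _ NT u).
    rewrite ler_nat /deg -(card_in_imset (f := fun v => [set u; v])).
      apply/subset_leq_card/subsetP => e /imsetP[v]; rewrite inE => /andP[_ uvE] ->.
      by rewrite inE uvE sub1set !inE eqxx.
    move=> v w; rewrite !inE => /andP[vu _] /andP[wu _] /setP /(_ v).
    by rewrite !inE eqxx orbT (negbTE vu) /= => /esym/eqP.
  apply: (@le_trans _ _ (D * (c1 ^+ (2 * k) * beta ^+ k))).
    rewrite ler_wpM2l //; apply: le_trans (nt_deg1 _ _ _ _ _ _ _ NT u); exact: ler0n.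
  rewrite -{2}(prednK k_gt0) exprS.
  have -> : D * (c1 ^+ (2 * k) * (beta * beta ^+ k.-1)) = (D * beta ^+ k.-1) * (c1 ^+ (2 * k) * beta).
    by move: (c1 ^+ _) (beta ^+ _) => x z; ring.
  rewrite ler_wpM2r ?mulr_ge0 //; exact: (D_beta_le R V k E D beta eta NT).
have h2 : N * (4 * eps * lam ^+ 2) <= 4 * eps * c1 ^+ (2 * k) * (N * beta ^+ 2).
  have -> : 4 * eps * c1 ^+ (2 * k) * (N * beta ^+ 2) = N * (4 * eps * (c1 ^+ (2 * k) * beta ^+ 2)).
    by move: (c1 ^+ _) (beta ^+ _) => x z; ring.
  by rewrite ler_wpM2l ?ler0n // ler_wpM2l // mulr_ge0.
by move: h2 h3 l1; move: (\sum_(i | _) _) => s *; lra.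
Qed.

Lemma approx_prob_pair e f : e \in E -> f \in E -> [disjoint e & f] ->
  inner V E (e :|: f) = [set e; f] ->
  approx_prob (e :|: f) = approx_prob e * approx_prob f.
Proof.
move=> eE fE dis EI.
have i1 g : g \in E -> inner V E g = [set g] by exact: (inner_edge V E k unifE).
have ef : e != f.
  apply: contraTneq dis => <-; rewrite -setI_eq0 setIid -card_gt0.
  by rewrite unifE.
rewrite /approx_prob EI !i1 // !cards1 cards2 ef.
rewrite (eq_bigl (fun x => x \in [predU e & f])); last by move=> x; rewrite !inE.
rewrite bigU //=.
by rewrite [RHS]mulrACA -exprD.
Qed.

(** Two edges are exceptional if they meet, or if they are disjoint but a third edge lies in their
    union and adds a factor [1 - zeta]. Both kinds contribute only a multiple of [N * beta], by the
    degree conditions. *)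
Lemma variance_edges_le :
  `|mean (fun S => #|inner V E S|%:R ^+ 2) - mean (fun S => #|inner V E S|%:R) ^+ 2|
    <= 16 * eps * c1 ^+ (2 * k) * (N * beta) ^+ 2 +
       2 ^+ k.+4 * c1 ^+ (2 * k) * (N * beta).
Proof.
have sE S : #|inner V E S|%:R = \sum_(e in E) (e \subset S)%:R :> R.
  rewrite -sum1_card natr_sum big_mkcond [RHS]big_mkcond; apply: eq_bigr => e _.
  by rewrite inE; case: (e \in E) => //=; case: (e \subset S).
have -> : mean (fun S => #|inner V E S|%:R ^+ 2) = mean (fun S => (\sum_(e in E) (e \subset S)%:R) ^+ 2).
  by rewrite /mean; congr (_ / _); apply: eq_bigr => S _; rewrite sE.
have -> : mean (fun S => #|inner V E S|%:R) = mean (fun S => \sum_(e in E) (e \subset S)%:R).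
  by rewrite /mean; congr (_ / _); apply: eq_bigr => S _; rewrite sE.
rewrite (variance_sum _ (fun e => e \in E) id).
apply: (le_trans (ler_norm_sum _ _ _)).
have C0 : 0 <= c1 ^+ (2 * k) by rewrite exprn_ge0.
have lamk j : 0 <= lam ^+ j by rewrite exprn_ge0.
pose tri e f g := [&& [disjoint e & f], g != e, g != f & g \subset e :|: f].
have h e f : e \in E -> f \in E -> `|P (e :|: f) - P e * P f| <=
   4 * eps * lam ^+ (k + k) + (if ~~ [disjoint f & e] then lam ^+ (2 * k - #|f :&: e|) else 0)
   + \sum_(g in E | tri e f g) lam ^+ (2 * k).
  move=> eE fE.
  have l2 : 0 <= 4 * eps * lam ^+ (k + k) by rewrite !mulr_ge0.
  have s0 : 0 <= \sum_(g in E | tri e f g) lam ^+ (2 * k) by apply: sumr_ge0.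
  case: ifPn => dis.
    apply: (le_trans (cov_any _ _)).
    have -> : #|e :|: f| = (2 * k - #|f :&: e|)%N.
      by rewrite cardsU (unifE _ eE) (unifE _ fE) addnn mul2n setIC.
    by rewrite -addrA -[leLHS]add0r lerD // lerDl.
  rewrite negbK disjoint_sym in dis; rewrite addr0.
  case: (pickP (fun g => (g \in E) && tri e f g)) => [g Hg|none].
    apply: (le_trans (cov_any _ _)).
    have -> : #|e :|: f| = (2 * k)%N.
      by rewrite cardsU (unifE _ eE) (unifE _ fE) (eqP (_ : e :&: f == set0)) ?setI_eq0 // cards0 subn0 addnn mul2n.
    rewrite (bigD1 g) //= addrCA lerDl addr_ge0 //.
    by apply: sumr_ge0.
  rewrite big_pred0 // addr0.
  have := cov_good e f; rewrite !unifE //; apply=> //.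
  apply: approx_prob_pair => //; apply/setP => g; rewrite !inE.
  apply/andP/orP => [[gE gs]|[/eqP->|/eqP->]]; last 2 first.
  - by rewrite eE subsetUl.
  - by rewrite fE subsetUr.
  have := none g; rewrite gE /tri dis gs /= andbT => /negbT.
  by rewrite negb_and !negbK => /orP[] ->; [left|right].
have step : \sum_(e in E) `|\sum_(f in E) (P (e :|: f) - P e * P f)| <=
   \sum_(e in E) \sum_(f in E) (4 * eps * lam ^+ (k + k)) +
   \sum_(e in E) \sum_(f in E) (if ~~ [disjoint f & e] then lam ^+ (2 * k - #|f :&: e|) else 0) +
   \sum_(e in E) \sum_(f in E) \sum_(g in E | tri e f g) lam ^+ (2 * k).
  rewrite -!big_split /=; apply: ler_sum => e eE.
  apply: (le_trans (ler_norm_sum _ _ _)); rewrite -!big_split /=.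
  by apply: ler_sum => f fE; apply: h.
apply: (le_trans step).
have bk0 j : 0 <= beta ^+ j by rewrite exprn_ge0.
have b1 : \sum_(e in E) \sum_(f in E) (4 * eps * lam ^+ (k + k)) <=
   16 * eps * c1 ^+ (2 * k) * (N * beta) ^+ 2.
  under eq_bigr => e _ do rewrite sumr_const -[_ *+ #|_|]mulr_natl.
  rewrite sumr_const -[_ *+ #|_|]mulr_natl.
  have EB := edges_beta_le.
  have EB2 : (#|E|%:R * beta ^+ k) * (#|E|%:R * beta ^+ k) <= (2 * (N * beta)) * (2 * (N * beta)).
    by apply: ler_pM => //; rewrite mulr_ge0.
  have l2 : lam ^+ (k + k) <= c1 ^+ (2 * k) * (beta ^+ k * beta ^+ k).
    by rewrite -exprD; apply: lam_pow_le; rewrite mul2n -addnn.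
  apply: (@le_trans _ _ (#|E|%:R * (#|E|%:R * (4 * eps * (c1 ^+ (2 * k) * (beta ^+ k * beta ^+ k)))))).
    by rewrite !ler_wpM2l // mulr_ge0.
  have := ler_wpM2l (mulr_ge0 (mulr_ge0 (ler0n R 4) eps_ge0) C0) EB2.
  by move: (beta ^+ k) (c1 ^+ _) #|E|%:R => x z u; rewrite expr2; lra.
have EB := edges_beta_le.
have pw : (2 ^ k)%:R = 2 ^+ k :> R by rewrite natrX.
have p0 : 0 <= 2 ^+ k :> R by rewrite exprn_ge0.
have b2 : \sum_(e in E) \sum_(f in E) (if ~~ [disjoint f & e] then lam ^+ (2 * k - #|f :&: e|) else 0)
    <= 4 * 2 ^+ k * c1 ^+ (2 * k) * (N * beta).
  have r e : e \in E -> \sum_(f in E) (if ~~ [disjoint f & e] then lam ^+ (2 * k - #|f :&: e|) else 0)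
     <= 2 ^+ k * (c1 ^+ (2 * k) * (2 * beta ^+ k)).
    move=> eE; rewrite -big_mkcondr.
    apply: (@le_trans _ _ (\sum_(f in E | ~~ [disjoint f & e])
       (fun j => c1 ^+ (2 * k) * beta ^+ (2 * k - j)) #|f :&: e|)).
      by apply: ler_sum => f _; apply: lam_pow_le; rewrite leq_subr.
    rewrite -pw -[in (2 ^ k)%N](unifE _ eE).
    apply: (deg_group R V E e (fun f => ~~ [disjoint f & e])
       (fun j => c1 ^+ (2 * k) * beta ^+ (2 * k - j))) => [|j|f fE fe].
    - by rewrite !mulr_ge0.
    - by rewrite mulr_ge0.
    have j1 : (1 <= #|f :&: e|)%N by rewrite card_gt0 setI_eq0.
    have jk : (#|f :&: e| <= k)%N by rewrite -(unifE _ eE) subset_leq_card // subsetIr.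
    rewrite mulrCA ler_wpM2l // mul2n -addnn -addnBA // addnC exprD mulrA.
    rewrite ler_wpM2r //; apply: (deg_beta_le2 R V k E D beta eta NT).
    by rewrite j1 jk.
  apply: (le_trans (ler_sum _ (fun e eE => r e eE))).
  rewrite sumr_const -[_ *+ #|_|]mulr_natl.
  have := ler_wpM2l (mulr_ge0 p0 C0) EB.
  by move: (beta ^+ k) (c1 ^+ _) (2 ^+ k) #|E|%:R => x z u w; lra.
have b3 : \sum_(e in E) \sum_(f in E) \sum_(g in E | tri e f g) lam ^+ (2 * k)
    <= 8 * 2 ^+ k * c1 ^+ (2 * k) * (N * beta).
  (* With the third edge [g] chosen first, [e] can be grouped by its trace on [g], and [f] must
     contain the rest of [g]. *)
  have -> : \sum_(e in E) \sum_(f in E) \sum_(g in E | tri e f g) lam ^+ (2 * k) =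
     \sum_(g in E) \sum_(e in E) \sum_(f in E | tri e f g) lam ^+ (2 * k).
    rewrite [RHS]exchange_big /=; apply: eq_bigr => e _.
    rewrite (exchange_big_dep (fun g => g \in E)) /=; last by move=> f g _ /andP[].
    by apply: eq_bigr => g gE; apply: eq_bigl => f; rewrite gE.
  have r g : g \in E -> \sum_(e in E) \sum_(f in E | tri e f g) lam ^+ (2 * k)
     <= 2 ^+ k * (c1 ^+ (2 * k) * (4 * beta ^+ k)).
    move=> gE.
    (* For a trace of size [j], the edge [f] contains the [k - j] vertices of [g :\: e], whose
       degree absorbs [beta ^+ j]. The trace is neither empty nor all of [g], since [f] or [e] would
       then equal [g]. *)
    apply: (@le_trans _ _ (\sum_(e in E | (1 <= #|e :&: g| < k)%N)
       (fun j => c1 ^+ (2 * k) * (2 * beta ^+ (2 * k - j))) #|e :&: g|)).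
      rewrite big_mkcondr; apply: ler_sum => e eE.
      case: ifPn => [/andP[j1 jk]|nj]; last first.
        rewrite big_pred0 // => f; apply/negP => /andP[fE /and4P[dis ge gf gs]].
        move: nj; rewrite negb_and -eqn0Ngt cards_eq0 -leqNgt => /orP[/eqP eg0|ge_k].
          have : g \subset f.
            apply/subsetP => x xg; move: (subsetP gs _ xg); rewrite inE => /orP[xe|//].
            by have : x \in e :&: g; [rewrite inE xe xg | rewrite eg0 inE].
          by move=> gsub; move: gf; rewrite eqEcard gsub !unifE //= leqnn.
        have : g \subset e.
          apply/setIidPr/eqP; rewrite eqEcard subsetIr /= unifE //.
        by move=> gsub; move: ge; rewrite eqEcard gsub !unifE //= leqnn.
      apply: (@le_trans _ _ ((deg V E (g :\: e))%:R * lam ^+ (2 * k))).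
        have -> : (deg V E (g :\: e))%:R * lam ^+ (2 * k) = \sum_(f in [set f in E | g :\: e \subset f]) lam ^+ (2 * k).
          by rewrite mulr_natl sumr_const.
        rewrite big_mkcond [leRHS]big_mkcond; apply: ler_sum => f _; rewrite inE.
        case: ifPn => [/andP[fE /and4P[dis ge gf gs]]|_]; last by case: ifP.
        rewrite fE /=; have -> // : g :\: e \subset f.
        apply/subsetP => x; rewrite inE => /andP[xe xg].
        by move: (subsetP gs _ xg); rewrite inE (negbTE xe).
      have cg : #|g :\: e| = (k - #|e :&: g|)%N.
        by rewrite -(unifE _ gE) -(cardsID e g) setIC addKn.
      have hd := deg_beta_le2 R V k E D beta eta NT (g :\: e).
      apply: (@le_trans _ _ ((deg V E (g :\: e))%:R * (c1 ^+ (2 * k) * beta ^+ (2 * k)))).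
        by rewrite ler_wpM2l //; apply: lam_pow_le.
      rewrite mulrCA ler_wpM2l //.
      have -> : beta ^+ (2 * k) = beta ^+ (k - #|g :\: e|) * beta ^+ (2 * k - #|e :&: g|).
        rewrite -exprD; congr (_ ^+ _); rewrite cg.
        by move: #|_| jk => j; clear; lia.
      rewrite mulrA ler_wpM2r //; apply: hd.
      by rewrite cg; move: #|_| j1 jk => j; clear; lia.
    rewrite -pw -[in (2 ^ k)%N](unifE _ gE).
    apply: (deg_group R V E g (fun e => (1 <= #|e :&: g| < k)%N)
       (fun j => c1 ^+ (2 * k) * (2 * beta ^+ (2 * k - j)))) => [|j|e eE /andP[j1 jk]].
    - by rewrite !mulr_ge0.
    - by rewrite !mulr_ge0.
    rewrite mulrCA ler_wpM2l // mulrCA.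
    have -> : 4 * beta ^+ k = 2 * (2 * beta ^+ k) by rewrite mulrA; congr (_ * _); lra.
    rewrite ler_wpM2l // mul2n -addnn -addnBA ?(ltnW jk) // addnC exprD mulrA.
    rewrite ler_wpM2r //; apply: (deg_beta_le2 R V k E D beta eta NT).
    by rewrite j1 ltnW.
  apply: (le_trans (ler_sum _ (fun g gE => r g gE))).
  rewrite sumr_const -[_ *+ #|_|]mulr_natl.
  have := ler_wpM2l (mulr_ge0 p0 C0) EB.
  by move: (beta ^+ k) (c1 ^+ _) (2 ^+ k) #|E|%:R => x z u w; lra.
have b4 : 0 <= 2 ^+ k * c1 ^+ (2 * k) * (N * beta) by rewrite !mulr_ge0 ?ler0n.
have -> : 2 ^+ k.+4 = 16 * 2 ^+ k :> R by rewrite !exprS; lra.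
by move: b1 b2 b3 b4; move: (2 ^+ k) (c1 ^+ _) => x z; lra.
Qed.

End Variance.

(** * Derivatives from quadratic remainder bounds *)

Section LocalBounds.
Import numFieldNormedType.Exports.
Local Open Scope classical_set_scope.
Local Open Scope ring_scope.
Variables (R : realType) (f : R -> R) (x r : R).
Hypothesis r_gt0 : 0 < r.

Lemma continuous_local_lipschitz (L : R) : 0 <= L ->
  (forall y, `|y - x| <= r -> `|f y - f x| <= L * `|y - x|) ->
  {for x, continuous f}.
Proof.
move=> L0 H; apply/cvgrPdist_le => e e0.
have L1 : 0 < L + 1 by rewrite ltr_wpDl.
near=> y.
have h1 : `|y - x| <= r.
  by near: y; apply/nbhs_ballP; exists r => //= z; rewrite /ball /= distrC => /ltW.
have h2 : `|y - x| <= e / (L + 1).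
  near: y; apply/nbhs_ballP; exists (e / (L + 1)) => /=; first by rewrite divr_gt0.
  by move=> z; rewrite /ball /= distrC => /ltW.
rewrite distrC; apply: (le_trans (H y h1)).
apply: (@le_trans _ _ ((L + 1) * (e / (L + 1)))); last by rewrite mulrC divfK // gt_eqF.
by apply: ler_pM => //; rewrite lerDl.
Unshelve. all: by end_near. Qed.

Lemma is_derive_quadratic (K d : R) : 0 <= K ->
  (forall y, `|y - x| <= r -> `|f y - f x - d * (y - x)| <= K * (y - x) ^+ 2) ->
  is_derive x 1 f d.
Proof.
move=> K0 H.
have K1 : 0 < K + 1 by rewrite ltr_wpDl.
have cv : (fun h : R => h^-1 *: (f (h *: 1 + x) - f x)) @ 0^' --> d.
  apply/cvgrPdist_le => e e0; near=> h.
  have h0 : h != 0 by near: h; exact: nbhs_dnbhs_neq.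
  have h1 : `|h| <= r.
    near: h; apply: nbhs_dnbhs; apply/nbhs_ballP; exists r => //= z.
    by rewrite /ball /= sub0r normrN => /ltW.
  have h2 : `|h| <= e / (K + 1).
    near: h; apply: nbhs_dnbhs; apply/nbhs_ballP; exists (e / (K + 1)) => /=.
      by rewrite divr_gt0.
    by move=> z; rewrite /ball /= sub0r normrN => /ltW.
  have hE : h *: 1 + x - x = h by rewrite /GRing.scale /= mulr1 addrK.
  have := H (h *: 1 + x); rewrite hE => /(_ h1) Hh.
  rewrite distrC.
  have -> : h^-1 *: (f (h *: 1 + x) - f x) - d = h^-1 * (f (h *: 1 + x) - f x - d * h).
    by rewrite -[h^-1 *: _]/(h^-1 * _); field.
  rewrite normrM normfV ler_pdivrMl ?normr_gt0 //; apply: (le_trans Hh).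
  rewrite -real_normK ?num_real // expr2 mulrCA ler_wpM2l //.
  apply: (@le_trans _ _ ((K + 1) * (e / (K + 1)))); last by rewrite mulrC divfK // gt_eqF.
  by apply: ler_pM => //; rewrite lerDl.
apply: DeriveDef; first by apply/cvg_ex; exists d.
exact: cvg_lim.
Unshelve. all: by end_near. Qed.

End LocalBounds.

(** * Integration on a segment from quadratic remainder bounds *)

Section SegmentIntegral.
Import numFieldNormedType.Exports.
Local Open Scope classical_set_scope.
Local Open Scope ring_scope.
Variables (R : realType) (c : R).
Hypothesis c_gt0 : 0 < c.

(** Extends functions controlled only on [[0, c]] to the whole line, with continuity preserved, so
    that results about functions on [R] apply. *)
Definition clamp (t : R) : R := Num.max 0 (Num.min t c).

Lemma clamp_range (t : R) : 0 <= clamp t <= c.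
Proof. by rewrite /clamp le_max lexx /= ge_max (ltW c_gt0) ge_min lexx orbT. Qed.

Lemma clamp_id (t : R) : 0 <= t <= c -> clamp t = t.
Proof. by move=> /andP[t0 tc]; rewrite /clamp (min_idPl tc) (max_idPr t0). Qed.

Lemma clamp_lipschitz (s t : R) : `|clamp s - clamp t| <= `|s - t|.
Proof.
wlog st : s t / s <= t.
  move=> h; case: (leP s t) => [|/ltW] st; first exact: h.
  by rewrite distrC [leRHS]distrC h.
have m : clamp s <= clamp t.
  by rewrite /clamp ge_max le_max lexx /= le_max; apply/orP; right; rewrite le_min !ge_min st lexx orbT.
rewrite distrC ger0_norm ?subr_ge0 // distrC ger0_norm ?subr_ge0 //.
rewrite /clamp /Order.max /Order.min; have c0 := c_gt0; move: (0 : R) c0 => z c0.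
by case: (ltP s c) => ?; case: (ltP t c) => ?; (do 2 case: ltP => ?); lra.
Qed.

Lemma clamp_continuous (L : R) (f : R -> R) : 0 <= L ->
  (forall s t, 0 <= s <= c -> 0 <= t <= c -> `|f s - f t| <= L * `|s - t|) ->
  continuous (fun t => f (clamp t)).
Proof.
move=> L0 H t; apply: (continuous_local_lipschitz R (fun t => f (clamp t)) t 1 ltr01 L L0) => s _.
apply: (le_trans (H _ _ (clamp_range s) (clamp_range t))).
by rewrite ler_wpM2l // clamp_lipschitz.
Qed.

Variables (F h : R -> R).
Hypothesis quad : forall t, 0 <= t <= c -> exists K r : R, [/\ 0 <= K, 0 < r &
  forall s, 0 <= s <= c -> `|s - t| <= r -> `|F s - F t - h t * (s - t)| <= K * (s - t) ^+ 2].

Lemma quadratic_continuous : continuous (fun t => F (clamp t)).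
Proof.
move=> t; have [K [r [K0 r0 H]]] := quad (clamp t) (clamp_range t).
apply: (continuous_local_lipschitz R (fun t => F (clamp t)) t r r0 (`|h (clamp t)| + K * r)).
  by rewrite addr_ge0 // mulr_ge0 // ltW.
move=> s sr.
have d1 := clamp_lipschitz s t.
have {}H := H (clamp s) (clamp_range s) (le_trans d1 sr).
set d := clamp s - clamp t in H d1.
apply: (@le_trans _ _ ((`|h (clamp t)| + K * r) * `|d|)); last first.
  by rewrite ler_wpM2l // addr_ge0 // mulr_ge0 // ltW.
have -> : F (clamp s) - F (clamp t) = (F (clamp s) - F (clamp t) - h (clamp t) * d) + h (clamp t) * d by ring.
apply: (le_trans (ler_normD _ _)); rewrite mulrDl addrC; apply: lerD; first by rewrite normrM.
apply: (le_trans H); rewrite -real_normK ?num_real // expr2 -mulrA ler_wpM2l // ler_wpM2r //.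
exact: le_trans sr.
Qed.

Lemma quadratic_is_derive (t : R) : 0 < t < c ->
  is_derive t 1 (fun t => F (clamp t)) (h t).
Proof.
move=> /andP[t0 tc].
have tr : 0 <= t <= c by rewrite !ltW.
have [K [r [K0 r0 H]]] := quad t tr.
pose r' := Num.min r (Num.min t (c - t)).
have r'0 : 0 < r' by rewrite /r' !lt_min r0 t0 subr_gt0.
apply: (is_derive_quadratic R (fun t => F (clamp t)) t r' r'0 K _ K0) => y.
rewrite /r' !le_min => /and3P[y1 y2 y3].
have yr : 0 <= y <= c.
  by move: y2 y3; rewrite !ler_norml => /andP[? ?] /andP[? ?]; apply/andP; split; lra.
by rewrite (clamp_id y yr) (clamp_id t tr); apply: H.
Qed.

(** On the half-open interval each [g t v] agrees with its clamped version, which is continuous and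
    hence integrable on the closed segment; the endpoint [0] is negligible. The fundamental theorem
    then applies to the clamped [F]. *)
Lemma sum_Rintegral_quadratic (V : finType) (g : R -> V -> R) (L : R) : 0 <= L ->
  (forall t, h t = \sum_v g t v) ->
  (forall v s t, 0 <= s <= c -> 0 <= t <= c -> `|g s v - g t v| <= L * `|s - t|) ->
  \sum_v (\int[lebesgue_measure]_(t in `]0, c]%classic) g t v)%R = F c - F 0.
Proof.
move=> L0 hE Hg.
have cg v : continuous (fun t => g (clamp t) v).
  exact: (clamp_continuous L (fun t => g t v) L0 (Hg v)).
have int_of (f : R -> R) : continuous f -> lebesgue_measure.-integrable `[0, c] (EFin \o f).
  move=> cf; apply: (continuous_compact_integrable (@segment_compact _ 0 c)).
  exact: continuous_subspaceT.
have ig v := int_of _ (cg v).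
have step v : (\int[lebesgue_measure]_(t in `]0, c]%classic) g t v)%R =
    (\int[lebesgue_measure]_(t in `[0, c]%classic) g (clamp t) v)%R.
  rewrite -Rintegral_itv_obnd_cbnd.
    apply: eq_Rintegral => t; rewrite inE /= in_itv /= => /andP[t0 tc].
    by rewrite clamp_id // tc ltW.
  by apply: integrableS (ig v) => //; exact: subset_itv_oc_cc.
rewrite (eq_bigr _ (fun v _ => step v)).
have csum (s : seq V) : continuous (fun t => \sum_(v <- s) g (clamp t) v).
  elim: s => [|v s IH] t; first by rewrite (_ : (fun _ => _) = cst 0); [exact: cst_continuous|apply/funext => x; rewrite big_nil].
  rewrite (_ : (fun _ => _) = (fun x => g (clamp x) v + \sum_(v <- s) g (clamp x) v)).
    by apply: continuousD; [exact: cg|exact: IH].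
  by apply/funext => x; rewrite big_cons.
have split_sum (s : seq V) : \sum_(v <- s) (\int[lebesgue_measure]_(t in `[0, c]%classic) g (clamp t) v)%R =
   (\int[lebesgue_measure]_(t in `[0, c]%classic) (\sum_(v <- s) g (clamp t) v))%R.
  elim: s => [|v s IH].
    rewrite big_nil; under eq_Rintegral do rewrite big_nil.
    by rewrite /Rintegral integral0.
  rewrite big_cons IH -RintegralD //; last exact: int_of (csum s).
  by apply: eq_Rintegral => t _; rewrite big_cons.
rewrite split_sum /Rintegral.
rewrite (@continuous_FTC2 _ _ (fun t => F (clamp t))) //.
- rewrite /= !clamp_id ?lexx ?(ltW c_gt0) //.
- exact: continuous_subspaceT (csum _).
- split.
  + by move=> x; rewrite in_itv /= => /quadratic_is_derive[].
  + by apply: cvg_at_right_filter; exact: quadratic_continuous.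
  + by apply: cvg_at_left_filter; exact: quadratic_continuous.
move=> x; rewrite in_itv /= => xc; rewrite derive1E.
have /@derive_val -> := quadratic_is_derive x xc.
by rewrite hE clamp_id //; case/andP: xc => *; rewrite !ltW.
Qed.

End SegmentIntegral.

(** * The Bethe functional along the fixed points *)

Section Flow.
Import mathcomp.boot.fintype mathcomp.boot.finset.
Variables (R : realType) (V : finType) (k : nat) (E : {set {set V}}).
Implicit Types (e f : {set V}) (u v : V).
Variables (D beta eta : R).
Hypothesis NT : near_tree R V k E D beta eta.
Variables (a c1 zeta c : R).
Hypotheses (a_gt1 : 1 < a) (c1_ge1 : 1 <= c1) (c1_eta : c1 * eta <= 2^-1).
Hypotheses (zeta_ge0 : 0 <= zeta).
Hypotheses (c_gt0 : 0 < c) (temper_c : temper R k zeta c <= expR (2 - a)).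
Variable tau : R -> V -> R.
Hypothesis tauP : forall t, 0 < t <= c -> mean_field R V k E D zeta t (tau t).

Local Notation kap := (kap R k).
Local Notation ztemper := (temper R k zeta).
Let k2 : (2 <= k)%N. Proof. by case: NT. Qed.
Let k_gt0 : (0 < k)%N. Proof. exact: leq_trans k2. Qed.
Let unifE e : e \in E -> #|e| = k. Proof. by case: NT => _ + *; apply. Qed.
Let kap_ge1 : 1 <= kap. Proof. exact: (kap_ge1 R V k E D beta eta NT). Qed.
Let kap_gt0 : 0 < kap. Proof. exact: lt_le_trans kap_ge1. Qed.
Let D_gt0 : 0 < D. Proof. exact: (D_gt0 R V k E D beta eta NT c1). Qed.
Let H : R := a + expR (2 - a).
Let H_gt0 : 0 < H. Proof. by rewrite addr_gt0 ?expR_gt0 // (lt_trans ltr01). Qed.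

Lemma temper_le_end (t : R) : 0 < t <= c -> ztemper t <= expR (2 - a).
Proof.
move=> /andP[t0 tc]; apply: le_trans temper_c; rewrite /ztemper ler_wpM2l //.
  by rewrite mulr_ge0 // ltW.
by rewrite lerXn2r // nnegrE ltW // (lt_le_trans t0).
Qed.

Let tau_ge0 (t : R) v : 0 < t <= c -> 0 <= tau t v.
Proof.
move=> tc; have /andP[t0 _] := tc.
exact: (tau_ge0 R V k E D beta eta NT c1 zeta t c1_ge1 c1_eta zeta_ge0 t0 (tau t) (tauP t tc)).
Qed.

Let tau_le (t : R) v : 0 < t <= c -> tau t v <= ztemper t.
Proof.
move=> tc; have /andP[t0 _] := tc; rewrite (tauP t tc).
apply: (fsum_le_temper R V k E D beta eta NT c1) => // e _ _.
by rewrite expR_le1 mulNr oppr_le0 divr_ge0 ?(ltW kap_gt0) ?sumr_ge0 // => u _; apply: tau_ge0.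
Qed.

(** The contraction at parameter [s] replaces the neighbours' values [tau s] by [tau t]. Changing
    the coefficient from [temper s] to [temper t] then adds at most their distance, absorbed in the
    exponent because [a + tau t v >= 1]. *)
Lemma mean_field_step (s t M : R) v : 0 < s <= c -> 0 < t <= c -> 0 <= M ->
  (forall u, a + tau t u <= expR M * (a + tau s u)) ->
  ln (a + tau s v) - ln (a + tau t v) <= rate R a * M + `|ztemper s - ztemper t|.
Proof.
move=> sc tc M0 close.
have /andP[s0 _] := sc; have /andP[t0 _] := tc.
have at1 (r : R) u : 0 < r <= c -> 1 <= a + tau r u.
  by move=> rc; have := tau_ge0 r u rc; move: a_gt1; lra.
have atp (r : R) u : 0 < r <= c -> 0 < a + tau r u.
  by move=> rc; apply: lt_le_trans (at1 r u rc).
rewrite -lnV ?posrE ?atp // -lnM ?posrE ?invr_gt0 ?atp // -ler_expR.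
rewrite lnK ?posrE ?mulr_gt0 ?invr_gt0 ?atp // ler_pdivrMr ?atp //.
have e1 : 1 <= expR (rate R a * M).
  by rewrite -expR0 ler_expR mulr_ge0 // ltW // rate_gt0.
pose X r w := fun e : {set V} => expR (a - w * (a + (\sum_(u in e :\ v) tau r u) / kap)).
have E1 (r : R) : 0 < r <= c -> tau r v = fsum R V k E D zeta r v (X r 1).
  move=> rc; rewrite (tauP r rc); congr (_ * _); apply: eq_bigr => e _.
  by congr expR; rewrite mulNr; lra.
have cont : a + tau s v <= expR (rate R a * M) * (a + fsum R V k E D zeta s v (X s (expR M))).
  rewrite (E1 s sc).
  have -> : fsum R V k E D zeta s v (X s 1) =
     fsum R V k E D zeta s v (fun e => expR (a - (a + (\sum_(u in e :\ v) tau s u) / kap))).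
    by congr (_ * _); apply: eq_bigr => e _; rewrite /X mul1r.
  apply: (fsum_contraction R V k E D beta eta NT a c1) => //.
    exact: temper_le_end.
  move=> e _ _; rewrite lerDl divr_ge0 ?(ltW kap_gt0) // sumr_ge0 // => u _.
  exact: tau_ge0.
have le1 : fsum R V k E D zeta s v (X s (expR M)) <= fsum R V k E D zeta s v (X t 1).
  apply: (fsum_le R V k E D beta eta NT c1) => // e eE ve.
  rewrite /X ler_expR lerD2l lerN2 mul1r.
  rewrite -!(sum_link_shift R V k E D beta eta NT a _ e v eE ve) mulrA mulr_sumr.
  by rewrite ler_pM2r ?invr_gt0 //; apply: ler_sum => u _.
have le2 : fsum R V k E D zeta s v (X t 1) <= tau t v + `|ztemper s - ztemper t|.
  rewrite (E1 t tc); set Y := \sum_(e in E | v \in e) X t 1 e.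
  have fE r : fsum R V k E D zeta r v (X t 1) = ztemper r * (Y / D).
    by rewrite /fsum -/Y mulrAC mulrA.
  rewrite !fE -lerBlDl -mulrBl.
  have Y0 : 0 <= Y / D by rewrite divr_ge0 ?(ltW D_gt0) // sumr_ge0 // => e _; apply: expR_ge0.
  have Y1 : Y / D <= 1.
    rewrite ler_pdivrMr // mul1r.
    have h := sum_edges_const R V k E D beta eta NT v 1 ler01; rewrite mulr1 in h.
    apply: le_trans h; apply: ler_sum => e _.
    rewrite /X mul1r expR_le1 opprD addrA subrr sub0r oppr_le0.
    by rewrite divr_ge0 ?(ltW kap_gt0) // sumr_ge0 // => u _; apply: tau_ge0.
  apply: (@le_trans _ _ (`|ztemper s - ztemper t| * (Y / D))).
    by rewrite ler_wpM2r // ler_norm.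
  by rewrite ler_piMr.
rewrite expRD -mulrA; apply: (le_trans cont).
rewrite ler_wpM2l ?expR_ge0 //.
set d : R := `|ztemper s - ztemper t|; have d0 : 0 <= d by rewrite /d normr_ge0.
apply: (@le_trans _ _ ((1 + d) * (a + tau t v))); last first.
  by rewrite ler_wpM2r ?expR_ge1Dx // ltW // atp.
have : 0 <= d * (a + tau t v - 1) by rewrite mulr_ge0 // subr_ge0 at1.
by move: le1 le2; rewrite -/d; lra.
Qed.

(** The largest logarithmic distance [M] over the vertices satisfies [M <= rate a * M + d] by the
    previous step, so [M <= d / (1 - rate a)]. Leaving the logarithm costs the upper bound [H] of
    [a + tau]. *)
Lemma mean_field_lipschitz (s t : R) v : 0 < s <= c -> 0 < t <= c ->
  `|tau s v - tau t v| <= H / (1 - rate R a) * `|ztemper s - ztemper t|.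
Proof.
move=> sc tc.
have at1 (r : R) u : 0 < r <= c -> 1 <= a + tau r u.
  by move=> rc; have := tau_ge0 r u rc; move: a_gt1; lra.
have atp (r : R) u : 0 < r <= c -> 0 < a + tau r u.
  by move=> rc; apply: lt_le_trans (at1 r u rc).
have atH (r : R) u : 0 < r <= c -> a + tau r u <= H.
  by move=> rc; rewrite lerD2l (le_trans (tau_le r u rc)) // temper_le_end.
have rl1 := rate_lt1 R a a_gt1.
set d : R := `|ztemper s - ztemper t|.
pose M : R := \big[Num.max/0]_(u : V) `|ln (a + tau s u) - ln (a + tau t u)|.
have M0 : 0 <= M by apply: bigmax_ge_id.
have Mu u : `|ln (a + tau s u) - ln (a + tau t u)| <= M.
  exact: (le_bigmax 0 (fun u => `|ln (a + tau s u) - ln (a + tau t u)|) u).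
have close (r1 r2 : R) u : 0 < r1 <= c -> 0 < r2 <= c ->
    ln (a + tau r1 u) - ln (a + tau r2 u) <= M ->
    a + tau r1 u <= expR M * (a + tau r2 u).
  move=> r1c r2c h.
  rewrite -[leLHS]lnK ?posrE ?atp // -[X in _ <= _ * X]lnK ?posrE ?atp //.
  by rewrite -expRD ler_expR -lerBlDr.
have cst u : a + tau s u <= expR M * (a + tau t u).
  by apply: close => //; apply: le_trans (Mu u); apply: ler_norm.
have cts u : a + tau t u <= expR M * (a + tau s u).
  by apply: close => //; apply: le_trans (Mu u); rewrite distrC ler_norm.
have MM : M <= rate R a * M + d.
  apply: bigmax_le => [|u _].
    by rewrite addr_ge0 ?normr_ge0 // mulr_ge0 // ltW // rate_gt0.
  rewrite ler_norml opprD; apply/andP; split.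
    have := mean_field_step t s M u tc sc M0 cst; rewrite distrC -/d; lra.
  exact: mean_field_step.
have Md : M <= d / (1 - rate R a).
  by rewrite ler_pdivlMr ?subr_gt0 //; move: MM; lra.
have key (r1 r2 : R) : 0 < r1 <= c -> 0 < r2 <= c ->
    ln (a + tau r1 v) - ln (a + tau r2 v) <= M -> tau r1 v - tau r2 v <= H * M.
  move=> r1c r2c h.
  have p1 := atp r1 v r1c; have p2 := atp r2 v r2c.
  have h1 : ln ((a + tau r2 v) / (a + tau r1 v)) <= (a + tau r2 v) / (a + tau r1 v) - 1.
    have := @le_ln1Dx R ((a + tau r2 v) / (a + tau r1 v) - 1).
    rewrite addrCA subrr addr0; apply.
    by rewrite ltrBDr addNr divr_gt0.
  rewrite ln_div ?posrE // in h1.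
  have h2 : 1 - (a + tau r2 v) / (a + tau r1 v) <= M by move: h h1; lra.
  have h3 : (a + tau r1 v) * (1 - (a + tau r2 v) / (a + tau r1 v)) = tau r1 v - tau r2 v.
    by field; rewrite gt_eqF.
  rewrite -h3; apply: (@le_trans _ _ ((a + tau r1 v) * M)).
    by rewrite ler_wpM2l // ltW.
  by rewrite ler_wpM2r // atH.
apply: (@le_trans _ _ (H * M)); last first.
  by rewrite -mulrA ler_wpM2l ?(ltW H_gt0) // mulrC.
rewrite ler_norml -[- (H * M)]opprK opprK; apply/andP; split.
  rewrite lerNl opprB; apply: key => //; apply: le_trans (Mu v).
  by rewrite distrC ler_norm.
by apply: key => //; apply: le_trans (Mu v); apply: ler_norm.
Qed.

Lemma expRN_quadratic (z : R) : `|z| <= 2^-1 -> `|expR (- z) - 1 + z| <= 2 * z ^+ 2.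
Proof.
rewrite ler_norml => /andP[z1 z2].
have lo := expR_ge1Dx (- z).
have hi : expR (- z) <= (1 + z)^-1.
  by rewrite expRN lef_pV2 ?posrE ?expR_gt0 ?expR_ge1Dx //; lra.
have h : (1 + z)^-1 <= 1 - z + 2 * z ^+ 2.
  rewrite -div1r ler_pdivrMr; last by lra.
  have : 0 <= z ^+ 2 * (1 + 2 * z) by rewrite mulr_ge0 ?sqr_ge0 //; lra.
  by rewrite expr2; lra.
have := sqr_ge0 z; rewrite ler_norml; move: lo hi h.
by move: (expR (- z)) (z ^+ 2) => x y *; apply/andP; split; lra.
Qed.

Lemma expn_lipschitz n : exists2 L : R, 0 <= L &
  forall s t : R, 0 <= s <= c -> 0 <= t <= c -> `|s ^+ n - t ^+ n| <= L * `|s - t|.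
Proof.
elim: n => [|n [L L0 IH]].
  by exists 0 => // s t _ _; rewrite !expr0 subrr normr0 mul0r.
exists (c * L + c ^+ n) => [|s t sc tc].
  by rewrite addr_ge0 ?mulr_ge0 ?exprn_ge0 // ltW.
have /andP[s0 s1] := sc; have /andP[t0 t1] := tc.
have -> : s ^+ n.+1 - t ^+ n.+1 = s * (s ^+ n - t ^+ n) + t ^+ n * (s - t).
  by rewrite !exprS; move: (s ^+ n) (t ^+ n) => x y; ring.
apply: (le_trans (ler_normD _ _)); rewrite !normrM mulrDl; apply: lerD.
  rewrite (ger0_norm s0) -[leRHS]mulrA; apply: ler_pM => //; exact: IH.
by rewrite ler_wpM2r // ger0_norm ?exprn_ge0 // lerXn2r // nnegrE ltW.
Qed.

Lemma expn_quadratic n : exists2 K : R, 0 <= K &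
  forall s t : R, 0 <= s <= c -> 0 <= t <= c ->
    `|s ^+ n - t ^+ n - n%:R * t ^+ n.-1 * (s - t)| <= K * (s - t) ^+ 2.
Proof.
elim: n => [|n [K K0 IH]].
  by exists 0 => // s t _ _; rewrite !expr0 !mul0r subrr subr0 normr0.
exists (c * K + n%:R * c ^+ n.-1) => [|s t sc tc].
  by rewrite addr_ge0 ?mulr_ge0 ?exprn_ge0 // ltW.
have /andP[s0 s1] := sc; have /andP[t0 t1] := tc.
have -> : s ^+ n.+1 - t ^+ n.+1 - n.+1%:R * t ^+ n.+1.-1 * (s - t) =
   s * (s ^+ n - t ^+ n - n%:R * t ^+ n.-1 * (s - t)) + n%:R * t ^+ n.-1 * (s - t) ^+ 2.
  (* For [n = 0] the exponent [n.-1] is truncated, but its coefficient vanishes. *)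
  case: n {IH} => [|n]; first by rewrite /= !expr0 !expr1 !mul0r; ring.
  rewrite /= [t ^+ n.+2]exprS [s ^+ n.+2]exprS [t ^+ n.+1]exprS -(natr1 n.+1).
  by move: (s ^+ n.+1) (t ^+ n) n.+1%:R => x y z; rewrite expr2; ring.
apply: (le_trans (ler_normD _ _)).
rewrite [X in X + _]normrM [X in _ + X]normrM mulrDl; apply: lerD.
  by rewrite (ger0_norm s0) -[leRHS]mulrA; apply: ler_pM => //; exact: IH.
rewrite (ger0_norm (sqr_ge0 _)) ler_wpM2r ?sqr_ge0 // normrM normr_nat ler_wpM2l //.
by rewrite ger0_norm ?exprn_ge0 // lerXn2r // nnegrE ltW.
Qed.

(* Stationarity of [bethe_fun] in [s = - ln (x / c)]: the derivative of [s |-> expR (- s) * (1 + s)] is [- s * expR (- s)]. *)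
Definition stat (s : V -> R) (b : R) : Prop := forall v,
  s v = b * \sum_(e in E | v \in e) expR (- \sum_(u in e :\ v) s u).
Definition edge_sum (s : V -> R) : R := \sum_(e in E) expR (- \sum_(u in e) s u).
(** The Bethe functional divided by [t], in the coordinates [x_v = t * expR (- s v)] and with
    [b = zeta * t ^+ k.-1 / D]. *)
Definition bethe_fun (s : V -> R) (b : R) : R :=
  \sum_v expR (- s v) * (1 + s v) - b * edge_sum s.

(** Weighting the equation at [v] by [expR (- s v)] completes [e :\ v] to [e], and the incidences
    can be summed edge first. With [h = 1] this evaluates the functional at a stationary point; with
    [h = s' - s] it cancels the first-order variation. *)
Lemma stat_double_count s b (h : V -> R) : stat s b ->
  \sum_v h v * (s v * expR (- s v)) =
  b * \sum_(e in E) expR (- \sum_(u in e) s u) * \sum_(v in e) h v.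
Proof.
move=> st.
transitivity (\sum_v \sum_(e in E | v \in e) b * (expR (- \sum_(u in e) s u) * h v)).
  apply: eq_bigr => v _; rewrite {1}(st v) -mulrA mulrCA -mulr_sumr; congr (_ * _).
  rewrite mulr_suml mulr_sumr; apply: eq_bigr => e /andP[eE ve].
  rewrite -expRD mulrC; congr (_ * _); congr expR.
  by rewrite [in RHS](big_setD1 v ve) /=; lra.
rewrite (exchange_big_dep (fun e => e \in E)) /=; last by move=> v e _ /andP[].
rewrite mulr_sumr; apply: eq_bigr => e eE; rewrite !mulr_sumr.
by apply: eq_bigl => v; rewrite eE.
Qed.

(** For [b] proportional to [t ^+ k.-1] and [s] frozen, the derivative of [t * bethe_fun s b] is
    [bethe_fun s b - kap * (b * edge_sum s)]. This identity reduces it to the sum over the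
    vertices. *)
Lemma bethe_stat s b : stat s b ->
  bethe_fun s b = \sum_v expR (- s v) + kap * (b * edge_sum s).
Proof.
move=> st; rewrite /bethe_fun.
have := stat_double_count s b (fun=> 1) st.
have -> : \sum_(e in E) expR (- \sum_(u in e) s u) * \sum_(v in e) 1 = k%:R * edge_sum s.
  rewrite /edge_sum mulr_sumr; apply: eq_bigr => e eE.
  by rewrite sumr_const unifE // mulrC.
have -> : k%:R = kap + 1 :> R by rewrite -[kap]/(k.-1%:R) natr1 prednK.
have -> : \sum_v expR (- s v) * (1 + s v) = \sum_v expR (- s v) + \sum_v 1 * (s v * expR (- s v)).
  by rewrite -big_split; apply: eq_bigr => v _ /=; ring.
by move=> ->; ring.
Qed.

(** The first-order terms of the vertex sum and of the edge sum cancel by [stat_double_count]. There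
    remain the remainders [p] and [q], quadratic in [d], and the cross term between the changes of
    [b] and [s]. *)
Lemma bethe_fun_expand (s s' : V -> R) (b b' d : R) : stat s b -> 0 <= b ->
  (forall v, 0 <= s v <= H) -> 0 <= d -> (forall v, `|s' v - s v| <= d) -> k%:R * d <= 2^-1 ->
  `|bethe_fun s' b' - bethe_fun s b + (b' - b) * edge_sum s| <=
    #|V|%:R * ((5 + 2 * H) * d ^+ 2) + b * (#|E|%:R * (2 * (k%:R * d) ^+ 2))
     + `|b' - b| * (#|E|%:R * (2 * (k%:R * d))).
Proof.
move=> st b0 sH d0 close kd.
have d2 : d <= 2^-1.
  apply: le_trans kd; rewrite ler_peMl // ler1n //.
pose h v := s' v - s v.
have kd0 : 0 <= k%:R * d by rewrite mulr_ge0.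
have hsum e : e \in E -> `|\sum_(u in e) h u| <= k%:R * d.
  move=> eE; apply: (le_trans (ler_norm_sum _ _ _)).
  rewrite -(unifE _ eE) mulr_natl -sumr_const; apply: ler_sum => u _; exact: close.
have ele e : expR (- \sum_(u in e) s u) <= 1.
  by rewrite expR_le1 oppr_le0 sumr_ge0 // => u _; case/andP: (sH u).
have edec e : expR (- \sum_(u in e) s' u) = expR (- \sum_(u in e) s u) * expR (- \sum_(u in e) h u).
  by rewrite -expRD; congr expR; rewrite /h sumrB; ring.
pose q e := expR (- \sum_(u in e) h u) - 1 + \sum_(u in e) h u.
have qb e : e \in E -> `|q e| <= 2 * (k%:R * d) ^+ 2.
  move=> eE; apply: (le_trans (expRN_quadratic _ (le_trans (hsum e eE) kd))).
  rewrite ler_wpM2l // -real_normK ?num_real // lerXn2r ?nnegrE //; exact: hsum.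
pose p v := expR (- s' v) * (1 + s' v) - expR (- s v) * (1 + s v) + h v * (s v * expR (- s v)).
have pb v : `|p v| <= (5 + 2 * H) * d ^+ 2.
  have hd : `|h v| <= d by exact: close.
  have hq := expRN_quadratic (h v) (le_trans hd d2).
  have h2 : h v ^+ 2 <= d ^+ 2 by rewrite -real_normK ?num_real // lerXn2r ?nnegrE.
  have /andP[s0 s1] := sH v.
  set r := expR (- h v) - 1 + h v in hq.
  have -> : p v = expR (- s v) * (- h v ^+ 2 + r * (1 + s v + h v)).
    rewrite /p; have -> : s' v = s v + h v by rewrite /h; lra.
    have -> : expR (- (s v + h v)) = expR (- s v) * (1 - h v + r).
      rewrite opprD expRD; congr (_ * _); rewrite /r; lra.
    by rewrite expr2; ring.
  rewrite normrM ger0_norm ?expR_ge0 //.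
  apply: (@le_trans _ _ (1 * (d ^+ 2 + 2 * d ^+ 2 * (2 + H)))); last first.
    by rewrite mul1r le_eqVlt; apply/orP; left; apply/eqP; ring.
  apply: ler_pM => //; first by rewrite expR_le1 oppr_le0.
  apply: (le_trans (ler_normD _ _)); rewrite normrN ger0_norm ?sqr_ge0 //.
  apply: lerD => //; rewrite normrM; apply: ler_pM => //.
    by apply: (le_trans hq); rewrite ler_wpM2l.
  move: hd; rewrite !ler_norml => /andP[hd1 hd2]; apply/andP; split; lra.
have dc := stat_double_count s b h st.
have eE' : bethe_fun s' b' - bethe_fun s b + (b' - b) * edge_sum s =
   \sum_v p v - b * (\sum_(e in E) expR (- \sum_(u in e) s u) * q e)
    - (b' - b) * (\sum_(e in E) expR (- \sum_(u in e) s u) * (expR (- \sum_(u in e) h u) - 1)).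
  have -> : \sum_v p v = \sum_v expR (- s' v) * (1 + s' v) - \sum_v expR (- s v) * (1 + s v)
     + b * \sum_(e in E) expR (- \sum_(u in e) s u) * \sum_(v in e) h v.
    by rewrite -dc -sumrB -big_split.
  have e1 : \sum_(e in E) expR (- \sum_(u in e) s u) * (expR (- \sum_(u in e) h u) - 1) = edge_sum s' - edge_sum s.
    rewrite /edge_sum -sumrB; apply: eq_bigr => e _; rewrite edec; ring.
  have e2 : \sum_(e in E) expR (- \sum_(u in e) s u) * q e = (edge_sum s' - edge_sum s)
      + \sum_(e in E) expR (- \sum_(u in e) s u) * \sum_(v in e) h v.
    by rewrite -e1 -big_split; apply: eq_bigr => e _; rewrite /q /=; ring.
  by rewrite e1 e2 /bethe_fun; ring.
rewrite eE'; apply: (le_trans (ler_normB _ _)); apply: lerD.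
  apply: (le_trans (ler_normB _ _)); apply: lerD.
    apply: (le_trans (ler_norm_sum _ _ _)); rewrite mulr_natl -sumr_const.
    by apply: ler_sum => v _.
  rewrite normrM ger0_norm // ler_wpM2l //.
  apply: (le_trans (ler_norm_sum _ _ _)); rewrite mulr_natl -sumr_const.
  apply: ler_sum => e eE; rewrite normrM ger0_norm ?expR_ge0 // -[leRHS]mul1r.
  by apply: ler_pM; rewrite ?expR_ge0 ?qb.
rewrite normrM ler_wpM2l //.
apply: (le_trans (ler_norm_sum _ _ _)); rewrite mulr_natl -sumr_const.
apply: ler_sum => e eE; rewrite normrM ger0_norm ?expR_ge0 // -[leRHS]mul1r.
apply: ler_pM; rewrite ?expR_ge0 //.
have -> : expR (- \sum_(u in e) h u) - 1 = q e - \sum_(u in e) h u by rewrite /q; ring.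
apply: (le_trans (ler_normB _ _)).
have h1 := qb e eE; have h2 := hsum e eE.
have h3 : 2 * (k%:R * d) ^+ 2 <= k%:R * d.
  by rewrite expr2 mulrA ler_piMl //; move: kd; lra.
by move: h1 h2 h3; lra.
Qed.

(* [sg t v] is [- ln (x_v(t) / t)], extended by its limit [0] at [t = 0]. *)
Definition sg (t : R) (v : V) : R := if 0 < t then tau t v / kap else 0.
Definition coupling (t : R) : R := zeta * t ^+ k.-1 / D.
Definition hdens (t : R) : R := \sum_v expR (- sg t v).
Definition bethe (t : R) : R := t * bethe_fun (sg t) (coupling t).

Let kk0 : (0 < k.-1)%N. Proof. by rewrite -ltnS prednK. Qed.

Lemma coupling_ge0 (t : R) : 0 <= t -> 0 <= coupling t.
Proof. by move=> t0; rewrite /coupling !mulr_ge0 ?exprn_ge0 // invr_ge0 ltW. Qed.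

Lemma sg_stat (t : R) : 0 <= t <= c -> stat (sg t) (coupling t).
Proof.
move=> /andP[t0 tc] v; rewrite /sg; case: ifPn => [tp|].
  have tpc : 0 < t <= c by rewrite tp.
  rewrite (tauP t tpc) /fsum /coupling /temper.
  have -> : zeta * kap * t ^+ k.-1 / D = kap * (zeta * t ^+ k.-1 / D) by ring.
  set B := _ / D; set X := \sum_(e in E | _) _.
  have -> : kap * B * X / kap = B * X by field; rewrite gt_eqF.
  congr (_ * _).
  by apply: eq_bigr => e _; congr expR; rewrite mulNr mulr_suml.
rewrite -leNgt => t0'.
have -> : t = 0 by apply/eqP; rewrite eq_le t0 t0'.
by rewrite /coupling expr0n gtn_eqF // mulr0 !mul0r.
Qed.

Lemma sg_range (t : R) v : 0 <= t <= c -> 0 <= sg t v <= H.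
Proof.
move=> /andP[t0 tc]; rewrite /sg; case: ifPn => [tp|_]; last by rewrite lexx ltW.
have tpc : 0 < t <= c by rewrite tp.
rewrite divr_ge0 ?tau_ge0 ?(ltW kap_gt0) //= ler_pdivrMr //.
apply: (@le_trans _ _ H); last by rewrite ler_peMr // ltW.
apply: (le_trans (tau_le t v tpc)); apply: (le_trans (temper_le_end t tpc)).
by rewrite lerDr; move: a_gt1; lra.
Qed.

(** For positive parameters this is [mean_field_lipschitz] and the Lipschitz property of powers.
    When one parameter is [0], the bound [tau r v <= temper r] suffices, since [temper] vanishes at
    [0]. *)
Lemma sg_lipschitz : exists2 L : R, 0 <= L & forall (s t : R) v,
  0 <= s <= c -> 0 <= t <= c -> `|sg s v - sg t v| <= L * `|s - t|.
Proof.
have [L L0 HL] := expn_lipschitz k.-1.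
have rl1 := rate_lt1 R a a_gt1; have rl0 := rate_gt0 R a a_gt1.
set C := H / (1 - rate R a).
have C1 : 1 <= C.
  rewrite /C ler_pdivlMr ?subr_gt0 // mul1r.
  by have := expR_gt0 (2 - a); rewrite /H; move: a_gt1; lra.
have C0 : 0 <= C by exact: le_trans C1.
suff key (s t : R) v : 0 <= s <= c -> 0 <= t <= c ->
    `|sg s v - sg t v| <= C * `|ztemper s - ztemper t|.
  exists (C * (zeta * kap * L)).
    by apply: mulr_ge0 => //; rewrite !mulr_ge0 // ltW.
  move=> s t v sc tc; apply: (le_trans (key s t v sc tc)).
  rewrite -mulrA ler_wpM2l // /temper -mulrBr normrM ger0_norm.
    by rewrite -mulrA ler_wpM2l ?HL // mulr_ge0 // ltW.
  by rewrite mulr_ge0 // ltW.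
have temper0 : ztemper 0 = 0 by rewrite /temper expr0n gtn_eqF // mulr0.
have one r : 0 < r <= c -> `|tau r v / kap| <= C * `|ztemper r|.
  move=> rc; rewrite ger0_norm ?divr_ge0 ?tau_ge0 ?(ltW kap_gt0) //.
  apply: (@le_trans _ _ (tau r v)).
    by rewrite ler_pdivrMr // ler_peMr // tau_ge0.
  apply: (le_trans (tau_le r v rc)).
  apply: (@le_trans _ _ `|ztemper r|); first exact: ler_norm.
  by rewrite ler_peMl.
move=> /andP[s0 s1] /andP[t0 t1]; rewrite /sg.
case: ifPn => sp; case: ifPn => tp.
- rewrite -mulrBl normrM normfV (gtr0_norm kap_gt0) ler_pdivrMr //.
  apply: (@le_trans _ _ (C * `|ztemper s - ztemper t|)).
    by apply: mean_field_lipschitz; rewrite ?sp ?tp.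
  by rewrite ler_peMr // mulr_ge0.
- have -> : t = 0 by apply/eqP; rewrite eq_le t0 leNgt tp.
  by rewrite temper0 !subr0; apply: one; rewrite sp.
- have -> : s = 0 by apply/eqP; rewrite eq_le s0 leNgt sp.
  by rewrite temper0 !sub0r !normrN; apply: one; rewrite tp.
by rewrite subrr normr0 mulr_ge0.
Qed.

(* By stationarity the variation of [sg] contributes only to second order. *)
Lemma bethe_quadratic (t : R) : 0 <= t <= c -> exists K r : R, [/\ 0 <= K, 0 < r &
  forall s, 0 <= s <= c -> `|s - t| <= r ->
    `|bethe s - bethe t - hdens t * (s - t)| <= K * (s - t) ^+ 2].
Proof.
move=> tc; have [L L0 HL] := sg_lipschitz.
have [Lp Lp0 HLp] := expn_lipschitz k.-1.
have [Kp Kp0 HKp] := expn_quadratic k.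
have /andP[t0 t1] := tc.
set z := zeta / D; have z0 : 0 <= z by rewrite divr_ge0 // ltW.
have b0 := coupling_ge0 t t0; have st := sg_stat t tc.
set S := edge_sum (sg t).
have S0 : 0 <= S by apply: sumr_ge0 => e _; apply: expR_ge0.
have kL1 : 0 < 2 * (k%:R * L + 1) :> R by rewrite mulr_gt0 // ltr_wpDl // mulr_ge0.
pose K0 := #|V|%:R * ((5 + 2 * H) * L ^+ 2) + coupling t * (#|E|%:R * (2 * (k%:R * L) ^+ 2))
     + z * Lp * (#|E|%:R * (2 * (k%:R * L))) : R.
have K00 : 0 <= K0.
  have H5 : 0 <= 5 + 2 * H by move: H_gt0; lra.
  have kL0 : 0 <= k%:R * L by rewrite mulr_ge0.
  rewrite /K0; apply: addr_ge0; first apply: addr_ge0.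
  - by apply: mulr_ge0 => //; apply: mulr_ge0 => //; rewrite exprn_ge0.
  - by apply: mulr_ge0 => //; apply: mulr_ge0 => //; rewrite mulr_ge0 // exprn_ge0.
  - apply: mulr_ge0; first exact: mulr_ge0.
    by apply: mulr_ge0 => //; rewrite mulr_ge0.
(* The radius guarantees [k * d <= 1/2] for [d = L * |s - t|], as [bethe_fun_expand] demands. *)
exists (c * K0 + S * (z * Kp)), (2 * (k%:R * L + 1))^-1; split.
- exact: addr_ge0 (mulr_ge0 (ltW c_gt0) K00) (mulr_ge0 S0 (mulr_ge0 z0 Kp0)).
- by rewrite invr_gt0.
move=> s sc sr; have /andP[s0 s1] := sc.
set d := L * `|s - t|.
have d0 : 0 <= d by rewrite mulr_ge0.
have kd : k%:R * d <= 2^-1.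
  apply: (@le_trans _ _ ((k%:R * L + 1) * `|s - t|)).
    by rewrite mulrA ler_wpM2r // lerDl.
  rewrite -ler_pdivlMl; last by rewrite ltr_wpDl // mulr_ge0.
  by rewrite -invfM mulrC.
have J := bethe_fun_expand (sg t) (sg s) (coupling t) (coupling s) d st b0
  (fun v => sg_range t v tc) d0 (fun v => HL s t v sc tc) kd.
have bb : `|coupling s - coupling t| <= z * Lp * `|s - t|.
  have -> : coupling s - coupling t = z * (s ^+ k.-1 - t ^+ k.-1) by rewrite /coupling /z; ring.
  by rewrite normrM (ger0_norm z0) -mulrA ler_wpM2l // HLp.
have {}J : `|bethe_fun (sg s) (coupling s) - bethe_fun (sg t) (coupling t)
     + (coupling s - coupling t) * S| <= K0 * (s - t) ^+ 2.
  apply: (le_trans J).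
  have dE : d ^+ 2 = L ^+ 2 * (s - t) ^+ 2 by rewrite /d exprMn real_normK ?num_real.
  have kdE : (k%:R * d) ^+ 2 = (k%:R * L) ^+ 2 * (s - t) ^+ 2.
    by rewrite exprMn dE exprMn mulrA.
  rewrite dE kdE /K0 [leRHS]mulrDl [X in _ <= X + _]mulrDl; apply: lerD; first by apply: lerD; rewrite !mulrA.
  apply: (@le_trans _ _ (z * Lp * `|s - t| * (#|E|%:R * (2 * (k%:R * d))))).
    by rewrite ler_wpM2r // !mulr_ge0.
  rewrite /d -(real_normK (num_real (s - t))) expr2.
  by rewrite le_eqVlt; apply/orP; left; apply/eqP; ring.
have P := HKp s t sc tc.
have kE : k%:R = kap + 1 :> R by rewrite -[kap]/(k.-1%:R) natr1 prednK.
have tk : t ^+ k = t * t ^+ k.-1 by rewrite -exprS prednK.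
have sk : s ^+ k = s * s ^+ k.-1 by rewrite -exprS prednK.
have BE := bethe_stat (sg t) (coupling t) st.
(* Through [bethe_stat], the explicit change of the coupling leaves exactly the second-order
   remainder of [t ^+ k]. *)
have -> : bethe s - bethe t - hdens t * (s - t) =
   s * (bethe_fun (sg s) (coupling s) - bethe_fun (sg t) (coupling t)
     + (coupling s - coupling t) * S)
   - S * (z * (s ^+ k - t ^+ k - k%:R * t ^+ k.-1 * (s - t))).
  rewrite /bethe kE tk sk BE -/S /coupling /z -/(hdens t).
  by move: (s ^+ k.-1) (t ^+ k.-1) (bethe_fun _ _) (hdens t) => x y w u; ring.
apply: (le_trans (ler_normB _ _)); rewrite [leRHS]mulrDl; apply: lerD.
  rewrite normrM (ger0_norm s0) -[leRHS]mulrA; apply: ler_pM => //.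
rewrite normrM (ger0_norm S0) -[leRHS]mulrA ler_wpM2l // normrM (ger0_norm z0).
by rewrite -[leRHS]mulrA ler_wpM2l.
Qed.

Lemma expRN_lipschitz (x y : R) : 0 <= x -> 0 <= y ->
  `|expR (- x) - expR (- y)| <= `|x - y|.
Proof.
wlog xy : x y / x <= y.
  move=> h x0 y0; case: (leP x y) => [|/ltW] xy; first exact: h.
  by rewrite distrC [leRHS]distrC h.
move=> x0 y0; rewrite ger0_norm ?subr_ge0 ?ler_expR ?lerN2 // distrC ger0_norm ?subr_ge0 //.
have -> : expR (- y) = expR (- x) * expR (- (y - x)) by rewrite -expRD; congr expR; lra.
have e1 : expR (- x) <= 1 by rewrite expR_le1 oppr_le0.
have e2 := expR_ge1Dx (- (y - x)).
have -> : expR (- x) - expR (- x) * expR (- (y - x)) = expR (- x) * (1 - expR (- (y - x))) by ring.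
apply: (@le_trans _ _ (expR (- x) * (y - x))).
  by rewrite ler_wpM2l ?expR_ge0 //; move: e2; lra.
by rewrite ler_piMl // subr_ge0.
Qed.

Lemma sum_Rintegral_sg :
  \sum_v (\int[lebesgue_measure]_(t in `]0, c]%classic) expR (- sg t v))%R = bethe c.
Proof.
have [L L0 HL] := sg_lipschitz.
rewrite (sum_Rintegral_quadratic R c c_gt0 bethe hdens bethe_quadratic V
  (fun t v => expR (- sg t v)) L) //; first by rewrite /bethe mul0r subr0.
move=> v s t sc tc.
have /andP[s0 _] := sg_range s v sc; have /andP[t0 _] := sg_range t v tc.
exact: le_trans (expRN_lipschitz _ _ s0 t0) (HL s t v sc tc).
Qed.

Lemma bethe_ge : c * (#|V|%:R * expR (- H)) <= bethe c.
Proof.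
have cc : 0 <= c <= c by rewrite ltW /=.
rewrite /bethe (bethe_stat _ _ (sg_stat c cc)) ler_wpM2l ?(ltW c_gt0) //.
apply: (@le_trans _ _ (\sum_v expR (- sg c v))).
  rewrite mulr_natl -sumr_const; apply: ler_sum => v _.
  by rewrite ler_expR lerN2; case/andP: (sg_range c v cc).
rewrite lerDl mulr_ge0 ?(ltW kap_gt0) // mulr_ge0 ?coupling_ge0 ?(ltW c_gt0) //.
by apply: sumr_ge0 => e _; apply: expR_ge0.
Qed.

Lemma bethe_le : bethe c <= c * #|V|%:R.
Proof.
have cc : 0 <= c <= c by rewrite ltW /=.
rewrite /bethe ler_wpM2l ?(ltW c_gt0) // /bethe_fun.
apply: (@le_trans _ _ (\sum_v expR (- sg c v) * (1 + sg c v))).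
  rewrite gerBl mulr_ge0 ?coupling_ge0 ?(ltW c_gt0) //.
  by apply: sumr_ge0 => e _; apply: expR_ge0.
rewrite -sumr_const; apply: ler_sum => v _.
by rewrite expRN mulrC ler_pdivrMr ?expR_gt0 // mul1r expR_ge1Dx.
Qed.

Hypothesis zeta_le1 : zeta <= 1.
Variable eps : R.
Hypothesis pinned_single : forall t v, 0 < t <= c ->
  `|pinned_prob R V (t * beta) zeta E [set v] - t * beta * expR (- sg t v)| <= eps * (t * beta).

Let beta_gt0 : 0 < beta. Proof. by case: NT. Qed.

Let wt_set0 (lam : R) : wt R V lam zeta E set0 = 1.
Proof.
rewrite /wt cards0 expr0 mul1r.
have -> : inner V E set0 = set0.
  apply/setP => e; rewrite !inE subset0; apply/andP => -[eE /eqP e0].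
  by have := unifE e eE; rewrite e0 cards0 => k0; have := k_gt0; rewrite -k0.
by rewrite cards0 expr0.
Qed.

(** The partition function at activity [t * beta] as a polynomial in [t], so that its derivative is
    obtained algebraically. *)
Definition Zpoly : {poly R} := \sum_(S : {set V}) wt R V beta zeta E S *: 'X^#|S|.

Lemma horner_Zpoly (t : R) : Zpoly.[t] = Zin R V (t * beta) zeta set0 E.
Proof.
rewrite /Zpoly horner_sum /Zin; apply: eq_big => [S|S _]; first by rewrite sub0set.
rewrite hornerZ hornerXn /wt exprMn.
by move: (t ^+ _) (beta ^+ _) (_ ^+ #|inner V E S|) => x y z; ring.
Qed.

Lemma Zpoly_gt0 (t : R) : 0 <= t -> 0 < Zpoly.[t].
Proof.
move=> t0; rewrite horner_Zpoly /Zin (bigD1 set0) ?sub0set //=.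
apply: ltr_pwDl; last first.
  by apply: sumr_ge0 => S _; rewrite mulr_ge0 ?exprn_ge0 ?subr_ge0 // mulr_ge0 // ltW.
by rewrite wt_set0.
Qed.

Lemma Zpoly_at0 : Zpoly.[0] = 1.
Proof.
rewrite horner_Zpoly mul0r /Zin (bigD1 set0) ?sub0set //= wt_set0 big1 ?addr0 // => S.
by rewrite sub0set -cards_eq0 => /= S0; rewrite /wt expr0n (negbTE S0) mul0r.
Qed.

Lemma deriv_Zpoly (t : R) : 0 < t ->
  t * Zpoly^`().[t] = (\sum_v pinned_prob R V (t * beta) zeta E [set v]) * Zpoly.[t].
Proof.
move=> t0.
rewrite -(mean_sum R V E zeta (t * beta) V xpredT (fun v => [set v])) /mean -horner_Zpoly.
rewrite divfK ?gt_eqF ?Zpoly_gt0 ?(ltW t0) // /Zpoly [(\sum_S _)^`()]linear_sum horner_sum mulr_sumr.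
apply: eq_bigr => S _; rewrite /= derivZ derivXn hornerZ hornerMn hornerXn.
have -> : \sum_v ([set v] \subset S)%:R = #|S|%:R :> R.
  rewrite -sum1_card natr_sum [RHS]big_mkcond; apply: eq_bigr => v _.
  by rewrite sub1set; case: (v \in S).
rewrite /wt exprMn; case: #|S| => [|n]; first by rewrite mulr0n mulr0 mulr0 mul0r.
rewrite /= [t ^+ n.+1]exprS -mulr_natl.
by move: (t ^+ _) (beta ^+ _) (_ ^+ #|inner V E S|) n.+1%:R => x y z w; ring.
Qed.

Import numFieldNormedType.Exports.
Local Open Scope classical_set_scope.
Local Open Scope ring_scope.

(** Both functions vanish at [t = 0], and the derivative of their difference is the summed error of
    the marginals divided by [t]. That error is proportional to [t], so the quotient is bounded down
    to [0] and the mean value theorem concludes. *)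
Lemma log_partition :
  `|ln (Zin R V (c * beta) zeta set0 E) - beta * bethe c| <= eps * (#|V|%:R * beta * c).
Proof.
rewrite -horner_Zpoly.
pose f1 : R -> R := (@ln R) \o horner Zpoly.
pose f2 : R -> R := beta \*: (fun t => bethe (clamp R c t)).
pose df (t : R) : R := (Zpoly.[t])^-1 * Zpoly^`().[t] - beta *: hdens t.
have d1 (t : R) : 0 <= t -> is_derive t 1 f1 ((Zpoly.[t])^-1 * Zpoly^`().[t]).
  move=> t0; apply: is_derive1_comp; exact: is_derive1_ln (Zpoly_gt0 t t0).
have d2 (t : R) : 0 < t < c -> is_derive t 1 f2 (beta *: hdens t).
  by move=> tc; apply: is_deriveZ; apply: (quadratic_is_derive R c bethe hdens bethe_quadratic).
have c2 : continuous f2.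
  move=> t; apply: continuousZr; exact: (quadratic_continuous R c c_gt0 bethe hdens bethe_quadratic).
have cont : {within `[0, c]%classic, continuous (f1 - f2)}.
  apply: continuous_in_subspaceT => t /set_mem; rewrite /= in_itv /= => /andP[t0 _].
  apply: continuousB; last exact: c2.
  apply: differentiable_continuous; apply/derivable1_diffP.
  by have [] := d1 t t0.
have dd (t : R) : t \in `]0, c[ -> is_derive t 1 (f1 - f2) (df t).
  rewrite in_itv /= => tc; have /andP[t0 _] := tc.
  by apply: is_deriveB; [exact: d1 (ltW t0)|exact: d2].
have [t] := MVT c_gt0 dd cont.
rewrite in_itv /= subr0 => /andP[t0 tc].
have -> : (f1 - f2) c - (f1 - f2) 0 = ln Zpoly.[c] - beta * bethe c.
  rewrite /f1 /f2 !fctE /= !clamp_id ?lexx ?(ltW c_gt0) //.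
  by rewrite Zpoly_at0 ln1 /bethe mul0r scaler0 subr0 subr0.
move=> ->; rewrite normrM (gtr0_norm c_gt0) !mulrA ler_wpM2r ?(ltW c_gt0) //.
have tc' : 0 < t <= c by rewrite t0 ltW.
have -> : df t = (\sum_v (pinned_prob R V (t * beta) zeta E [set v] - t * beta * expR (- sg t v))) / t.
  rewrite sumrB -mulr_sumr -/(hdens t) /df.
  have -> : Zpoly^`().[t] = t^-1 * (t * Zpoly^`().[t]) by rewrite mulKf // gt_eqF.
  rewrite deriv_Zpoly // -[beta *: _]/(beta * _).
  by field; rewrite !gt_eqF ?Zpoly_gt0 // ltW.
rewrite normrM normfV (gtr0_norm t0) ler_pdivrMr //.
apply: (le_trans (ler_norm_sum _ _ _)).
have -> : eps * #|V|%:R * beta * t = #|V|%:R * (eps * (t * beta)) by ring.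
by rewrite mulr_natl -sumr_const; apply: ler_sum => v _; apply: pinned_single.
Qed.

End Flow.

(** * Asymptotically tree-like sequences *)

Section Eventually.
Import numFieldNormedType.Exports.
Variable R : realType.

Lemma evn_and (P Q : nat -> Prop) : evn P -> evn Q -> evn (fun n => P n /\ Q n).
Proof.
move=> [m Hm] [p Hp]; exists (maxn m p) => n; rewrite geq_max => /andP[mn pn].
by split; [apply: Hm|apply: Hp].
Qed.

Lemma evn_mono (P Q : nat -> Prop) : (forall n, P n -> Q n) -> evn P -> evn Q.
Proof. by move=> PQ [m Hm]; exists m => n /Hm /PQ. Qed.

Lemma evn_forall_lt (m : nat) (P : nat -> nat -> Prop) : (forall i, (i < m)%N -> evn (P i)) ->
  evn (fun n => forall i, (i < m)%N -> P i n).
Proof.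
elim: m => [|m IH] H; first by exists 0%N.
have [p Hp] := IH (fun i im => H i (leqW im)).
have [q Hq] := H m (ltnSn m).
exists (maxn p q) => n; rewrite geq_max => /andP[pn qn] i; rewrite ltnS leq_eqVlt.
by case/orP => [/eqP -> | im]; [apply: Hq | apply: Hp].
Qed.

(** For a bounded sequence the limit superior is the infimum of the tail suprema, one of which is
    then below [x] and serves as [y]. *)
Lemma limn_sup_lt (u : nat -> R) (B x : R) : (forall n, `|u n| <= B) -> limn_sup u < x ->
  exists2 y, y < x & evn (fun n => u n <= y).
Proof.
move=> uB.
have ub n : has_ubound (sdrop u n).
  by exists B => y [m _ <-]; apply: le_trans (uB m); apply: ler_norm.
have bu : bounded_fun u.
  exists B; split; first exact: num_real.
  by move=> y By n _; apply: le_trans (uB n) (ltW By).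
rewrite limn_supE // => /inf_lt.
case=> [|_ [m _ <-] mx]; first by exists (sups u 0%N), 0%N.
exists (sups u m) => //; exists m => n mn.
by apply: ub_le_sup; [exact: ub | exists n].
Qed.

End Eventually.

(** * Powers of a ratio close to one *)

Section PowerGap.
Variable R : realType.

Lemma expn_near1 (r e : R) n : 0 <= r -> `|r - 1| <= e -> e <= 1 -> `|r ^+ n - 1| <= 2 ^+ n * e.
Proof.
move=> r0 re e1; have e0 : 0 <= e by exact: le_trans re.
have r2 : r <= 2 by move: re; rewrite ler_norml => /andP[_]; move: e1; lra.
suff : `|r ^+ n - 1| <= (2 ^+ n - 1) * e.
  by move=> h; apply: (le_trans h); rewrite ler_wpM2r // gerBl.
elim: n => [|n IH]; first by rewrite !expr0 subrr normr0 mul0r.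
have -> : r ^+ n.+1 - 1 = r * (r ^+ n - 1) + (r - 1) by rewrite exprS; ring.
apply: (le_trans (ler_normD _ _)); rewrite normrM (ger0_norm r0) exprS.
have : r * `|r ^+ n - 1| <= 2 * ((2 ^+ n - 1) * e) by apply: ler_pM.
by move: re; move: (2 ^+ n) => x; lra.
Qed.

End PowerGap.

(** * From the tree-like conditions to [near_tree] *)

Section NearTreeOfHypergraph.
Import mathcomp.boot.fintype mathcomp.boot.finset.
Variables (R : realType) (k : nat) (G : hgraph).
Hypotheses (k2 : (2 <= k)%N) (unifG : uniform k G).
Local Notation D := ((Delta G)%:R : R).
Local Notation delta := (Dpow R k G).
Hypothesis D_ge1 : 1 <= D.

Let D_gt0 : 0 < D. Proof. exact: lt_le_trans ltr01 D_ge1. Qed.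
Let kp : (0 < k.-1)%N. Proof. by rewrite -ltnS prednK // (leq_trans _ k2). Qed.
Let kr : (k.-1)%:R != 0 :> R. Proof. by rewrite pnatr_eq0 -lt0n. Qed.

Lemma Dpow_gt0 : 0 < delta.
Proof. exact: powR_gt0. Qed.

Lemma Dpow_inv : powR D ((k.-1)%:R^-1) = delta^-1.
Proof. by rewrite /Dpow powRN invrK. Qed.

Lemma powR_Dpow (j : nat) : powR D (j%:R / (k.-1)%:R) * delta ^+ j = 1.
Proof.
rewrite -powR_mulrn ?(ltW Dpow_gt0) // /Dpow -powRrM -powRD; last by apply/implyP => _; rewrite gt_eqF.
by rewrite mulNr mulrC addrC [_^-1 * _]mulrC addNr powRr0.
Qed.

Lemma Delta_Dpow : D * delta ^+ k.-1 = 1.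
Proof. by have := powR_Dpow k.-1; rewrite divff // powRr1 // ltW. Qed.

Lemma Dpow_le_of (e : R) : 0 < e -> (e ^+ k.-1)^-1 <= D -> delta <= e.
Proof.
move=> e0 h.
have h1 : delta ^+ k.-1 <= e ^+ k.-1.
  have -> : delta ^+ k.-1 = D^-1.
    by apply: (@mulfI _ D); rewrite ?Delta_Dpow ?divff // gt_eqF.
  by rewrite -[leRHS]invrK lef_pV2 ?posrE ?invr_gt0 ?exprn_gt0.
by rewrite -(@ler_pXn2r _ k.-1) ?nnegrE ?(ltW Dpow_gt0) ?(ltW e0) //.
Qed.

Lemma deg_Delta_l (B : {set 'I_(hN G)}) : (deg _ (hE G) B <= Delta_l G #|B|)%N.
Proof. exact: (@leq_bigmax_cond _ (fun S : {set 'I_(hN G)} => #|S| == #|B|) (@degS G) B (eqxx _)). Qed.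

(** The factor [2 ^+ k] pays for exchanging [Dpow] and [beta], which is at most [2 * Dpow], in
    powers up to [k]. *)
Lemma near_tree_of (beta e : R) : 0 < e -> 2 ^+ k * e <= 1 -> (e ^+ k.-1)^-1 <= D ->
  `|beta - delta| <= e * delta ->
  (forall l, (2 <= l <= k.-1)%N ->
     (Delta_l G l)%:R <= e * powR D ((k - l)%:R / (k.-1)%:R)) ->
  (Gamma k G)%:R <= e * D ->
  near_tree R 'I_(hN G) k (hE G) D beta (2 ^+ k * e).
Proof.
move=> e0 ke De be Hl HG.
have dl := Dpow_gt0; have dle := Dpow_le_of e e0 De.
have e1 : 4 * e <= 1.
  apply: le_trans ke; rewrite ler_wpM2r ?(ltW e0) //.
  have -> : 4 = 2 ^+ 2 :> R by rewrite expr2; lra.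
  by rewrite ler_weXn2l // ler1n.
have [b0 b2] : 0 < beta /\ beta <= 2 * delta.
  have h : e * delta <= 4^-1 * delta by rewrite ler_wpM2r ?(ltW dl) //; move: e1; lra.
  by move: be; rewrite ler_norml => /andP[h1 h2]; split; move: h h1 h2 dl; lra.
have p2 j : (j <= k)%N -> beta ^+ j <= 2 ^+ k * delta ^+ j.
  move=> jk; apply: (@le_trans _ _ ((2 * delta) ^+ j)).
    by rewrite lerXn2r ?nnegrE ?mulr_ge0 ?(ltW b0) ?(ltW dl).
  by rewrite exprMn ler_wpM2r ?exprn_ge0 ?(ltW dl) // ler_weXn2l // ler1n.
split => //.
- apply: (le_trans b2); apply: (@le_trans _ _ (2 * e)); first by rewrite ler_wpM2l.
  rewrite ler_wpM2r ?(ltW e0) // -{1}[2]expr1 ler_weXn2l ?ler1n //.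
  exact: leq_trans k2.
- by move=> v; rewrite ler_nat; have := deg_Delta_l [set v]; rewrite cards1.
- set r := beta / delta.
  have -> : D * beta ^+ k.-1 = r ^+ k.-1.
    have -> : beta = r * delta by rewrite /r divfK // gt_eqF.
    by rewrite exprMn mulrCA Delta_Dpow mulr1.
  have re : `|r - 1| <= e.
    have -> : r - 1 = (beta - delta) / delta by rewrite /r mulrBl divff // gt_eqF.
    by rewrite normrM normfV (gtr0_norm dl) ler_pdivrMr.
  have e1' : e <= 1 by move: e1 e0; lra.
  apply: (le_trans (expn_near1 R r e k.-1 _ re e1')); first by rewrite divr_ge0 // ltW.
  by rewrite ler_wpM2r ?(ltW e0) // ler_weXn2l ?ler1n // leq_pred.
- move=> B /andP[B2 Bk].
  have Bk' : (2 <= #|B| <= k.-1)%N by rewrite B2 /= -ltnS prednK // (leq_trans _ k2).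
  apply: (@le_trans _ _ (e * powR D ((k - #|B|)%:R / (k.-1)%:R) * (2 ^+ k * delta ^+ (k - #|B|)))).
    apply: ler_pM; rewrite ?exprn_ge0 ?ler0n ?(ltW b0) ?p2 ?leq_subr //.
    by apply: le_trans (Hl _ Bk'); rewrite ler_nat deg_Delta_l.
  have := powR_Dpow (k - #|B|); set X := powR _ _; set Y := delta ^+ _ => XY.
  have -> : e * X * (2 ^+ k * Y) = 2 ^+ k * e * (X * Y) by ring.
by rewrite XY mulr1.
move=> v w vw.
apply: (@le_trans _ _ (e * D * (2 ^+ k * delta ^+ k.-1))).
  apply: ler_pM; rewrite ?exprn_ge0 ?ler0n ?(ltW b0) ?p2 ?leq_pred //.
  apply: le_trans HG; rewrite ler_nat.
  exact: (@leq_bigmax_cond _ (fun vv : 'I_(hN G) * 'I_(hN G) => vv.1 != vv.2) (fun vv => #|common_links _ k (hE G) vv.1 vv.2|) (v, w) vw).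
have := Delta_Dpow; set Y := delta ^+ _ => XY.
have -> : e * D * (2 ^+ k * Y) = 2 ^+ k * e * (D * Y) by ring.
by rewrite XY mulr1.
Qed.

End NearTreeOfHypergraph.

(** * Number of vertices bounded below by pair codegrees *)

Section ManyVertices.
Import mathcomp.boot.fintype mathcomp.boot.finset.
Variables (R : realType) (k : nat) (G : hgraph).
Hypotheses (unifG : uniform k G).
Local Notation V := 'I_(hN G).
Local Notation E := (hE G).

Lemma card_sum_mem (T : finType) (A : {set T}) (P : pred T) :
  #|[set x in A | P x]| = (\sum_(x in A) P x)%N.
Proof.
rewrite -sum1_card big_mkcond [RHS]big_mkcond /=; apply: eq_bigr => x _.
by rewrite !inE; case: (x \in A) => //=; case: (P x).
Qed.

(** Double counting of the pairs formed by an edge at [v] and one of its [k.-1] other vertices. *)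
Lemma degree_le_codegree (v : V) :
  (k.-1 * deg V E [set v] <= hN G * Delta_l G 2)%N.
Proof.
have -> : (k.-1 * deg V E [set v] = \sum_(w | w != v) deg V E [set v; w])%N.
  rewrite /deg mulnC -sum_nat_const.
  under [RHS]eq_bigr => w _ do rewrite card_sum_mem.
  rewrite exchange_big /= big_mkcond [RHS]big_mkcond; apply: eq_bigr => e _.
  rewrite !inE sub1set; case eE: (e \in E) => //=; case ve: (v \in e).
    rewrite -(card_link _ E k unifG e v eE ve) -sum1_card big_mkcond [RHS]big_mkcond /=.
    by apply: eq_bigr => w _; rewrite !inE subUset !sub1set ve /=; case: (w != v).
  by rewrite big1 // => w _; rewrite subUset !sub1set ve.
apply: (@leq_trans (\sum_(w : V | w != v) Delta_l G 2)%N).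
  by apply: leq_sum => w wv; have := deg_Delta_l G [set v; w]; rewrite cards2 eq_sym wv.
rewrite sum_nat_const leq_mul2r; apply/orP; right.
by rewrite -[X in (_ <= X)%N]card_ord max_card.
Qed.

Lemma Delta_le_codegree : (k.-1 * Delta G <= hN G * Delta_l G 2)%N.
Proof.
rewrite /Delta {1}/Delta_l; elim/big_rec: _ => [|S m /eqP S1 IH]; first by rewrite muln0.
rewrite maxnMr geq_max IH andbT.
have /cards1P[v ->] : #|S| == 1%N by rewrite S1.
exact: degree_le_codegree.
Qed.

End ManyVertices.

(** * Density of graphs with few common neighbours *)

Section Graphs.
Import mathcomp.boot.fintype mathcomp.boot.finset.
Variables (R : realType) (G : hgraph).
Hypotheses (unifG : uniform 2 G).
Local Notation V := 'I_(hN G).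
Local Notation E := (hE G).

Let adj (v u : V) : bool := [set v; u] \in E.
Let d (v : V) : nat := (\sum_u adj v u)%N.

Let adj_sym v u : adj v u = adj u v.
Proof. by rewrite /adj setUC. Qed.

Let sum_card (P : pred V) : (\sum_u P u)%N = #|[set u | P u]|.
Proof.
rewrite -sum1_card [RHS]big_mkcond /=; apply: eq_bigr => u _; rewrite inE.
by case: (P u).
Qed.

Lemma adj_degree (v : V) : d v = deg V E [set v].
Proof.
rewrite /d sum_card /deg.
have adjn u : adj v u -> u != v.
  by move=> /unifG; rewrite cards2; case: eqVneq => // ->; rewrite eqxx.
rewrite -(card_in_imset (f := fun u => [set v; u])).
  apply: eq_card => e; rewrite !inE sub1set; apply/imsetP/andP => [[u]|[eE ve]].
    by rewrite inE /adj => uE ->; rewrite uE !inE eqxx.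
  have /eqP := unifG e eE; rewrite (cardsD1 v e) ve add1n eqSS => /cards1P[u eu].
  exists u; last by rewrite -(setD1K ve) eu.
  by rewrite inE /adj -eu setD1K.
move=> u w; rewrite !inE => /adjn uv /adjn wv /setP /(_ u).
by rewrite !inE eqxx orbT (negbTE uv) /= => /esym /eqP.
Qed.

Let adj_common (u w : V) : u != w -> (\sum_v adj u v * adj w v <= Gamma 2 G)%N.
Proof.
move=> uw; under eq_bigr => v _ do rewrite mulnb.
rewrite sum_card -(card_imset _ (@set1_inj V)).
apply: (@leq_trans #|common_links V 2 E u w|); last first.
  exact: (@leq_bigmax_cond _ (fun vv : V * V => vv.1 != vv.2)
    (fun vv => #|common_links _ 2 E vv.1 vv.2|) (u, w) uw).
apply/subset_leq_card/subsetP => S /imsetP[v]; rewrite !inE => h ->.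
by rewrite cards1 eqxx.
Qed.

Let degree_le (v : V) : (d v <= Delta G)%N.
Proof. by rewrite adj_degree; have := deg_Delta_l G [set v]; rewrite cards1. Qed.

Lemma sum_degree : (\sum_v d v = 2 * #|E|)%N.
Proof.
under eq_bigr => v _ do rewrite adj_degree /deg card_sum_mem.
rewrite exchange_big /= mulnC -sum_nat_const; apply: eq_bigr => e eE.
rewrite sum_card -(unifG e eE); apply: eq_card => v.
by rewrite inE sub1set.
Qed.

(** The left side counts triples [u], [v], [w] with [v] adjacent to both others. For [u != w] there
    are at most [Gamma] such [v], and for [u = w] at most [Delta]. *)
Lemma sum_degree_sqr_le :
  (\sum_v d v * d v <= hN G * (hN G * Gamma 2 G) + hN G * Delta G)%N.
Proof.
have -> : (\sum_v d v * d v = \sum_u \sum_w \sum_v adj u v * adj w v)%N.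
  under eq_bigr => v _ do rewrite /d big_distrlr /=.
  rewrite exchange_big /=; apply: eq_bigr => u _.
  rewrite exchange_big /=; apply: eq_bigr => w _.
  by apply: eq_bigr => v _; rewrite adj_sym (adj_sym v w).
have cV : #|V| = hN G by rewrite card_ord.
have -> : (hN G * (hN G * Gamma 2 G) + hN G * Delta G =
    \sum_(u : V) (\sum_(w : V) Gamma 2 G + Delta G))%N.
  by rewrite !sum_nat_const cV mulnDr.
apply: leq_sum => u _; rewrite (bigD1 u) //= addnC; apply: leq_add.
  rewrite [X in (_ <= X)%N](bigD1 u) //=; apply: leq_trans (leq_addl _ _).
  by apply: leq_sum => w wu; apply: adj_common; rewrite eq_sym.
apply: leq_trans (degree_le u); apply: leq_sum => v _.
by case: (adj u v).
Qed.

(** With [x = C * Delta], the degree sum is [2 * #|E| >= 2 * x * N], so [0 <= \sum_v (d v - x) ^+ 2]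
    gives [\sum_v d v ^+ 2 >= 4 * x ^+ 2 * N - x ^+ 2 * N]. Against [sum_degree_sqr_le] this forces
    [N] to be large when [Gamma] is much smaller than [Delta]. *)
Lemma graph_density (C : R) : 0 < C -> C * (Delta G)%:R * (hN G)%:R <= #|E|%:R ->
  3 * (C * (Delta G)%:R) ^+ 2 * (hN G)%:R <=
    (hN G)%:R * ((hN G)%:R * (Gamma 2 G)%:R + (Delta G)%:R).
Proof.
move=> C0 CE; set x := C * _ in CE *.
have x0 : 0 <= x by rewrite mulr_ge0 // ltW.
have h : 0 <= \sum_(v : V) ((d v)%:R - x) ^+ 2 by apply: sumr_ge0 => v _; apply: sqr_ge0.
have hE : \sum_(v : V) ((d v)%:R - x) ^+ 2 =
    (\sum_v d v * d v)%N%:R - 2 * x * (\sum_v d v)%N%:R + x ^+ 2 * (hN G)%:R.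
  rewrite !natr_sum mulr_sumr -sumrB.
  have -> : x ^+ 2 * (hN G)%:R = \sum_(v : V) x ^+ 2.
    by rewrite sumr_const card_ord mulr_natr.
  rewrite -big_split /=; apply: eq_bigr => v _; rewrite natrM !expr2; ring.
have s2 : (\sum_v d v * d v)%N%:R <= (hN G)%:R * ((hN G)%:R * (Gamma 2 G)%:R + (Delta G)%:R) :> R.
  have := sum_degree_sqr_le; rewrite -(ler_nat R) => h1; apply: (le_trans h1).
  by rewrite natrD !natrM mulrDr.
have s1 : 2 * x * (2 * (x * (hN G)%:R)) <= 2 * x * (\sum_v d v)%N%:R.
  by rewrite sum_degree natrM; apply: (ler_wpM2l (mulr_ge0 (ler0n R 2) x0)); apply: ler_wpM2l.
by move: h s1 s2; rewrite hE !expr2; lra.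
Qed.

End Graphs.

(** * Fixed points as mean-field solutions *)

Section FixedPoints.
Import mathcomp.boot.fintype mathcomp.boot.finset.
Variables (R : realType) (k : nat) (G : hgraph).
Hypotheses (k2 : (2 <= k)%N) (unifG : uniform k G).
Local Notation V := 'I_(hN G).
Local Notation E := (hE G).
Local Notation D := ((Delta G)%:R : R).
Variables (zeta : R).

Let kap_gt0 : 0 < kap R k.
Proof. by rewrite /kap ltr0n -ltnS prednK // (leq_trans _ k2). Qed.

Definition log_ratio (t : R) (x : V -> R) (v : V) : R := - (kap R k * ln (x v / t)).

Lemma fixed_gt0 (t : R) (x : V -> R) v : 0 < t -> is_fixed t zeta x -> 0 < x v.
Proof. by move=> t0 /(_ v) <-; rewrite mulr_gt0 ?expR_gt0. Qed.

Lemma fixed_expR (t : R) (x : V -> R) v : 0 < t -> is_fixed t zeta x ->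
  t * expR (- log_ratio t x v / kap R k) = x v.
Proof.
move=> t0 fx.
have -> : - log_ratio t x v / kap R k = ln (x v / t).
  by rewrite /log_ratio opprK mulrAC divff ?mul1r ?gt_eqF.
rewrite mulrC lnK; first by rewrite divfK // gt_eqF.
by rewrite posrE divr_gt0 // (fixed_gt0 t x v t0 fx).
Qed.

Lemma fixed_mean_field (t : R) (x : V -> R) : 0 < t -> is_fixed t zeta x ->
  mean_field R V k E D zeta t (log_ratio t x).
Proof.
move=> t0 fx v; rewrite {1}/log_ratio -{1}(fx v) /Fmap.
rewrite [t * _]mulrC mulfK ?gt_eqF // expRK /fsum /temper.
have -> : \sum_(e in E | v \in e) \prod_(u in e :\ v) x u =
   t ^+ k.-1 * \sum_(e in E | v \in e)
      expR (- (\sum_(u in e :\ v) log_ratio t x u) / kap R k).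
  rewrite mulr_sumr; apply: eq_bigr => e /andP[eE ve].
  rewrite -prod_expR_link -(card_link V E k unifG e v eE ve) -prodr_const -big_split /=.
  by apply: eq_bigr => u _; rewrite fixed_expR.
by move: (t ^+ _) (\sum_(e in E | _) _) => y z; ring.
Qed.

Lemma fixed_sg (t : R) (x : R -> V -> R) v : 0 < t ->
  (is_fixed t zeta (x t)) ->
  expR (- sg R V k (fun t => log_ratio t (x t)) t v) = x t v / t.
Proof.
move=> t0 fx; rewrite /sg t0 -mulNr -[X in _ = X / _](fixed_expR t (x t) v t0 fx).
by rewrite [t * _]mulrC mulfK // gt_eqF.
Qed.

Lemma Bfun_bethe (c : R) (x : R -> V -> R) : 0 < c -> is_fixed c zeta (x c) ->
  Bfun c zeta (x c) = bethe R V k E D zeta (fun t => log_ratio t (x t)) c.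
Proof.
move=> c0 fx; set s := sg R V k (fun t => log_ratio t (x t)) c.
have xE v : x c v = c * expR (- s v).
  by rewrite /s fixed_sg // mulrC divfK // gt_eqF.
have lE v : ln (x c v / c) = - s v by rewrite xE mulrC mulKf ?gt_eqF // expRK.
rewrite /Bfun /bethe /bethe_fun -/s /coupling /edge_sum.
have -> : \sum_(e in E) \prod_(u in e) x c u = c ^+ k * \sum_(e in E) expR (- \sum_(u in e) s u).
  rewrite mulr_sumr; apply: eq_bigr => e eE.
  rewrite (eq_bigr _ (fun u _ => xE u)) big_split /= prodr_const unifG //.
  by rewrite -expR_sum sumrN.
have -> : \sum_v x c v * (ln (x c v / c) - 1) = - (c * \sum_v expR (- s v) * (1 + s v)).
  by rewrite mulr_sumr -sumrN; apply: eq_bigr => v _; rewrite lE xE; ring.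
have -> : c ^+ k = c * c ^+ k.-1 by rewrite -exprS prednK // (leq_trans _ k2).
by move: (c ^+ k.-1) (\sum_(e in E) _) (\sum_v _) => y z w; ring.
Qed.

End FixedPoints.

(** * Estimates along the sequence of hypergraphs *)

Section Sequences.
Import mathcomp.boot.fintype mathcomp.boot.finset.
Variables (R : realType) (k : nat) (c : R) (zeta lam : nat -> R) (G : nat -> hgraph).
Hypotheses (k2 : (2 <= k)%N) (c_gt0 : 0 < c) (zeta01 : forall n, 0 < zeta n <= 1).
Hypothesis zeta_limsup : limn_sup (fun n => zeta n * (k.-1)%:R * c ^+ k.-1) < expR 1.
Hypotheses (unifG : forall n, uniform k (G n)) (treeG : tree_like R k G).
Hypothesis lamP : seq_asymp lam (fun n => c * Dpow R k (G n)).

Local Notation D n := ((Delta (G n))%:R : R).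
Local Notation N n := ((hN (G n))%:R : R).
Local Notation delta n := (Dpow R k (G n)).
Local Notation beta n := (lam n / c).

Lemma evn_temper : exists2 a : R, 1 < a & evn (fun n => temper R k (zeta n) c <= expR (2 - a)).
Proof.
have [y ye Hy] : exists2 y : R, y < expR 1 & evn (fun n => zeta n * (k.-1)%:R * c ^+ k.-1 <= y).
  apply: (limn_sup_lt R _ ((k.-1)%:R * c ^+ k.-1)) => // n.
  have /andP[z0 z1] := zeta01 n.
  have p0 : 0 <= (k.-1)%:R * c ^+ k.-1 by rewrite mulr_ge0 // exprn_ge0 // ltW.
  rewrite -mulrA ger0_norm; last exact: mulr_ge0 (ltW z0) p0.
  exact: ler_piMl.
(* With [a = 2 - ln m] one has [expR (2 - a) = m]. The maximum with [1] keeps the argument of [ln]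
   positive, and [m < e] gives [a > 1]. *)
pose m := Num.max y 1.
have m0 : 0 < m by rewrite lt_max ltr01 orbT.
exists (2 - ln m).
  suff : ln m < 1 by lra.
  by rewrite -ltr_expR lnK ?posrE // gt_max ye -{1}expR0 ltr_expR ltr01.
apply: evn_mono Hy => n Hn; rewrite opprB addrCA subrr addr0 lnK ?posrE //.
by apply: (le_trans Hn); rewrite le_max lexx.
Qed.

Lemma evn_Delta (M : R) : evn (fun n => M <= D n).
Proof. by case: treeG. Qed.

Lemma evn_beta (e : R) : 0 < e -> evn (fun n => `|beta n - delta n| <= e * delta n).
Proof.
move=> e0; apply: evn_mono (lamP e e0) => n.
rewrite normrM (gtr0_norm c_gt0) (ger0_norm (powR_ge0 _ _)) -/(Dpow R k (G n)) => h.
have -> : beta n - delta n = (lam n - c * delta n) / c by field; rewrite gt_eqF.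
rewrite normrM normfV (gtr0_norm c_gt0) ler_pdivrMr //; apply: (le_trans h).
by rewrite le_eqVlt; apply/orP; left; apply/eqP; ring.
Qed.

Lemma evn_near_tree (eta : R) : 0 < eta -> eta <= 1 ->
  evn (fun n => near_tree R 'I_(hN (G n)) k (hE (G n)) (D n) (beta n) eta).
Proof.
move=> eta0 eta1; pose e := eta / 2 ^+ k.
have p0 : 0 < 2 ^+ k :> R by rewrite exprn_gt0.
have e0 : 0 < e by rewrite divr_gt0.
have eE : 2 ^+ k * e = eta by rewrite /e mulrC divfK // gt_eqF.
case: treeG => _ Hl HG _.
have {}Hl : evn (fun n => forall l, (l < k)%N -> (2 <= l <= k.-1)%N ->
     (Delta_l (G n) l)%:R <= e * powR (D n) ((k - l)%:R / (k.-1)%:R)).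
  apply: evn_forall_lt => l lk; case: (boolP (2 <= l <= k.-1)%N) => [lr|_]; last by exists 0%N.
  apply: evn_mono (Hl l lr e e0) => n h _.
  by move: h; rewrite normr_nat (ger0_norm (powR_ge0 _ _)).
have h1 := evn_and _ _ (evn_and _ _ (evn_Delta 1) (evn_Delta (e ^+ k.-1)^-1))
  (evn_and _ _ (evn_beta e e0) (evn_and _ _ Hl (HG e e0))).
apply: evn_mono h1 => n [[D1 De] [be [hl hG]]].
rewrite -eE; apply: near_tree_of => //; first by rewrite eE.
  by move=> l lk; apply: hl => //; case/andP: lk => _ lk; rewrite -ltnS prednK // in lk; exact: leq_trans k2.
by move: hG; rewrite !normr_nat.
Qed.

(* For [k >= 3] this is condition (2) at [l = 2]; for [k = 2] that condition is void and (3) and (4) are used instead. *)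
Lemma evn_many_vertices (M : R) : evn (fun n => M <= N n * delta n).
Proof.
suff pos M' : 0 < M' -> evn (fun n => M' <= N n * delta n).
  apply: (evn_mono _ _ _ (pos (Num.max M 1) _)) => [n|]; last by rewrite lt_max ltr01 orbT.
  by move=> h; apply: le_trans h; rewrite le_max lexx.
move=> {M} M0; case: treeG => _ Hl HG [C [C0 HC]].
case: (ltnP 2 k) => k3.
  have l2 : (2 <= 2 <= k.-1)%N by rewrite /= -ltnS prednK // (leq_trans _ k2).
  have h1 := evn_and _ _ (evn_Delta 1) (Hl 2%N l2 M'^-1 _).
  apply: evn_mono (h1 _) => [n [D1]|]; last by rewrite invr_gt0.
  rewrite normr_nat (ger0_norm (powR_ge0 _ _)).
  have X1 := powR_Dpow R k (G n) D1 (k - 2).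
  set X := powR _ _ in X1 *; move=> h.
  have d0 := Dpow_gt0 R k (G n) D1.
  have h2 : (k.-1)%:R * D n <= N n * (M'^-1 * X).
    have := Delta_le_codegree k (G n) (unifG n); rewrite -(ler_nat R) !natrM => h3.
    by apply: (le_trans h3); rewrite ler_wpM2l.
  have h3 : (k.-1)%:R * D n * delta n ^+ k.-1 <= N n * (M'^-1 * X) * delta n ^+ k.-1.
    by rewrite ler_wpM2r // exprn_ge0 // ltW.
  rewrite -mulrA (Delta_Dpow R k (G n) k2 D1) mulr1 in h3.
  have kE : delta n ^+ k.-1 = delta n ^+ (k - 2) * delta n.
    have -> : k.-1 = (k - 2).+1 by case: (k) k3 => [|[|[|j]]] // _; rewrite subn2.
    by rewrite exprSr.
  rewrite kE in h3.
  have {}h3 : 1 <= M'^-1 * (N n * delta n).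
    apply: (@le_trans _ _ (k.-1)%:R); first by rewrite ler1n -ltnS prednK // (leq_trans _ k2).
    apply: (le_trans h3); rewrite le_eqVlt; apply/orP; left; apply/eqP.
    have -> : N n * (M'^-1 * X) * (delta n ^+ (k - 2) * delta n) =
      M'^-1 * (N n * delta n) * (X * delta n ^+ (k - 2)) by ring.
    by rewrite X1 mulr1.
  by rewrite -(ler_pM2l (x := M'^-1)) ?invr_gt0 // mulVf // gt_eqF.
have kE : k = 2%N by apply/eqP; rewrite eqn_leq k3 k2.
(* Of the [3 * C ^+ 2 * D ^+ 2] in [graph_density], one third covers the term [D] once
   [D >= C ^- 2]. The other two thirds are at most [N * Gamma], and this bound on [Gamma / D] then
   yields [N >= M' * D]. *)
have e0 : 0 < 2 * C ^+ 2 / M' by rewrite divr_gt0 // mulr_gt0 // exprn_gt0.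
have h1 := evn_and _ _ (evn_and _ _ (evn_Delta 1) (evn_Delta (C ^+ 2)^-1)) (evn_and _ _ HC (HG _ e0)).
apply: evn_mono h1 => n [[D1 DC] [CE]]; rewrite !normr_nat kE => Ge.
have D0 : 0 < D n by exact: lt_le_trans ltr01 D1.
have N0 : 0 < N n.
  rewrite lt_def ler0n andbT; apply/eqP => N0; move: CE; rewrite N0 invr0 mulr0.
  by apply/negP; rewrite -ltNge mulr_gt0.
have u2 : uniform 2 (G n) by have := unifG n; rewrite kE.
have := graph_density R (G n) u2 C C0; rewrite -ler_pdivlMr // => /(_ CE).
rewrite [leLHS]mulrC ler_pM2l // => h.
have dE : delta n = (D n)^-1.
  have := Delta_Dpow R k (G n) k2 D1; rewrite kE expr1 => h2.
  by apply: (@mulfI _ (D n)); rewrite ?divff ?h2 // gt_eqF.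
rewrite kE in dE; rewrite dE ler_pdivlMr //.
have h2 : N n * (Gamma 2 (G n))%:R <= N n * (2 * C ^+ 2 / M' * D n) by rewrite ler_wpM2l // ltW.
have h3 : 1 * D n <= C ^+ 2 * D n * D n.
  by rewrite ler_wpM2r ?(ltW D0) // -ler_pdivrMl ?mulr1 // exprn_gt0.
have h4 : 2 * C ^+ 2 * D n * D n <= N n * (2 * C ^+ 2 / M') * D n.
  by move: h h2 h3; rewrite exprMn expr2; move: (C ^+ 2 / M') (N n) (C ^+ 2) (D n) => x y z w; lra.
rewrite ler_pM2r // in h4.
rewrite -(ler_pM2l (x := 2 * C ^+ 2 / M')) //.
have -> : 2 * C ^+ 2 / M' * (M' * D n) = 2 * C ^+ 2 * D n by field; rewrite gt_eqF.
by rewrite [leRHS]mulrC.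
Qed.

Lemma Zpart_Zin n : Zpart (G n) (lam n) (zeta n) = Zin R 'I_(hN (G n)) (lam n) (zeta n) set0 (hE (G n)).
Proof. by rewrite /Zpart /Zin; apply: eq_big => [S|S _]; rewrite ?sub0set. Qed.

Lemma muP_pinned_prob n (P : pred {set 'I_(hN (G n))}) (W : {set 'I_(hN (G n))}) : (forall S, P S = (W \subset S)) ->
  muP (lam n) (zeta n) P = pinned_prob R _ (lam n) (zeta n) (hE (G n)) W.
Proof. by move=> PW; rewrite /muP /pinned_prob Zpart_Zin; congr (_ / _); apply: eq_bigl. Qed.

Lemma mvar_mean n (f : {set 'I_(hN (G n))} -> R) : mvar (lam n) (zeta n) f =
  mean R _ (hE (G n)) (zeta n) (lam n) (fun S => f S ^+ 2)
  - mean R _ (hE (G n)) (zeta n) (lam n) f ^+ 2.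
Proof. by rewrite /mvar /mexp Zpart_Zin. Qed.

Let c1 := Num.max 1 c.
Let c1_ge1 : 1 <= c1. Proof. by rewrite le_max lexx. Qed.
Let c_le_c1 : c <= c1. Proof. by rewrite le_max lexx orbT. Qed.

Lemma evn_pinned : exists2 a : R, 1 < a & forall eps : R, 0 < eps ->
  exists eta, [/\ 0 < eta, c1 * eta <= 2^-1 & evn (fun n =>
    [/\ near_tree R 'I_(hN (G n)) k (hE (G n)) (D n) (beta n) eta,
        temper R k (zeta n) c <= expR (2 - a) &
        forall (t : R) (x : 'I_(hN (G n)) -> R), 0 < t <= c -> is_fixed t (zeta n) x ->
        forall W : {set 'I_(hN (G n))}, (#|W| <= 2 * k)%N ->
        `|pinned_prob R _ (t * beta n) (zeta n) (hE (G n)) W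
            - approx_prob R _ (hE (G n)) (zeta n) (fun w => x w * beta n) W|
        <= eps * approx_prob R _ (hE (G n)) (zeta n) (fun w => x w * beta n) W])].
Proof.
have [a a1 Ha] := evn_temper; exists a => // eps eps0.
have [eta [eta0 ceta H]] := pinned_prob_asymp R k a c1 eps k2 a1 c1_ge1 eps0.
exists eta; split => //.
have eta1 : eta <= 1.
  apply: (@le_trans _ _ (c1 * eta)); first by rewrite ler_peMl // ltW.
  by apply: (le_trans ceta); rewrite invf_le1 // ler1n.
apply: evn_mono (evn_and _ _ Ha (evn_near_tree eta eta0 eta1)) => n [tc NT].
split=> // t x tc' fx W Wk; have /andP[t0 t1] := tc'.
have /andP[z0 z1] := zeta01 n.
have tt : temper R k (zeta n) t <= expR (2 - a).
  apply: le_trans tc; rewrite /temper ler_wpM2l //.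
    by rewrite mulr_ge0 // ltW.
  by rewrite lerXn2r // nnegrE ltW // (lt_le_trans t0).
have mf := fixed_mean_field R k (G n) k2 (unifG n) (zeta n) t x t0 fx.
have := H _ (hE (G n)) (D n) (beta n) (zeta n) t _ NT (ltW z0) z1 t0 (le_trans t1 c_le_c1) tt mf W Wk.
rewrite /approx_prob; have -> // : \prod_(w in W) (t * beta n * expR (- log_ratio R k (G n) t x w / kap R k))
  = \prod_(w in W) (x w * beta n).
by apply: eq_bigr => w _; rewrite mulrAC (fixed_expR R k (G n) k2 (zeta n)).
Qed.

Lemma approx_prob_scale (V : finType) (E : {set {set V}}) (z r : R) (y : V -> R) (W : {set V}) :
  approx_prob R V E z (fun w => y w * r) W = r ^+ #|W| * approx_prob R V E z y W.
Proof. by rewrite /approx_prob big_split /= prodr_const mulrA mulrC. Qed.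

Lemma evn_pinned_delta (eps : R) : 0 < eps -> evn (fun n =>
  forall x : 'I_(hN (G n)) -> R, is_fixed c (zeta n) x -> forall W : {set 'I_(hN (G n))}, (#|W| <= k)%N ->
  `|pinned_prob R _ (lam n) (zeta n) (hE (G n)) W
      - approx_prob R _ (hE (G n)) (zeta n) (fun w => x w * delta n) W|
    <= eps * `|approx_prob R _ (hE (G n)) (zeta n) (fun w => x w * delta n) W|).
Proof.
move=> eps0; have [a a1 Ha] := evn_pinned.
pose p : R := 2 ^+ k.
have p1 : 1 <= p by rewrite exprn_ege1 // ler1n.
have p0 : 0 < p by exact: lt_le_trans ltr01 p1.
(* Two relative errors of at most [p * e] add up: the approximation itself, scaled by
   [r ^+ #|W| <= p], and the replacement of [beta] by [Dpow]. *)
pose e := Num.min 1 (eps / (2 * p)).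
have e0 : 0 < e by rewrite lt_min ltr01 divr_gt0 // mulr_gt0.
have e1 : e <= 1 by rewrite ge_min lexx.
have ee : 2 * p * e <= eps.
  by rewrite mulrC -ler_pdivlMr ?mulr_gt0 // ge_min lexx orbT.
have [eta [_ _ He]] := Ha e e0.
apply: evn_mono (evn_and _ _ (evn_and _ _ (evn_Delta 1) (evn_beta e e0)) He).
move=> n [[D1 be] [NT _ H]] x fx W Wk.
set A := approx_prob _ _ _ _ _ W.
have dl := Dpow_gt0 R k (G n) D1.
have b0 : 0 < beta n by case: NT.
have cc : 0 < c <= c by rewrite c_gt0 /=.
have := H c x cc fx W (leq_trans Wk (leq_pmull _ _)); rewrite -[in X in X -> _]mulrC divfK ?gt_eqF // => /(_ isT) {}H.
set r := beta n / delta n.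
have rE : (fun w => x w * beta n) = (fun w => x w * delta n * r).
  by apply/funext => w; rewrite -mulrA /r [delta n * _]mulrC divfK // gt_eqF.
rewrite rE approx_prob_scale -/A in H.
have re : `|r - 1| <= e.
  have -> : r - 1 = (beta n - delta n) / delta n by rewrite /r mulrBl divff // gt_eqF.
  by rewrite normrM normfV (gtr0_norm dl) ler_pdivrMr.
have r0 : 0 <= r by rewrite divr_ge0 // ltW.
have rW : `|r ^+ #|W| - 1| <= p * e.
  apply: (le_trans (expn_near1 R r e #|W| r0 re e1)).
  by rewrite ler_wpM2r ?(ltW e0) // ler_weXn2l ?ler1n.
have r2 : r ^+ #|W| <= p.
  apply: (@le_trans _ _ (2 ^+ #|W|)); last by rewrite ler_weXn2l ?ler1n.
  by rewrite lerXn2r ?nnegrE //; move: re e1; rewrite ler_norml => /andP[_]; lra.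
have A0 : 0 <= A.
  have /andP[z0 z1] := zeta01 n.
  rewrite /A /approx_prob mulr_ge0 ?exprn_ge0 ?subr_ge0 //.
  by apply: prodr_ge0 => w _; rewrite mulr_ge0 ?(ltW dl) // ltW // (fixed_gt0 _ _ _ c x w c_gt0 fx).
rewrite (ger0_norm A0).
have -> : pinned_prob R _ (lam n) (zeta n) (hE (G n)) W - A =
  (pinned_prob R _ (lam n) (zeta n) (hE (G n)) W - r ^+ #|W| * A) + (r ^+ #|W| - 1) * A.
  by rewrite mulrBl mul1r addrA subrK.
apply: (le_trans (ler_normD _ _)); rewrite normrM (ger0_norm A0).
have h1 : e * (r ^+ #|W| * A) <= e * (p * A) by rewrite ler_wpM2l ?(ltW e0) // ler_wpM2r.
have h2 : `|r ^+ #|W| - 1| * A <= p * e * A by rewrite ler_wpM2r.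
have h3 : 2 * p * e * A <= eps * A by rewrite ler_wpM2r.
by move: H h1 h2 h3; lra.
Qed.

(** The constant [c0] precedes [eps], so that the second bound can turn the first into a relative
    error of any size. *)
Lemma evn_log : exists2 c0 : R, 0 < c0 & forall eps : R, 0 < eps -> evn (fun n =>
  forall x : R -> 'I_(hN (G n)) -> R, (forall t, 0 < t <= c -> is_fixed t (zeta n) (x t)) ->
  let B := Bfun c (zeta n) (x c) in
  [/\ `|(delta n)^-1 * ln (Zpart (G n) (lam n) (zeta n)) - B| <= eps * N n,
      c0 * N n <= B &
      \sum_v (\int[lebesgue_measure]_(t in `]0, c]%classic) (x t v / t))%R = B]).
Proof.
have [a a1 Ha] := evn_pinned.
exists (c * expR (- (a + expR (2 - a)))); first by rewrite mulr_gt0 ?expR_gt0.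
move=> eps eps0.
(* In units of [c * e * N * Dpow], replacing [beta] by [Dpow] costs [1] and [log_partition] costs
   [2], because [beta <= 2 * Dpow]. *)
pose e := Num.min 1 (eps / (3 * c)).
have c3 : 0 < 3 * c by rewrite mulr_gt0.
have e0 : 0 < e by rewrite lt_min ltr01 divr_gt0.
have e1 : e <= 1 by rewrite ge_min lexx.
have ee : 3 * c * e <= eps by rewrite mulrC -ler_pdivlMr // ge_min lexx orbT.
have [eta [eta0 ceta He]] := Ha e e0.
apply: evn_mono (evn_and _ _ (evn_and _ _ (evn_Delta 1) (evn_beta e e0)) He).
move=> n [[D1 be] [NT tc H]] x fx /=.
have dl := Dpow_gt0 R k (G n) D1.
have b0 : 0 < beta n by case: NT.
have /andP[z0 z1] := zeta01 n; have z0' := ltW z0.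
pose tau t := log_ratio R k (G n) t (x t).
have mf t : 0 < t <= c -> mean_field R _ k (hE (G n)) (D n) (zeta n) t (tau t).
  by move=> tc'; have /andP[t0 _] := tc'; apply: fixed_mean_field (fx t tc').
have cc : 0 < c <= c by rewrite c_gt0 /=.
have sgE t v : 0 < t <= c -> expR (- sg R _ k tau t v) = x t v / t.
  by move=> tc'; have /andP[t0 _] := tc'; apply: fixed_sg (fx t tc').
have BE : Bfun c (zeta n) (x c) = bethe R _ k (hE (G n)) (D n) (zeta n) tau c.
  exact: Bfun_bethe (fx c cc).
have cN : #|'I_(hN (G n))| = hN (G n) by rewrite card_ord.
have Blo := bethe_ge R _ k (hE (G n)) (D n) (beta n) eta NT a c1 (zeta n) c a1 c1_ge1 ceta z0' c_gt0 tc tau mf.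
have Bhi := bethe_le R _ k (hE (G n)) (D n) (beta n) eta NT c1 (zeta n) c c1_ge1 ceta z0' c_gt0 tau.
have BI := sum_Rintegral_sg R _ k (hE (G n)) (D n) (beta n) eta NT a c1 (zeta n) c a1 c1_ge1 ceta z0' c_gt0 tc tau mf.
have single t v : 0 < t <= c ->
  `|pinned_prob R _ (t * beta n) (zeta n) (hE (G n)) [set v] - t * beta n * expR (- sg R _ k tau t v)|
   <= e * (t * beta n).
  move=> tc'; have /andP[t0 _] := tc'.
  have k1 : (#|[set v]| <= 2 * k)%N by rewrite cards1 muln_gt0 /= (leq_trans _ k2).
  have := H t (x t) tc' (fx t tc') [set v] k1.
  rewrite /approx_prob big_set1 (inner_lt_card _ _ k (unifG n)) ?cards1 // cards0 expr0 mul1r.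
  rewrite sgE //; have -> : t * beta n * (x t v / t) = x t v * beta n.
    by move: (beta n) (x t v) => b y; field; rewrite gt_eqF.
  move=> h; apply: (le_trans h).
  rewrite ler_wpM2l ?(ltW e0) // ler_wpM2r ?(ltW b0) //.
  rewrite -(fx t tc' v) /Fmap ler_piMr ?(ltW t0) // expR_le1 mulNr oppr_le0 mulr_ge0 ?divr_ge0 //.
  by apply: sumr_ge0 => f _; apply: prodr_ge0 => u _; apply/ltW/(fixed_gt0 _ _ _ t _ u t0 (fx t tc')).
have LP := log_partition R _ k (hE (G n)) (D n) (beta n) eta NT a c1 (zeta n) c a1 c1_ge1 ceta z0' c_gt0 tc tau mf z1 e single.
rewrite [c * beta n]mulrC divfK ?gt_eqF // -Zpart_Zin cN in LP.
rewrite cN in Blo Bhi; rewrite BE; split.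
- set B := bethe _ _ _ _ _ _ _ _ in Blo Bhi LP *; set L := ln _ in LP *.
  have -> : (delta n)^-1 * L - B = (delta n)^-1 * ((beta n - delta n) * B + (L - beta n * B)).
    by field; rewrite !gt_eqF.
  rewrite normrM normfV (gtr0_norm dl) ler_pdivrMl //.
  have B0 : 0 <= B by apply: le_trans Blo; rewrite mulr_ge0 ?(ltW c_gt0) // mulr_ge0 ?expR_ge0.
  apply: (le_trans (ler_normD _ _)); rewrite normrM (ger0_norm B0).
  have h1 : `|beta n - delta n| * B <= e * delta n * (c * N n) by apply: ler_pM.
  have b2 : beta n <= 2 * delta n.
    have : e * delta n <= 1 * delta n by rewrite ler_wpM2r // ltW.
    by move: be; rewrite ler_norml => /andP[_]; lra.
  have h2 : e * (N n * beta n * c) <= e * (N n * (2 * delta n) * c).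
    by rewrite ler_wpM2l ?(ltW e0) // ler_wpM2r ?(ltW c_gt0) // ler_wpM2l.
  have h3 : 3 * c * e * (N n * delta n) <= eps * (N n * delta n).
    by rewrite ler_wpM2r // mulr_ge0 // ltW.
  have -> : delta n * (eps * N n) = eps * (N n * delta n) by ring.
  by apply: le_trans h3; move: h1 h2 LP; lra.
- by rewrite -mulrA [expR _ * _]mulrC.
rewrite -BI; apply: eq_bigr => v _; apply: eq_Rintegral => t.
by move=> /set_mem /=; rewrite in_itv /= => tc'; rewrite sgE.
Qed.

(** The terms linear in [N * beta] left by exceptional pairs are of lower order because [N * Dpow]
    tends to infinity: once it is at least [2 / e], [beta >= Dpow / 2] gives
    [1 <= e * (N * beta)]. *)
Lemma evn_variance (eps : R) : 0 < eps -> evn (fun n =>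
  forall x : 'I_(hN (G n)) -> R, is_fixed c (zeta n) x ->
  `|mvar (lam n) (zeta n) (fun S : {set 'I_(hN (G n))} => #|S|%:R)| <= eps * (N n ^+ 2 * delta n ^+ 2) /\
  `|mvar (lam n) (zeta n) (fun S : {set 'I_(hN (G n))} => #|Eof S|%:R)| <= eps * (N n ^+ 2 * delta n ^+ 2)).
Proof.
move=> eps0; have [a a1 Ha] := evn_pinned.
pose C : R := c1 ^+ (2 * k); pose K : R := 16 + 2 ^+ k.+4.
have C0 : 0 < C by rewrite exprn_gt0 // (lt_le_trans ltr01).
have K0 : 0 < K by rewrite addr_gt0 // exprn_gt0.
pose e := Num.min 1 (eps / (4 * K * C)).
have KC : 0 < 4 * K * C by rewrite mulr_gt0 // mulr_gt0.
have e0 : 0 < e by rewrite lt_min ltr01 divr_gt0.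
have e1 : e <= 1 by rewrite ge_min lexx.
have ee : 4 * K * C * e <= eps by rewrite mulrC -ler_pdivlMr // ge_min lexx orbT.
have [eta [eta0 ceta He]] := Ha e e0.
have h2 : 0 < 2^-1 :> R by [].
apply: evn_mono (evn_and _ _ (evn_and _ _ (evn_Delta 1) (evn_beta _ h2))
  (evn_and _ _ (evn_many_vertices (2 / e)) He)).
move=> n [[D1 be] [Nd [NT tc H]]] x fx.
have dl := Dpow_gt0 R k (G n) D1.
have b0 : 0 < beta n by case: NT.
have /andP[z0 z1] := zeta01 n.
have lamE : c * beta n = lam n by rewrite mulrC divfK // gt_eqF.
have l0 : 0 < lam n by rewrite -lamE mulr_gt0.
have llc : lam n <= c1 * beta n by rewrite -[leLHS]lamE ler_wpM2r // ltW.
have l1 : lam n <= 1.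
  apply: (le_trans llc); apply: (@le_trans _ _ (c1 * eta)).
    by rewrite ler_wpM2l ?(le_trans ler01) //; case: NT.
  by apply: (le_trans ceta); rewrite invf_le1 // ler1n.
have cc : 0 < c <= c by rewrite c_gt0 /=.
have HP := H c x cc fx; rewrite lamE in HP.
have y01 v : 0 <= x v * beta n <= lam n.
  have x0 := fixed_gt0 _ _ _ c x v c_gt0 fx.
  rewrite mulr_ge0 ?(ltW x0) ?(ltW b0) //= -[leRHS]lamE ler_wpM2r ?(ltW b0) //.
  rewrite -(fx v) /Fmap ler_piMr ?(ltW c_gt0) // expR_le1 mulNr oppr_le0.
  rewrite mulr_ge0 ?divr_ge0 ?(ltW z0) //.
  by apply: sumr_ge0 => f _; apply: prodr_ge0 => u _; apply/ltW/(fixed_gt0 _ _ _ c x u c_gt0 fx).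
have vs := variance_size_le R _ k (hE (G n)) (D n) (beta n) eta NT (zeta n) (lam n) c1 e
  (fun v => x v * beta n) (ltW z0) z1 l0 l1 c1_ge1 llc (ltW e0) e1 y01 HP.
have ve := variance_edges_le R _ k (hE (G n)) (D n) (beta n) eta NT (zeta n) (lam n) c1 e
  (fun v => x v * beta n) (ltW z0) z1 l0 l1 c1_ge1 llc (ltW e0) e1 y01 HP.
rewrite card_ord -/C in vs ve.
have [b1 b2] : 2^-1 * delta n <= beta n /\ beta n <= 2 * delta n.
  by move: be dl; rewrite ler_norml => /andP[]; split; lra.
have NdN : 0 <= N n * beta n by rewrite mulr_ge0 // ltW.
have q1 : 1 <= e * (N n * beta n).
  rewrite -ler_pdivrMl // mulr1.
  have -> : e^-1 = 2^-1 * (2 / e) by field; rewrite gt_eqF.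
  apply: (@le_trans _ _ (2^-1 * (N n * delta n))); first by rewrite ler_wpM2l.
  by rewrite mulrCA ler_wpM2l.
have q2 : N n * beta n <= e * (N n * beta n) ^+ 2.
  move: NdN q1; move: (N n * beta n) => X X0 q1.
  by rewrite expr2 mulrA -[leLHS]mul1r ler_wpM2r.
have q3 : (N n * beta n) ^+ 2 <= 4 * (N n ^+ 2 * delta n ^+ 2).
  have -> : 4 * (N n ^+ 2 * delta n ^+ 2) = (N n * (2 * delta n)) ^+ 2 by rewrite !expr2; ring.
  by rewrite lerXn2r ?nnegrE // ?mulr_ge0 ?(ltW dl) // ler_wpM2l.
have fin (p q : R) : 0 <= p -> 0 <= q -> p + q <= K ->
    p * e * C * (N n * beta n) ^+ 2 + q * C * (N n * beta n) <= eps * (N n ^+ 2 * delta n ^+ 2).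
  move=> p0 q0 pq; set Y := (N n * beta n) ^+ 2 in q2 q3 *.
  have Y0 : 0 <= Y by exact: sqr_ge0.
  apply: (@le_trans _ _ (K * (e * C * Y))).
    apply: (@le_trans _ _ ((p + q) * (e * C * Y))); last first.
      by rewrite ler_wpM2r // mulr_ge0 // mulr_ge0 // ltW.
    have : q * C * (N n * beta n) <= q * C * (e * Y) by rewrite ler_wpM2l // mulr_ge0 // ltW.
    by lra.
  apply: (@le_trans _ _ (K * (e * C * (4 * (N n ^+ 2 * delta n ^+ 2))))).
    by rewrite ler_wpM2l ?(ltW K0) // ler_wpM2l // mulr_ge0 // ltW.
  have -> : K * (e * C * (4 * (N n ^+ 2 * delta n ^+ 2))) = 4 * K * C * e * (N n ^+ 2 * delta n ^+ 2).
    by move: (N n ^+ 2 * delta n ^+ 2) => z; ring.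
  by rewrite ler_wpM2r // mulr_ge0 // exprn_ge0 // ltW.
have p16 : 0 <= 2 ^+ k.+4 :> R by rewrite exprn_ge0.
by split; rewrite mvar_mean; [apply: (le_trans vs)|apply: (le_trans ve)]; apply: fin => //; rewrite /K; lra.
Qed.

End Sequences.

Theorem mainTheorem16 (R : realType) (k : nat) (c : R) (zeta lam : nat -> R)
  (G : nat -> hgraph)
  (xs : forall n, 'I_(hN (G n)) -> R)
  (xt : forall n, R -> 'I_(hN (G n)) -> R) :
  (2 <= k)%N -> 0 < c -> (forall n, 0 < zeta n <= 1) ->
  limn_sup (fun n => zeta n * (k.-1)%:R * c ^+ k.-1) < expR 1 ->
  (forall n, uniform k (G n)) -> tree_like R k G ->
  seq_asymp lam (fun n => c * Dpow R k (G n)) ->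
  (forall n, is_fixed c (zeta n) (xs n)) ->
  (forall n t, 0 < t <= c -> is_fixed t (zeta n) (xt n t)) ->
  [/\ (* (i) uniformly in v *)
      (forall eps : R, 0 < eps -> evn (fun n => forall v : 'I_(hN (G n)),
         `| muP (lam n) (zeta n) (fun S => v \in S) - xs n v * Dpow R k (G n) |
           <= eps * `| xs n v * Dpow R k (G n) |)),
      (* (ii) uniformly in e *)
      (forall eps : R, 0 < eps -> evn (fun n => forall e, e \in hE (G n) ->
         `| muP (lam n) (zeta n) (fun S => e \subset S)
            - (1 - zeta n) * \prod_(v in e) (xs n v * Dpow R k (G n)) |
           <= eps * `| (1 - zeta n) * \prod_(v in e) (xs n v * Dpow R k (G n)) |)),
      (* (iii) *)
      seq_asymp (fun n => powR (Delta (G n))%:R ((k.-1)%:R^-1) * ln (Zpart (G n) (lam n) (zeta n)))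
            (fun n => \sum_(v : 'I_(hN (G n)))
                        (\int[lebesgue_measure]_(t in `]0, c]%classic) (xt n t v / t))%R),
      (* (iv) *)
      seq_o (fun n => powR (Delta (G n))%:R ((k.-1)%:R^-1)
                          * ln (Zpart (G n) (lam n) (zeta n)) / (hN (G n))%:R
                        - Bfun c (zeta n) (xs n) / (hN (G n))%:R)
              (fun _ => 1)
    & (* (v) *)
      seq_o (fun n => @mvar R (G n) (lam n) (zeta n) (fun S => (#|S|)%:R))
              (fun n => (hN (G n))%:R ^+ 2 * Dpow R k (G n) ^+ 2) /\
      seq_o (fun n => @mvar R (G n) (lam n) (zeta n) (fun S => (#|Eof S|)%:R))
              (fun n => (hN (G n))%:R ^+ 2 * Dpow R k (G n) ^+ 2)].
Proof.
move=> k2 c0 z01 lims unif tl lamP xsf xtf.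
have pd := evn_pinned_delta R k c zeta lam G k2 c0 z01 lims unif tl lamP.
have D1 := evn_Delta R k G tl 1.
have [c00 c00p lg] := evn_log R k c zeta lam G k2 c0 z01 lims unif tl lamP.
have zinv n : 1 <= (Delta (G n))%:R :> R -> powR (Delta (G n))%:R ((k.-1)%:R^-1) = (Dpow R k (G n))^-1.
  by move=> d1; apply: Dpow_inv.
split.
- move=> eps eps0; apply: evn_mono (pd eps eps0) => n H v.
  have k1 : (#|finset.set1 v| <= k)%N by rewrite cards1 (leq_trans _ k2).
  have := H (xs n) (xsf n) _ k1.
  rewrite (muP_pinned_prob _ _ _ _ _ _ (finset.set1 v)); last by move=> S; rewrite finset.sub1set.
  rewrite /approx_prob big_set1 (inner_lt_card _ _ k (unif n)) ?cards1 // cards0 expr0 mul1r //.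
- move=> eps eps0; apply: evn_mono (pd eps eps0) => n H e eE.
  have := H (xs n) (xsf n) e; rewrite (unif n e eE) => /(_ (leqnn k)).
  rewrite (muP_pinned_prob _ _ _ _ _ _ e) // /approx_prob.
  by rewrite (inner_edge _ _ k (unif n)) // cards1 expr1.
- move=> eps eps0; have ec : 0 < eps * c00 by rewrite mulr_gt0.
  apply: evn_mono (evn_and _ _ D1 (lg _ ec)) => n [d1 H].
  have [h1 h2 h3] := H (xt n) (xtf n).
  rewrite zinv // h3; apply: (le_trans h1).
  have B0 : 0 <= Bfun c (zeta n) (xt n c) by apply: le_trans h2; rewrite mulr_ge0 // ltW.
  by rewrite (ger0_norm B0) -mulrA ler_wpM2l // ltW.
- move=> eps eps0.
  apply: evn_mono (evn_and _ _ D1 (lg _ eps0)) => n [d1 H].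
  (* Inserting [xs] into the family at [t = c] makes the uniqueness of the fixed point unnecessary. *)
  pose x t := if t == c then xs n else xt n t.
  have xf t : 0 < t <= c -> is_fixed t (zeta n) (x t).
    by rewrite /x; case: eqVneq => [->|] *; [exact: xsf | exact: xtf].
  have [h1 _ _] := H x xf; move: h1; rewrite /x eqxx => h1.
  rewrite zinv // normr1 mulr1 -mulrBl normrM normfV normr_nat.
  (* Without vertices the quotient is [0] by the convention for [0^-1]. *)
  have [-> | N0] := eqVneq ((hN (G n))%:R : R) 0; first by rewrite invr0 mulr0 ltW.
  by rewrite ler_pdivrMr // lt_def N0 ler0n.
split=> eps eps0;
  apply: evn_mono (evn_variance R k c zeta lam G k2 c0 z01 lims unif tl lamP eps eps0) => n H;
  have [h1 h2] := H (xs n) (xsf n);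
  by rewrite (ger0_norm (mulr_ge0 _ _)) ?exprn_ge0 ?ler0n ?powR_ge0.
Qed.
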